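(* Fix $c>1$ and $\beta>\sqrt{c}$, and let $(n,p,k)\to\infty$ in such a way that $p/n\to c$ and $\dfrac{k}{n/\log p}\to 0$. Let $\hat\Sigma$ be the sample covariance matrix of $n$ samples from the $p$-dimensional single-spike model with signal strength $\beta$ and $k$-sparse spike $\mathbf z$. Let $\hat{\mathbf w}_1$ be the leading (unit-length) eigenvector of $\hat\Sigma$, and let $\operatorname{supp}_k(\hat{\mathbf w}_1)\subseteq\{1,\dots,p\}$ denote the set of indices of its $k$ largest entries in absolute value. Then, with probability tending to one as $(n,p,k)\to\infty$, $$\operatorname{supp}_k(\hat{\mathbf w}_1)=\operatorname{supp}(\mathbf z).$$
   Context: Single-spike model: the spike $\mathbf z\in\mathbb R^p$ is a deterministic unit-length vector with exactly $k$ nonzero entries, each equal to $+1/\sqrt k$ or $-1/\sqrt k$. The samples are $\mathbf x_i=\sqrt{\beta}\,u_i\,\mathbf z+\boldsymbol\xi_i$ for $i=1,\dots,n$, where $\beta>0$ is the signal strength, $u_i\sim N(0,1)$, the vectors $\boldsymbol\xi_i\in\mathbb R^p$ have i.i.d. $N(0,1)$ entries, and all the $u_i$'s and $\boldsymbol\xi_i$'s are mutually independent. The sample covariance matrix is $\hat\Sigma=\frac1n\sum_{i=1}^n\mathbf x_i\mathbf x_i^T$. For a vector $\mathbf x$, $\operatorname{supp}(\mathbf x)=\{i: x_i\neq 0\}$. Asymptotic statements refer to sequences $p=p(n)$, $k=k(n)$ with $n\to\infty$, $p\to\infty$, $k\to\infty$. *)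

(* Defs.v *)
From HB Require Import structures.
From mathcomp Require Import all_boot all_order all_algebra.
From mathcomp Require Import all_classical all_reals all_analysis.

Set Implicit Arguments.
Unset Strict Implicit.
Unset Printing Implicit Defensive.

Import Order.TTheory GRing.Theory Num.Theory.
Import numFieldNormedType.Exports.

Local Open Scope classical_set_scope.
Local Open Scope ring_scope.

Section Vectors.
Context {R : realType} {p : nat}.
Implicit Types (v w : 'cV[R]_p) (A : 'M[R]_p) (S : {set 'I_p}) (k : nat).

(* The norm `|v| provided by the library on matrices is the sup norm. *)
Definition l2norm v : R := Num.sqrt (\sum_(i < p) v i 0 ^+ 2).

Definition supp v : {set 'I_p} := [set i | v i 0 != 0]%SET.

Definition sparse_spike k v : Prop :=
  [/\ l2norm v = 1,
      #|supp v| = k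
    & forall i, i \in supp v ->
        v i 0 = (Num.sqrt k%:R)^-1 \/ v i 0 = - (Num.sqrt k%:R)^-1].

(* [eigenvalue] is defined through row vectors; a square matrix has the same
   left and right eigenvalues. *)
Definition leading_unit_eigenvector A w : Prop :=
  l2norm w = 1 /\
  exists2 lambda : R, A *m w = lambda *: w
                    & forall mu : R, eigenvalue A mu -> mu <= lambda.

(* [S] consists of the indices of [k] largest entries of [w] in absolute value.
   When several entries are tied at the threshold more than one [S] qualifies,
   one for each way of breaking the ties. *)
Definition largest_entries k w S : Prop :=
  #|S| = k /\ forall i j, i \in S -> j \notin S -> `|w j 0| <= `|w i 0|.

End Vectors.

Section Probability.
Context {R : realType}.

Definition mutually_independent d (T : measurableType d)
    (P : probability T R) (I : finType) (X : I -> {RV P >-> R}) : Prop :=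
  forall (J : {set I}) (B : I -> set R), (forall i, measurable (B i)) ->
    P (\bigcap_(i in [set` J]) (X i @^-1` B i)) =
    (\prod_(i in J) P (X i @^-1` B i))%E.

(* The second parameter of [normal_prob] is the standard deviation. *)
Definition standard_normal d (T : measurableType d)
    (P : probability T R) (X : {RV P >-> R}) : Prop :=
  forall B : set R, measurable B -> distribution P X B = normal_prob 0 1 B.

(* The events [E n] hold with probability tending to one.  The inner
   approximation [A n] gives this a meaning without having to assume that
   [E n] is measurable; see [whpE] for the measurable case. *)
Definition with_high_probability (d : nat -> measure_display)
    (T : forall n, measurableType (d n)) (P : forall n, probability (T n) R)
    (E : forall n, set (T n)) : Prop :=
  exists A : forall n, set (T n),
    [/\ forall n, measurable (A n),
        forall n, A n `<=` E n
      & P n (A n) @[n --> \oo] --> 1%E].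

Lemma whpE (d : nat -> measure_display)
    (T : forall n, measurableType (d n)) (P : forall n, probability (T n) R)
    (E : forall n, set (T n)) : (forall n, measurable (E n)) ->
  with_high_probability P E <-> P n (E n) @[n --> \oo] --> 1%E.
Proof.
move=> mE; split=> [[A [mA AE cA]]|cE]; last first.
  by exists E; split=> // n t.
apply: (squeeze_cvge _ cA (cvg_cst 1%E)).
near=> n; rewrite probability_le1// andbT.
by apply: le_measure; rewrite ?inE//; exact: AE.
Unshelve. all: by end_near. Qed.

End Probability.

Section SpikeModel.
Context {R : realType}.

Section Inputs.
Context d (T : measurableType d) (P : probability T R) (n p : nat).
Variables (u : 'I_n -> {RV P >-> R}) (xi : 'I_n -> 'I_p -> {RV P >-> R}).

(* All scalar sources of randomness of the model, as a single family. *)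
Definition noise_family (a : 'I_n + 'I_n * 'I_p) : {RV P >-> R} :=
  match a with
  | inl i => u i
  | inr (i, j) => xi i j
  end.

Definition iid_gaussian_inputs : Prop :=
  mutually_independent noise_family /\
  forall a, standard_normal (noise_family a).

Definition spike_sample (beta : R) (z : 'cV[R]_p) (i : 'I_n) (t : T) :
    'cV[R]_p :=
  (Num.sqrt beta * u i t) *: z + \col_j xi i j t.

End Inputs.

Definition sample_covariance (n p : nat) (x : 'I_n -> 'cV[R]_p) : 'M[R]_p :=
  n%:R^-1 *: \sum_(i < n) x i *m (x i)^T.

End SpikeModel.

(* Main.v *)
(* Reflect the coordinates so that [z] becomes the first basis vector, and write the
   data matrix as [X = a z^T + Y], where [Y z = 0], [Y] is Gaussian with
   [Y Y^T = G G^T] for an [n * (p - 1)] Gaussian matrix [G], and the signal part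
   [a = sqrt beta u + Xi z] is independent of [G].  If [X^T X w = L w] and [L] lies
   above the spectrum of [G G^T], then [w] is proportional to
   [z + Y^T (L - G G^T)^-1 a].  Given [Y], for a fixed [L] the entries of the
   second term are Gaussian of variance of order [1 / n], hence all below
   [1 / (2 sqrt k)] with high probability as [k log p = o(n)]; a union bound over
   a grid of values of [L] removes the dependence of [L] on the data.  The [k]
   largest entries of [w] are then exactly those in the support of [z].

   It remains to separate [L] from the spectrum of [G G^T].  Both the upper bound on
   the latter, [(sqrt c + 1)^2 n], and the lower bound on [L] come from
   steps of the Golub-Kahan bidiagonalisation, which replace a
   Gaussian matrix by independent chi variables and a smaller Gaussian matrix.  For
   the lower bound one evaluates the quadratic form at the geometric vector of ratio
   [r = sqrt c / beta], truncated after [K] steps; as [K] grows this yields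
   [(1 + beta) (1 + c / beta)], which exceeds [(1 + sqrt c)^2] because
   [beta > sqrt c]. *)

Require Import Defs.
From HB Require Import structures.
From mathcomp Require Import all_boot all_order all_algebra.
From mathcomp Require Import all_classical all_reals all_analysis.
From mathcomp Require Import measurable_realfun zify ring lra.

Set Implicit Arguments.
Unset Strict Implicit.
Unset Printing Implicit Defensive.

Import Order.TTheory GRing.Theory Num.Theory.
Import numFieldNormedType.Exports.

Local Open Scope classical_set_scope.
Local Open Scope ring_scope.

(** * The Gaussian measure on the line and on the plane *)

Section GaussianPlane.
Context {R : realType}.
Local Notation mu := (@lebesgue_measure R).
Implicit Types (a b c s : R).

(** All randomness is carried by finite families whose joint law on cylinders is a product of
    standard normal laws ([gauss_family]). Their orthogonal invariance comes from the plane: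
    rotations of two coordinates yield Givens matrices, and these with one change of sign yield
    Householder reflections. The obstacle is that the reflections depend on the data; each is a
    function of a block independent of the block it acts on, and that block can be frozen.

    The eigenvector and its eigenvalue [L] are not known to be measurable, so estimates hold outside
    a measurable exceptional set, for all vectors and all admissible [L] at once. The grid has unit
    steps: since [L = O(n)] it has [O(n)] points, and replacing [L] by a grid point changes an entry
    by [O(1 / n)], negligible against [1 / sqrt k]. Grid points and coordinates give [O(n p)]
    events, each of probability of order [p ^ -4] because [k log p = o(n)].

    In the lower bound on [L] the signal part is the starting direction of the bidiagonalisation:
    once reflected onto the first axis, where the test vector has coordinate [1], it contributes its
    full squared norm. *)

Definition translation a (x : R) := x + a.

Lemma measurable_translation a : measurable_fun [set: R] (translation a).
Proof. exact: measurable_funD. Qed.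

(** The image of the Lebesgue measure under a translation agrees with it on half-open intervals,
    hence everywhere. *)
Lemma ge0_integral_translation a (f : R -> \bar R) :
  measurable_fun [set: R] f -> (forall x, (0 <= f x)%E) ->
  (\int[mu]_x f (translation a x) = \int[mu]_x f x)%E.
Proof.
move=> mf f0.
have mtr : @measurable_fun _ _ (measurableTypeR R) (measurableTypeR R) setT
  (translation a) := measurable_translation a.
pose tr : {mfun measurableTypeR R >-> measurableTypeR R} := HB.pack (translation a)
  (isMeasurableFun.Build _ _ _ _ _ mtr).
rewrite -[LHS](ge0_integral_pushforward mtr mu measurableT)//.
apply: eq_measure_integral => A mA _.
apply/esym; apply: (@lebesgue_measure_unique R (pushforward mu tr)) => //.
move=> X [[x y] _ <-].
transitivity (mu `](x - a), (y - a)]%classic); last first.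
  rewrite /= /pushforward; congr (mu _).
  by apply/seteqP; split => t /=; rewrite !in_itv/= ltrBlDr lerBrDr.
rewrite !lebesgue_measure_itv/= !lte_fin ltrD2r; case: ifPn => // _.
by rewrite -!EFinB; congr (_%:E); ring.
Qed.

Definition shear1 a (z : R * R) := (z.1 + a * z.2, z.2).
Definition shear2 a (z : R * R) := (z.1, z.2 + a * z.1).
Definition rotation c s (z : R * R) := (c * z.1 - s * z.2, s * z.1 + c * z.2).

Lemma measurable_shear1 a : measurable_fun [set: R * R] (shear1 a).
Proof.
apply: measurable_fun_pair => //.
by apply: measurable_funD => //; apply: measurable_funM.
Qed.

Lemma measurable_shear2 a : measurable_fun [set: R * R] (shear2 a).
Proof.
apply: measurable_fun_pair => //.
by apply: measurable_funD => //; apply: measurable_funM.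
Qed.

Lemma measurable_rotation c s : measurable_fun [set: R * R] (rotation c s).
Proof.
apply: measurable_fun_pair => //.
  by apply: measurable_funB => //; apply: measurable_funM.
by apply: measurable_funD => //; apply: measurable_funM.
Qed.

Lemma ge0_integral_shear1 a (f : R * R -> \bar R) :
  measurable_fun [set: R * R] f -> (forall x, (0 <= f x)%E) ->
  (\int[mu \x mu]_z f (shear1 a z) = \int[mu \x mu]_z f z)%E.
Proof.
move=> mf f0.
have mg := measurableT_comp mf (measurable_shear1 a).
rewrite [LHS](@fubini_tonelli2 _ _ _ _ _ mu mu _ mg (fun z => f0 _)).
rewrite [RHS](@fubini_tonelli2 _ _ _ _ _ mu mu _ mf f0).
apply: eq_integral => y _ /=.
rewrite /fubini_G/= -[RHS](@ge0_integral_translation (a * y))//.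
by apply: measurableT_comp => //; exact: measurable_pair2.
Qed.

Lemma ge0_integral_shear2 a (f : R * R -> \bar R) :
  measurable_fun [set: R * R] f -> (forall x, (0 <= f x)%E) ->
  (\int[mu \x mu]_z f (shear2 a z) = \int[mu \x mu]_z f z)%E.
Proof.
move=> mf f0.
have mg := measurableT_comp mf (measurable_shear2 a).
rewrite [LHS](@fubini_tonelli1 _ _ _ _ _ mu mu _ mg (fun z => f0 _)).
rewrite [RHS](@fubini_tonelli1 _ _ _ _ _ mu mu _ mf f0).
apply: eq_integral => y _ /=.
rewrite /fubini_F/= -[RHS](@ge0_integral_translation (a * y))//.
by apply: measurableT_comp => //; exact: measurable_pair1.
Qed.

(* A rotation by an angle that is not a multiple of [pi] is a product of three
   shears, and shears preserve the Lebesgue measure by Fubini. *)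
Lemma ge0_integral_rotation c s (f : R * R -> \bar R) :
  c ^+ 2 + s ^+ 2 = 1 -> s != 0 ->
  measurable_fun [set: R * R] f -> (forall x, (0 <= f x)%E) ->
  (\int[mu \x mu]_z f (rotation c s z) = \int[mu \x mu]_z f z)%E.
Proof.
(* For an angle [t] this is [- tan (t / 2)]: the rotation is the shear by [a] along the first axis,
   then by [s] along the second, then by [a] along the first again. *)
move=> cs s0 mf f0; pose a := (c - 1) / s.
have m1 := measurable_shear1 a.
have m2 := measurable_shear2 s.
rewrite -[RHS](@ge0_integral_shear1 a f)//.
rewrite -[RHS](@ge0_integral_shear2 s (f \o shear1 a)); last 2 first.
- exact: (measurableT_comp mf m1).
- by move=> x; exact: f0.
rewrite -[RHS](@ge0_integral_shear1 a (f \o shear1 a \o shear2 s)); last 2 first.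
- exact: (measurableT_comp (measurableT_comp mf m1) m2).
- by move=> x; exact: f0.
apply: eq_integral => -[x y] _ /=; rewrite /rotation/shear1/shear2/=.
have as_ : a * s = c - 1 by rewrite /a divfK.
have aas : a * (2 + a * s) = - s.
  by rewrite as_ /a; apply: (mulIf s0); rewrite mulrAC divfK//; nra.
congr (f (_, _)).
  transitivity ((1 + a * s) * x + a * (2 + a * s) * y); last by ring.
  by rewrite aas as_; ring.
transitivity (s * x + (1 + a * s) * y); last by ring.
by rewrite as_; ring.
Qed.

Local Notation np := (@normal_prob R 0 1).
Local Notation phi := (@normal_pdf R 0 1).

Lemma normal_pdf01 (x : R) : phi x = normal_peak 1 * expR (- x ^+ 2 / 2).
Proof. by rewrite normal_pdfE ?oner_eq0// /normal_fun subr0 expr1n. Qed.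

Let measurable_pdf : measurable_fun [set: R] phi.
Proof. exact: measurable_normal_pdf. Qed.

Import HBNNSimple.

(** Linearity reduces a simple function to indicators of its level sets, for which the formula is
    the definition of [normal_prob]; monotone convergence extends it to nonnegative functions
    next. *)
Let integral_np_nnsfun (f : {nnsfun R >-> R}) :
  (\int[np]_x (f x)%:E = \int[mu]_x (f x * phi x)%:E)%E.
Proof.
have mi r : measurable_fun [set: R] (\1_(f @^-1` [set r]) : R -> R).
  by apply: measurable_indic; exact: measurable_funPTI.
under [LHS]eq_integral do rewrite fimfunE -fsumEFin//.
rewrite [LHS]ge0_integral_fsum//; last 2 first.
  - move=> r; apply/measurable_EFinP; apply: measurable_funM => /=; [exact: measurable_cst|exact: mi].
  - by move=> n x _; rewrite EFinM; exact: nnfun_muleindic_ge0.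
under [RHS]eq_integral.
  move=> x xD; rewrite fimfunE EFinM -fsumEFin// ge0_mule_fsuml; last first.
    by move=> r; rewrite EFinM; exact: nnfun_muleindic_ge0.
  over.
rewrite [RHS]ge0_integral_fsum//; last 2 first.
  - move=> r; rewrite /=; apply: emeasurable_funM; apply/measurable_EFinP => //.
    by apply: measurable_funM => /=; [exact: measurable_cst|exact: mi].
  - move=> n x _; apply: mule_ge0; last by rewrite lee_fin normal_pdf_ge0.
    by rewrite EFinM; exact: nnfun_muleindic_ge0.
apply: eq_fsbigr => r rf.
have [r0|r0] := leP 0 r; last first.
  rewrite (_ : f @^-1` [set r] = set0) ?preimage_nnfun0//.
  by rewrite !integral0_eq// => x _; rewrite indic0/= mulr0 ?mul0e.
under [LHS]eq_integral => x _ do rewrite EFinM.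
rewrite [LHS]ge0_integralZl//; last first.
  by apply/measurable_EFinP; exact: mi.
under [RHS]eq_integral => x _ do rewrite EFinM -muleA.
rewrite ge0_integralZl//; last 2 first.
  - apply: emeasurable_funM; apply/measurable_EFinP => //; exact: mi.
  - by move=> x _; rewrite -EFinM lee_fin mulr_ge0 ?normal_pdf_ge0.
congr (_ * _)%E; transitivity (np (f @^-1` [set r])).
  have mA : measurable (f @^-1` [set r]) by exact: measurable_funPTI.
  by rewrite (@integral_indic _ _ _ np)// setIT.
rewrite /normal_prob [LHS]integral_mkcond.
apply: eq_integral => x _; rewrite patchE indicE.
by case: ifPn => xA; rewrite ?mul1e ?mul0e.
Qed.

Let ge0_integral_np (f : R -> \bar R) :
  measurable_fun [set: R] f -> (forall x, 0 <= f x)%E ->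
  (\int[np]_x f x = \int[mu]_x (f x * (phi x)%:E))%E.
Proof.
move=> mf f0; pose f_ := nnsfun_approx measurableT mf.
have mf_ n : measurable_fun [set: R] (f_ n) by [].
have ndf x m n : (m <= n)%N -> f_ m x <= f_ n x.
  by move=> mn; exact/lefP/nd_nnsfun_approx.
have cvgf x : (f_ n x)%:E @[n --> \oo] --> f x by exact: cvg_nnsfun_approx.
transitivity (lim (\int[np]_x (f_ n x)%:E @[n --> \oo])%E).
  rewrite -monotone_convergence//=.
  - by apply: eq_integral => x _; apply/esym/(cvg_lim _ (cvgf x)).
  - by move=> n; apply/measurable_EFinP; exact: mf_.
  - by move=> n ? _; rewrite lee_fin.
  - by move=> ? _ ? ? mn; rewrite lee_fin; exact: ndf.
rewrite (_ : (fun n => _) = (fun n => \int[mu]_x ((f_ n x)%:E * (phi x)%:E))%E);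
  last by apply/funext => n; rewrite integral_np_nnsfun.
rewrite -monotone_convergence//=.
- apply: eq_integral => x _; apply/cvg_lim => //.
  apply: cvgeZr => //; exact: cvgf.
- by move=> n; apply: emeasurable_funM; apply/measurable_EFinP => //; exact: mf_.
- by move=> n x _; rewrite mule_ge0// lee_fin ?normal_pdf_ge0.
- move=> x _ m n mn; rewrite lee_wpmul2r ?lee_fin ?normal_pdf_ge0//.
  exact: ndf.
Qed.

Definition gauss_idfun : {mfun measurableTypeR R >-> R} :=
  HB.pack (idfun : measurableTypeR R -> R)
    (isMeasurableFun.Build _ _ (measurableTypeR R) R _ (@measurable_id _ _ _)).

(* The library defines [normal_prob] over [measurableTypeR R], whose measurable
   sets are those of [R] but under another display; [gauss] is the same measure
   over [R] itself. *)
Definition gauss : probability R R := distribution (normal_prob 0 1) gauss_idfun.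

Lemma ge0_integral_gauss (f : R -> \bar R) :
  measurable_fun [set: R] f -> (forall x, 0 <= f x)%E ->
  (\int[gauss]_x f x = \int[mu]_x (f x * (phi x)%:E))%E.
Proof.
move=> mf f0; rewrite -ge0_integral_np//.
exact: (@ge0_integral_distribution _ _ _ _ _ np gauss_idfun f mf f0).
Qed.

Lemma ge0_integral_gauss2 (f : R * R -> \bar R) :
  measurable_fun [set: R * R] f -> (forall x, 0 <= f x)%E ->
  (\int[gauss \x gauss]_z f z =
   \int[mu \x mu]_z (f z * (phi z.1 * phi z.2)%:E))%E.
Proof.
move=> mf f0.
have mphi2 : measurable_fun [set: R * R] (fun z => phi z.1 * phi z.2).
  apply: measurable_funM => //=.
  - exact: (measurableT_comp measurable_pdf measurable_fst).
  - exact: (measurableT_comp measurable_pdf measurable_snd).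
have f1 x : measurable_fun [set: R] (fun y => f (x, y)).
  by apply: measurableT_comp => //; exact: measurable_pair1.
rewrite fubini_tonelli1// [RHS]fubini_tonelli1//; last 2 first.
  - by apply: emeasurable_funM => //; exact/measurable_EFinP.
  - by move=> z; rewrite mule_ge0// lee_fin mulr_ge0 ?normal_pdf_ge0.
rewrite ge0_integral_gauss//; last 2 first.
  - exact: measurable_fun_fubini_tonelli_F.
  - by move=> x; exact: integral_ge0.
apply: eq_integral => x _; rewrite /fubini_F/=.
rewrite ge0_integral_gauss// -ge0_integralZr//; last 3 first.
  - apply: emeasurable_funM; [exact: f1|apply/measurable_EFinP; exact: measurable_pdf].
  - by move=> y _; rewrite mule_ge0// lee_fin normal_pdf_ge0.
  - by rewrite lee_fin normal_pdf_ge0.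
by apply: eq_integral => y _; rewrite -muleA -EFinM [(phi y * _)%R]mulrC.
Qed.

Lemma normal_pdf_rotation c s (z : R * R) : c ^+ 2 + s ^+ 2 = 1 ->
  phi (rotation c s z).1 * phi (rotation c s z).2 = phi z.1 * phi z.2.
Proof.
move=> cs; rewrite !normal_pdf01 mulrACA [RHS]mulrACA -!expRD; congr (_ * expR _).
rewrite /= -!mulrDl -!opprD; congr (- _ / 2).
transitivity ((c ^+ 2 + s ^+ 2) * (z.1 ^+ 2 + z.2 ^+ 2)); first by ring.
by rewrite cs mul1r.
Qed.

(** The Lebesgue measure of the plane is rotation invariant, and so is the density, a function of
    the distance to the origin. *)
Lemma gauss2_rotation c s (A : set (R * R)) :
  c ^+ 2 + s ^+ 2 = 1 -> s != 0 -> measurable A ->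
  (gauss \x gauss)%E (rotation c s @^-1` A) = (gauss \x gauss)%E A.
Proof.
move=> cs s0 mA.
have mrA : measurable (rotation c s @^-1` A).
  by rewrite -[_ @^-1` _]setTI; exact: measurable_rotation.
have mind B : measurable B -> measurable_fun [set: R * R] (fun z => (\1_B z : R)%:E).
  by move=> mB; apply/measurable_EFinP; exact: measurable_indic.
have ind0 (B : set (R * R)) z : (0 <= (\1_B z : R)%:E)%E by rewrite lee_fin.
have ind B : measurable B -> ((gauss \x gauss)%E B =
    \int[mu \x mu]_z ((\1_B z : R)%:E * (phi z.1 * phi z.2)%:E))%E.
  move=> mB; rewrite -(@ge0_integral_gauss2 _ (mind B mB) (ind0 B)).
  have -> := @integral_indic _ _ _ (gauss \x gauss)%E setT measurableT B mB.
  by rewrite setIT.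
rewrite (ind _ mrA) (ind _ mA).
pose h (z : R * R) := ((\1_A z : R)%:E * (phi z.1 * phi z.2)%:E)%E.
have mh : measurable_fun [set: R * R] h.
  apply: emeasurable_funM; [exact: mind|apply/measurable_EFinP].
  apply: measurable_funM => //=.
  - exact: (measurableT_comp measurable_pdf measurable_fst).
  - exact: (measurableT_comp measurable_pdf measurable_snd).
have h0 z : (0 <= h z)%E.
  by rewrite mule_ge0// lee_fin mulr_ge0 ?normal_pdf_ge0.
rewrite -(@ge0_integral_rotation c s h cs s0 mh h0).
have hE (z : R * R) : h (rotation c s z) =
    ((\1_(rotation c s @^-1` A) z : R)%:E * (phi z.1 * phi z.2)%:E)%E.
  by rewrite /h (normal_pdf_rotation z cs).
by congr (integral _ _ _); apply/funext => z; rewrite hE.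
Qed.

(** A quarter turn of the plane pulls [A * R] back to [R * (- A)]. *)
Lemma gaussN (A : set R) : measurable A -> gauss (-%R @^-1` A) = gauss A.
Proof.
move=> mA.
have mNA : measurable (-%R @^-1` A).
  by rewrite -[_ @^-1` _]setTI; exact: measurable_funN.
have -> : gauss A = (gauss \x gauss)%E (A `*` setT).
  by rewrite product_measure1E//= probability_setT mule1.
rewrite -(@gauss2_rotation 0 1) ?oner_eq0//; last 2 first.
- by rewrite expr0n/= add0r expr1n.
- exact: measurableX.
rewrite (_ : _ @^-1` _ = setT `*` (-%R @^-1` A)); last first.
  apply/seteqP; split => -[x y] /=; rewrite /rotation/= mul0r mul1r sub0r.
  - by case.
  - by case.
by rewrite product_measure1E//= probability_setT mul1e.
Qed.

(* Completing the square: the tilted density is again a normal density. *)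
Lemma gauss_mgf s :
  (\int[gauss]_x (expR (s * x))%:E = (expR (s ^+ 2 / 2))%:E)%E.
Proof.
have mf : measurable_fun [set: R] (fun x : R => (expR (s * x))%:E).
  apply/measurable_EFinP.
  by apply: measurableT_comp; [exact: measurable_expR|exact: mulrl_measurable].
rewrite (ge0_integral_gauss mf) => [|x]; last by rewrite lee_fin expR_ge0.
transitivity (\int[mu]_x ((expR (s ^+ 2 / 2))%:E * (normal_pdf s 1 x)%:E))%E.
  apply: eq_integral => x _; rewrite -!EFinM normal_pdf01 normal_pdfE ?oner_eq0//.
  congr (_%:E); rewrite /normal_fun expr1n [LHS]mulrCA [RHS]mulrCA -!expRD.
  by congr (_ * expR _); field.
rewrite ge0_integralZl// ?lee_fin ?expR_ge0//.
- by rewrite integral_normal_pdf mule1.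
- by apply/measurable_EFinP; exact: measurable_normal_pdf.
- by move=> x _; rewrite lee_fin normal_pdf_ge0.
Qed.

(** The tilted density is [k^-1] times the centred normal density of standard deviation [k^-1],
    where [k ^+ 2 = 1 - 2 * s]. *)
Lemma gauss_sqr_mgf s : s < 1 / 2 ->
  (\int[gauss]_x (expR (s * x ^+ 2))%:E = ((Num.sqrt (1 - 2 * s))^-1)%:E)%E.
Proof.
move=> s2; set k := Num.sqrt (1 - 2 * s).
have k0 : 0 < k by rewrite sqrtr_gt0; lra.
have k2 : k ^+ 2 = 1 - 2 * s by rewrite sqr_sqrtr//; lra.
have mf : measurable_fun [set: R] (fun x : R => (expR (s * x ^+ 2))%:E).
  apply/measurable_EFinP; apply: measurableT_comp; first exact: measurable_expR.
  by apply: measurable_funM => //; exact: measurable_funX.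
rewrite (ge0_integral_gauss mf) => [|x]; last by rewrite lee_fin expR_ge0.
transitivity (\int[mu]_x ((k^-1)%:E * (normal_pdf 0 k^-1 x)%:E))%E.
  apply: eq_integral => x _; rewrite -!EFinM normal_pdf01 normal_pdfE ?invr_neq0 ?gt_eqF//.
  congr (_%:E); rewrite /normal_fun [LHS]mulrCA [RHS]mulrA -expRD subr0.
  congr (_ * expR _).
    rewrite /normal_peak expr1n mul1r -mulrnAr sqrtrM ?sqr_ge0//.
    by rewrite sqrtr_sqr ger0_norm ?invr_ge0 ?ltW// invfM invrK mulrA mulVf ?gt_eqF// mul1r.
  have -> : s = (1 - k ^+ 2) / 2 by rewrite k2; field.
  by field; rewrite gt_eqF.
rewrite ge0_integralZl// ?lee_fin ?invr_ge0 ?ltW//.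
- by rewrite integral_normal_pdf mule1.
- by apply/measurable_EFinP; exact: measurable_normal_pdf.
- by move=> x _; rewrite lee_fin normal_pdf_ge0.
Qed.

End GaussianPlane.

(** * Independent Gaussian families *)

Section GaussianFamilies.
Context {R : realType} {d} {T : measurableType d} (P : probability T R).
Local Notation gauss := (@gauss R).

Definition cylinder (I : finType) (X : I -> T -> R) (B : I -> set R) : set T :=
  [set t | forall i, B i (X i t)].

(** Independence and marginals in a single product formula; subfamilies are reached by taking [setT]
    for the other [B i]. *)
Definition gauss_family (I : finType) (X : I -> T -> R) : Prop :=
  (forall i, measurable_fun [set: T] (X i)) /\
  forall B, (forall i, measurable (B i)) ->
    P (cylinder X B) = (\prod_i gauss (B i))%E.

Definition cylinders (I : finType) (X : I -> T -> R) : set (set T) :=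
  [set A | exists2 B, (forall i, measurable (B i)) & A = cylinder X B].

(** The space [T] itself under the sigma-algebra generated by the family. Measurability on
    [sigmaT X] expresses that a map on [T] is a function of [X], without passing through a space of
    values. *)
Definition sigmaT (I : finType) (X : I -> T -> R) :=
  g_sigma_algebraType (cylinders X).

HB.instance Definition _ (I : finType) (X : I -> T -> R) :=
  Measurable.on (sigmaT X).

Section SubSigma.
Context (I : finType) (X : I -> T -> R).

Lemma cylinder_bigcap (B : I -> set R) :
  cylinder X B = \bigcap_(i in [set: I]) (X i @^-1` B i).
Proof. by apply/seteqP; split => t /= h i; [move=> _|]; exact: h. Qed.

Lemma measurable_cylinder (B : I -> set R) :
  (forall i, measurable_fun [set: T] (X i)) -> (forall i, measurable (B i)) ->
  measurable (cylinder X B).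
Proof.
move=> mX mB; rewrite cylinder_bigcap; apply: fin_bigcap_measurable => // i _.
by rewrite -[_ @^-1` _]setTI; exact: mX.
Qed.

Lemma setI_closed_cylinders : setI_closed (cylinders X).
Proof.
move=> _ _ [B mB ->] [C mC ->]; exists (fun i => B i `&` C i).
  by move=> i; exact: measurableI.
apply/seteqP; split => t /=; first by move=> [hB hC] i; split; [exact: hB|exact: hC].
by move=> h; split => i; have [] := h i.
Qed.

Lemma cylinders_setT : cylinders X [set: T].
Proof. by exists (fun=> setT) => //; apply/seteqP; split. Qed.

Lemma measurable_sigmaT i : measurable_fun [set: sigmaT X] (X i).
Proof.
move=> _ B mB; rewrite setTI; apply: sub_sigma_algebra.
exists (fun j => if j == i then B else setT).
  by move=> j; case: ifP.
apply/seteqP; split => t /= h; last by have := h i; rewrite eqxx.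
by move=> j; case: eqP => // ->.
Qed.

Hypothesis mX : forall i, measurable_fun [set: T] (X i).

Lemma sigmaT_sub : measurable_fun [set: T] (idfun : T -> sigmaT X).
Proof.
apply: (@measurability _ _ T (sigmaT X) setT idfun (cylinders X)) => //.
move=> _ [_ [B mB ->] <-]; rewrite setTI.
exact: measurable_cylinder.
Qed.

Lemma measurable_fun_sigmaT d' (U : measurableType d') (f : T -> U) :
  measurable_fun [set: sigmaT X] f -> measurable_fun [set: T] f.
Proof. by move=> mf; exact: (measurableT_comp mf sigmaT_sub). Qed.

Lemma measurable_set_sigmaT (A : set T) :
  measurable (A : set (sigmaT X)) -> measurable A.
Proof. by move=> mA; have := sigmaT_sub measurableT mA; rewrite setTI. Qed.

Definition to_sigmaT : {mfun T >-> sigmaT X} :=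
  HB.pack (idfun : T -> sigmaT X) (isMeasurableFun.Build _ _ _ _ _ sigmaT_sub).

(** Cylinders are stable under intersection, and [P (A & C)] and [P A * P C] are two finite measures
    in [A] that agree on them. *)
Lemma sigmaT_indep_extend (C : set T) : measurable C ->
  (forall A, cylinders X A -> P (A `&` C) = (P A * P C)%E) ->
  forall A, measurable (A : set (sigmaT X)) -> P (A `&` C) = (P A * P C)%E.
Proof.
move=> mC indep A mA.
have PCnn : 0 <= fine (P C) by rewrite fine_ge0.

pose m2 := mscale (NngNum PCnn) (distribution P to_sigmaT).
have PCE : (fine (P C))%:E = P C by rewrite fineK// fin_num_measure.
have m2E B : (P B * P C)%E = m2 B by rewrite /m2 /mscale/= PCE muleC.
rewrite m2E.
suff : forall B, measurable (B : set (sigmaT X)) ->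
  pushforward (mrestr P mC) to_sigmaT B = m2 B by move=> /(_ _ mA).
apply: (@measure_unique _ R (sigmaT X) (cylinders X) (fun=> setT) _ _ _ _ (pushforward (mrestr P mC) to_sigmaT) m2) => //.
- exact: setI_closed_cylinders.
- by move=> _; exact: cylinders_setT.
- by rewrite bigcup_const.
- by move=> D cD; transitivity (P D * P C)%E; [exact: indep|exact: m2E].
- move=> k; apply: (@le_lt_trans _ _ (P C)); last by rewrite ltey_eq fin_num_measure.
  by rewrite le_eqVlt; apply/orP; left; apply/eqP; congr (P _); apply/seteqP; split => [t []|t Ct].
Qed.

End SubSigma.

(** Coordinates outside the image of [h] receive [setT], a factor of one in the product. *)
Lemma gauss_family_inj (I J : finType) (h : J -> I) (X : I -> T -> R) :
  injective h -> gauss_family X -> gauss_family (X \o h).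
Proof.
move=> hI [mX gX]; split=> [j|B mB]; first exact: mX.
pose B' i := if [pick j | h j == i] is Some j then B j else setT.
have B'h j : B' (h j) = B j.
  by rewrite /B'; case: pickP => [k /eqP/hI ->//|/(_ j)]; rewrite eqxx.
have -> : cylinder (X \o h) B = cylinder X B'.
  apply/seteqP; split => t /= H; last first.
    by move=> j; have := H (h j); rewrite B'h.
  move=> i; rewrite /B'; case: pickP => // j /eqP <-; exact: H.
rewrite gX; last by move=> i; rewrite /B'; case: pickP.
rewrite (bigID (mem (codom h)))/= [X in (_ * X)%E]big1 ?mule1; last first.
  move=> i /negP ih; rewrite /B'; case: pickP => [j /eqP hj|_].
    by exfalso; apply: ih; rewrite -hj codom_f.
  exact: probability_setT.
rewrite (reindex_omap h (fun i => [pick j | h j == i])); last first.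
  move=> i /codomP[j ->]; case: pickP => [k /eqP/= <-//|/(_ j)].
  by rewrite eqxx.
apply: eq_big => [j|j _]; last by rewrite B'h.
rewrite codom_f/=; case: pickP => [k /eqP/hI ->|/(_ j)]; last by rewrite eqxx.
by rewrite eqxx.
Qed.

Section Freezing.
Context (I1 I2 : finType) (X1 : I1 -> T -> R) (X2 : I2 -> T -> R).

Definition join_family (i : I1 + I2) : T -> R :=
  match i with inl i1 => X1 i1 | inr i2 => X2 i2 end.

Hypothesis gX : gauss_family join_family.

Let mX1 i : measurable_fun [set: T] (X1 i). Proof. exact: (gX.1 (inl i)). Qed.
Let mX2 i : measurable_fun [set: T] (X2 i). Proof. exact: (gX.1 (inr i)). Qed.

Lemma gauss_family_inl : gauss_family X1.
Proof. by apply: (@gauss_family_inj _ _ inl _ _ gX) => i j []. Qed.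

Lemma gauss_family_inr : gauss_family X2.
Proof. by apply: (@gauss_family_inj _ _ inr _ _ gX) => i j []. Qed.

(** The extension from cylinders is applied once to each block. *)
Lemma sigmaT_indep (A1 A2 : set T) :
  measurable (A1 : set (sigmaT X1)) -> measurable (A2 : set (sigmaT X2)) ->
  P (A1 `&` A2) = (P A1 * P A2)%E.
Proof.
move=> mA1 mA2; apply: (sigmaT_indep_extend mX1) => //.
  exact: (measurable_set_sigmaT mX2).
move=> _ [B1 mB1 ->]; rewrite setIC muleC; apply: (sigmaT_indep_extend mX2) => //.
  exact: measurable_cylinder.
move=> _ [B2 mB2 ->].
pose B i := match i with inl i1 => B1 i1 | inr i2 => B2 i2 end.
have -> : cylinder X2 B2 `&` cylinder X1 B1 = cylinder join_family B.
  apply/seteqP; split => t /= => [[h2 h1] [i|i]|h]; [exact: h1|exact: h2|].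
  by split => i; [exact: (h (inr i))|exact: (h (inl i))].
rewrite gX.2; last by case.
by rewrite big_sumType/= gauss_family_inl.2// gauss_family_inr.2// muleC.
Qed.

(* Independence of the two blocks in integrated form: the first block may be
   frozen while integrating over the second one. *)
Lemma freezing (f : sigmaT X1 * sigmaT X2 -> \bar R) :
  measurable_fun [set: sigmaT X1 * sigmaT X2] f -> (forall z, 0 <= f z)%E ->
  (\int[P]_t f (t, t) = \int[P]_t \int[P]_s f (t, s))%E.
Proof.
move=> mf f0.
(* The image of [P] under the diagonal is the joint law of the two blocks; by independence it is the
   product of the marginal laws, and Tonelli applies. *)
pose diag (t : T) : sigmaT X1 * sigmaT X2 := (t, t).
have mdiag : measurable_fun [set: T] diag.
  by apply: measurable_fun_pair; [exact: sigmaT_sub|exact: sigmaT_sub].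
pose D : {mfun T >-> (sigmaT X1 * sigmaT X2)%type} := HB.pack diag
  (isMeasurableFun.Build _ _ _ _ _ mdiag).
pose P1 := distribution P (to_sigmaT mX1).
pose P2 := distribution P (to_sigmaT mX2).
rewrite -(@ge0_integral_pushforward _ _ _ _ _ _ mdiag P setT f)//.
rewrite (_ : \int[_]_(y in _) _ = \int[P1 \x P2]_z f z)%E; last first.
  apply: eq_measure_integral => A mA _.
  symmetry; apply: (@product_measure_unique _ _ _ _ _ P1 P2 (distribution P D)) => //.
  by move=> A1 A2 mA1 mA2; exact: sigmaT_indep.
rewrite fubini_tonelli1// [LHS](@ge0_integral_distribution _ _ _ _ _ P (to_sigmaT mX1))//=.
- apply: eq_integral => t _; rewrite /fubini_F/=.
  rewrite (@ge0_integral_distribution _ _ _ _ _ P (to_sigmaT mX2))//.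
  by apply: measurableT_comp => //; exact: measurable_pair1.
- exact: measurable_fun_fubini_tonelli_F.
- by move=> x; exact: integral_ge0.
Qed.

Lemma measurable_frozen (E : set (sigmaT X1 * sigmaT X2)) (t : T) :
  measurable E -> measurable ([set s | E (t, s)] : set T).
Proof.
move=> mE; apply: (@measurable_set_sigmaT _ X2 mX2 [set s | E (t, s)]).
have := @measurable_pair1 _ _ (sigmaT X1) (sigmaT X2) t measurableT E mE.
by rewrite setTI.
Qed.

Lemma measurable_diagonal (E : set (sigmaT X1 * sigmaT X2)) :
  measurable E -> measurable ([set t | E (t, t)] : set T).
Proof.
move=> mE.
have mdiag := measurable_fun_pair (sigmaT_sub mX1) (sigmaT_sub mX2).
by have := mdiag measurableT E mE; rewrite setTI.
Qed.

Lemma freezing_prob (E : set (sigmaT X1 * sigmaT X2)) : measurable E ->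
  P [set t | E (t, t)] = (\int[P]_t P [set s | E (t, s)])%E.
Proof.
move=> mE; have ind (A : set T) : measurable A -> P A = (\int[P]_t (\1_A t : R)%:E)%E.
  by move=> mA; rewrite integral_indic// setIT.
rewrite ind; last exact: measurable_diagonal.
under [RHS]eq_integral => t _ do rewrite (ind _ (measurable_frozen t mE)).
apply: (@freezing (fun z => (\1_E z : R)%:E)) => [|z]; last by rewrite lee_fin.
by apply/measurable_EFinP; exact: measurable_indic.
Qed.


End Freezing.

End GaussianFamilies.

(** * Orthogonal invariance *)

Section Givens.
Context {R : realType} {d} {T : measurableType d} (P : probability T R).
Local Notation gauss := (@gauss R).

Lemma prod_gauss_fin_num (I : finType) (Q : pred I) (B : I -> set R) :
  (forall i, measurable (B i)) -> (\prod_(i | Q i) gauss (B i))%E \is a fin_num.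
Proof.
move=> mB; elim/big_ind : _ => // [x y|i _]; first exact: fin_numM.
by apply: fin_num_measure; exact: mB.
Qed.

Lemma prod_gauss_ge0 (I : finType) (Q : pred I) (B : I -> set R) :
  (0 <= \prod_(i | Q i) gauss (B i))%E.
Proof. by elim/big_ind : _ => // x y x0 y0; exact: mule_ge0. Qed.

Lemma measure_prod_unique d1 d2 (T1 : measurableType d1) (T2 : measurableType d2)
    (m1 m2 : {measure set (T1 * T2) -> \bar R}) : (m1 [set: T1 * T2] < +oo)%E ->
  (forall A B, measurable A -> measurable B -> m1 (A `*` B) = m2 (A `*` B)) ->
  forall X, measurable X -> m1 X = m2 X.
Proof.
move=> m1oo m12 X mX.
pose C : set (set (T1 * T2)) :=
  [set C | exists A, measurable A /\ exists B, measurable B /\ C = A `*` B].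
apply: (measure_unique C (fun=> setT)) => //.
- rewrite measurable_prod_measurableType //; congr (<<s _ >>).
  rewrite predeqE; split => [[A mA [B mB <-]]|[A [mA [B [mB ->]]]]].
    by exists A; split => //; exists B.
  by exists A => //; exists B.
- move=> _ _ [X1 [mX1 [X2 [mX2 ->]]]] [Y1 [mY1 [Y2 [mY2 ->]]]].
  rewrite -setXI; exists (X1 `&` Y1); split; first exact: measurableI.
  by exists (X2 `&` Y2); split => //; exact: measurableI.
- by move=> _; exists setT; split => //; exists setT; split; rewrite ?setXTT.
- by rewrite bigcup_const.
- by move=> _ [A [mA [B [mB ->]]]]; exact: m12.
Qed.

Definition rotate_pair (I : finType) (i j : I) (c s : R) (X : I -> T -> R) k t :=
  if k == i then c * X i t - s * X j t
  else if k == j then s * X i t + c * X j t else X k t.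

(* Conditionally on the other coordinates, the law of the pair [(X i, X j)] is
   the Gaussian measure of the plane, which is invariant under rotations. *)
Lemma gauss_family_rotate_pair (I : finType) (i j : I) (c s : R) (X : I -> T -> R) :
  i != j -> c ^+ 2 + s ^+ 2 = 1 -> s != 0 ->
  gauss_family P X -> gauss_family P (rotate_pair i j c s X).
Proof.
move=> ij cs s0 [mX gX]; have ji : j != i by rewrite eq_sym.
have mpair : measurable_fun [set: T] (fun t => (X i t, X j t)).
  exact: measurable_fun_pair.
split=> [k|B mB].
  rewrite /rotate_pair; case: eqP => _.
    by apply: measurable_funB; apply: measurable_funM.
  case: eqP => _; last exact: mX.
  by apply: measurable_funD; apply: measurable_funM.
pose rest := (\prod_(k | (k != i) && (k != j)) gauss (B k))%E.
have rest_fin : rest \is a fin_num by exact: prod_gauss_fin_num.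
have r0 : 0 <= fine rest by rewrite fine_ge0// prod_gauss_ge0.
pose B' C1 C2 k := if k == i then C1 else if k == j then C2 else B k.
have mB' C1 C2 : measurable C1 -> measurable C2 -> forall k, measurable (B' C1 C2 k).
  by move=> m1 m2 k; rewrite /B'; case: ifP => // _; case: ifP.
have PB' C1 C2 : measurable C1 -> measurable C2 ->
    P (cylinder X (B' C1 C2)) = (gauss C1 * gauss C2 * rest)%E.
  move=> m1 m2; rewrite gX; last exact: mB'.
  rewrite (bigD1 i)//= (bigD1 j)//= /B' eqxx (negbTE ji) eqxx muleA.
  congr (_ * _)%E; apply: eq_bigr => k /andP[ki kj].
  by rewrite (negbTE ki) (negbTE kj).
(* [D] constrains only the coordinates other than [i] and [j]. The law of the pair restricted to [D]
   is [rest] times the plane Gaussian, by comparison on rectangles. *)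
pose D := cylinder X (B' setT setT).
have mD : measurable D by apply: measurable_cylinder => //; exact: mB'.
pose pr : {mfun T >-> (R * R)%type} := HB.pack (fun t => (X i t, X j t))
  (isMeasurableFun.Build _ _ _ _ _ mpair).
have nuE (C : set (R * R)) : measurable C ->
    pushforward (mrestr P mD) pr C = ((fine rest)%:E * (gauss \x gauss) C)%E.
  move=> mC; transitivity (mscale (NngNum r0) (gauss \x gauss)%E C); last by [].
  move: C mC; apply: (@measure_prod_unique _ _ _ _ (pushforward (mrestr P mD) pr)
    (mscale (NngNum r0) (gauss \x gauss)%E)) => [|C1 C2 mC1 mC2].
    apply: (@le_lt_trans _ _ (P D)); last by rewrite ltey_eq fin_num_measure.
    rewrite le_eqVlt; apply/orP; left; apply/eqP; congr (P _).
    by apply/seteqP; split => [t []|t Dt].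
  transitivity (gauss C1 * gauss C2 * rest)%E; last first.
    transitivity ((fine rest)%:E * (gauss \x gauss) (C1 `*` C2))%E; last by [].
    by rewrite product_measure1E// fineK// muleC.
  rewrite -PB'//; congr (P _); apply/seteqP; split => t /=.
    move=> [[h1 h2] h] k; have := h k; rewrite /B'.
    by case: eqP => [->//|_]; case: eqP => [->|].
  move=> h; split; first split.
  - by have := h i; rewrite /B' eqxx.
  - by have := h j; rewrite /B' (negbTE ji) eqxx.
  - move=> k; have := h k; rewrite /B'.
    by case: eqP => // _; case: eqP.
have mBij : measurable (B i `*` B j) by exact: measurableX.
have mrot : measurable (rotation c s @^-1` (B i `*` B j)).
  by rewrite -[_ @^-1` _]setTI; exact: measurable_rotation.
have -> : cylinder (rotate_pair i j c s X) B =
    (pr @^-1` (rotation c s @^-1` (B i `*` B j))) `&` D.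
  apply/seteqP; split => t /=.
    move=> h; split.
      split; first by have := h i; rewrite /rotate_pair eqxx.
      by have := h j; rewrite /rotate_pair (negbTE ji) eqxx.
    move=> k; have := h k; rewrite /rotate_pair /B'.
    by case: eqP => // _; case: eqP.
  move=> [[h1 h2] h] k; have := h k; rewrite /B' /rotate_pair.
  by case: eqP => [->//|_]; case: eqP => [->|].
transitivity (pushforward (mrestr P mD) pr (rotation c s @^-1` (B i `*` B j))).
  by [].
rewrite (nuE _ mrot) gauss2_rotation// product_measure1E// fineK//.
by rewrite [RHS](bigD1 i)//= [in RHS](bigD1 j)//= [LHS]muleC [RHS]muleA.
Qed.

Lemma gauss_family_sign (I : finType) (F : {pred I}) (X : I -> T -> R) :
  gauss_family P X ->
  gauss_family P (fun k t => if k \in F then - X k t else X k t).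
Proof.
move=> [mX gX]; split=> [k|B mB].
  by case: (k \in F); [apply: measurable_funN; exact: mX|exact: mX].
pose B' k := if k \in F then -%R @^-1` B k else B k.
have mN k : measurable (-%R @^-1` B k).
  by rewrite -[_ @^-1` _]setTI; exact: measurable_funN.
rewrite (_ : cylinder _ B = cylinder X B'); last first.
  by apply/seteqP; split => t /= h k; have := h k; rewrite /B'; case: ifP.
rewrite gX; last by move=> k; rewrite /B'; case: ifP.
apply: eq_bigr => k _; rewrite /B'; case: ifP => // _.
exact: gaussN.
Qed.

End Givens.

Section OrthogonalInvariance.
Context {R : realType}.

Definition entries d (T : measurableType d) m n (H : T -> 'M[R]_(m, n))
  (ij : 'I_m * 'I_n) (t : T) : R := H t ij.1 ij.2.

(** The companion family [X] records that independence from other sources of randomness survives the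
    multiplication. *)
Definition preserves_gauss n (Q : 'M[R]_n) : Prop :=
  forall d (T : measurableType d) (P : probability T R) (I : finType)
    (X : I -> T -> R) m (H : T -> 'M[R]_(m, n)),
  gauss_family P (join_family X (entries H)) ->
  gauss_family P (join_family X (entries (fun t => H t *m Q))).

Lemma preserves_gauss1 n : preserves_gauss (1%:M : 'M[R]_n).
Proof.
move=> d T P I X m H; rewrite (_ : (fun t => _) = H)//.
by apply/funext => t; rewrite mulmx1.
Qed.

Lemma preserves_gaussM n (Q Q' : 'M[R]_n) :
  preserves_gauss Q -> preserves_gauss Q' -> preserves_gauss (Q *m Q').
Proof.
move=> hQ hQ' d T P I X m H /hQ /hQ'.
rewrite (_ : (fun t => H t *m (Q *m Q')) = fun t => H t *m Q *m Q')//.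
by apply/funext => t; rewrite mulmxA.
Qed.

Section GivensMatrix.
Context (n : nat) (i j : 'I_n) (ij : i != j).

Definition givens c s : 'M[R]_n := \matrix_(l, k)
  if k == i then c *+ (l == i) - s *+ (l == j)
  else if k == j then s *+ (l == i) + c *+ (l == j) else (l == k)%:R.

Lemma mulmx_givens m (A : 'M[R]_(m, n)) c s r k : (A *m givens c s) r k =
  if k == i then c * A r i - s * A r j
  else if k == j then s * A r i + c * A r j else A r k.
Proof.
have sumd (l : 'I_n) (a : R) : \sum_l0 A r l0 * (a *+ (l0 == l)) = a * A r l.
  rewrite (bigD1 l)//= eqxx mulr1n big1 ?addr0 1?mulrC// => l0 /negbTE ->.
  by rewrite mulr0n mulr0.
rewrite mxE; under eq_bigr do rewrite mxE.
case: ifP => _; last case: ifP => _.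
- under eq_bigr do rewrite mulrBr.
  by rewrite big_split/= sumrN !sumd.
- under eq_bigr do rewrite mulrDr.
  by rewrite big_split/= !sumd.
- by rewrite sumd mul1r.
Qed.

Lemma givensK c s : c ^+ 2 + s ^+ 2 = 1 -> givens c s *m givens c (- s) = 1%:M.
Proof.
move=> cs; have ji : j != i by rewrite eq_sym.
apply/matrixP => r k; rewrite mulmx_givens !mxE.
rewrite !eqxx (negbTE ji).
case: (eqVneq k i) => [->|ki]; last case: (eqVneq k j) => [->|kj].
- case: (eqVneq r i) => [->|ri]; rewrite ?(negbTE ij) ?mulr1n ?mulr0n.
    by rewrite -cs; ring.
  by case: (eqVneq r j) => rj; rewrite ?mulr1n ?mulr0n; ring.
- case: (eqVneq r i) => [->|ri]; rewrite ?(negbTE ij) ?mulr1n ?mulr0n; first by ring.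
  by case: (eqVneq r j) => rj; rewrite ?mulr1n ?mulr0n -?cs; ring.
- by [].
Qed.

Lemma givens_tr c s : (givens c s)^T = givens c (- s).
Proof.
have ji : j != i by rewrite eq_sym.
apply/matrixP => r k; rewrite !mxE.
case: (eqVneq r i) => ri; case: (eqVneq r j) => rj;
  case: (eqVneq k i) => ki; case: (eqVneq k j) => kj;
  first [by move: ij; rewrite -ri -rj eqxx | by move: ij; rewrite -ki -kj eqxx
    | by rewrite ?(eqxx, ri, rj, ki, kj, negbTE ij, negbTE ji) ?mulr1n ?mulr0n; ring
    | by rewrite eq_sym | by rewrite ri eq_sym (negbTE ki) !mulr0n; ring
    | by rewrite rj eq_sym (negbTE kj) !mulr0n; ring
    | by rewrite ki eq_sym (negbTE ri) !mulr0n; ring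
    | by rewrite kj eq_sym (negbTE rj) !mulr0n; ring].
Qed.

(** The rows are rotated one at a time: in [HS S] those listed in [S] are done, and adding a row is
    a [rotate_pair] of two entries of that row. *)
Lemma preserves_gauss_givens c s :
  c ^+ 2 + s ^+ 2 = 1 -> s != 0 -> preserves_gauss (givens c s).
Proof.
move=> cs s0 d T P I X m H gH.
pose HS (S : seq 'I_m) t : 'M[R]_(m, n) :=
  \matrix_(r, k) if r \in S then (H t *m givens c s) r k else H t r k.
have HSE S t r k : HS S t r k =
  if r \in S then (H t *m givens c s) r k else H t r k by rewrite [LHS]mxE.
suff HSg S : uniq S -> gauss_family P (join_family X (entries (HS S))).
  rewrite (_ : (fun t => _) = HS (enum 'I_m)); first exact/HSg/enum_uniq.
  by apply/funext => t; apply/matrixP => r k; rewrite [RHS]mxE mem_enum.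
elim: S => [_|r S IH /=/andP[rS uS]].
  rewrite (_ : HS [::] = H)//.
  by apply/funext => t; apply/matrixP => r k; rewrite mxE.
rewrite (_ : join_family X _ =
  rotate_pair (inr (r, i)) (inr (r, j)) c s (join_family X (entries (HS S)))).
  apply: gauss_family_rotate_pair => //; last exact: IH.
  by apply: contra ij => /eqP [->].
apply/funext => -[x|[r' k]]; apply/funext => t//=.
rewrite /rotate_pair /= /entries/= !HSE in_cons (negbTE rS).
have einr (a : 'I_m) (k1 k2 : 'I_n) :
  (inr (a, k1) == inr (a, k2) :> I + 'I_m * 'I_n) = (k1 == k2).
  by apply/eqP/eqP => [[]|->].
case: (eqVneq r' r) => [->|r'r] /=.
  by rewrite !einr mulmx_givens (negbTE rS).
have ninr k1 : (inr (r', k) == inr (r, k1) :> I + 'I_m * 'I_n) = false.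
  by apply/eqP => -[/eqP]; rewrite (negbTE r'r).
by rewrite !ninr.
Qed.

End GivensMatrix.

Definition sign0 n : 'M[R]_n.+1 := \matrix_(l, k)
  if k == ord0 then - (l == k)%:R else (l == k)%:R.

Lemma mulmx_sign0 m n (A : 'M[R]_(m, n.+1)) r k :
  (A *m sign0 n) r k = if k == ord0 then - A r k else A r k.
Proof.
rewrite mxE (bigD1 k)//= big1 ?addr0 => [|l lk].
  by rewrite mxE eqxx; case: ifP => _; rewrite ?mulrN1 ?mulr1.
by rewrite mxE (negbTE lk); case: ifP => _; rewrite ?oppr0 mulr0.
Qed.

Lemma preserves_gauss_sign0 n : preserves_gauss (sign0 n).
Proof.
move=> d T P I X m H gH.
pose F : {pred I + 'I_m * 'I_n.+1} :=
  [pred x | if x is inr (r, k) then k == ord0 else false].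
have := gauss_family_sign F gH; congr gauss_family.
apply/funext => -[x|[r k]]; apply/funext => t; rewrite ?inE//=.
by rewrite /entries/= mulmx_sign0.
Qed.

End OrthogonalInvariance.

(** * Measurability of matrix-valued maps *)

Section Measurability.
Context {R : realType} {d} {T : measurableType d}.

(** The inverse is [f] times a real power of [f ^+ 2]; where [f] vanishes both sides are [0], as
    [0^-1 = 0]. *)
Lemma measurable_funV (f : T -> R) :
  measurable_fun [set: T] f -> measurable_fun [set: T] (fun t => (f t)^-1).
Proof.
move=> mf; rewrite (_ : (fun t => _) = fun t => f t * (f t ^+ 2) `^ (-1)).
  apply: measurable_funM => //.
  by apply: (measurableT_comp (measurable_powR (-1))); exact: measurable_funX.
apply/funext => t; rewrite powR_inv1 ?sqr_ge0//.
have [->|f0] := eqVneq (f t) 0; first by rewrite invr0 mul0r.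
by rewrite expr2 invfM mulrA mulfV// mul1r.
Qed.

Lemma measurable_fun_sqrt (f : T -> R) :
  measurable_fun [set: T] f -> measurable_fun [set: T] (fun t => Num.sqrt (f t)).
Proof.
by apply: measurableT_comp; apply: continuous_measurable_fun; exact: sqrt_continuous.
Qed.

Definition measurable_mx m n (A : T -> 'M[R]_(m, n)) :=
  forall i j, measurable_fun [set: T] (fun t => A t i j).

Lemma measurable_mxM m n p (A : T -> 'M[R]_(m, n)) (B : T -> 'M[R]_(n, p)) :
  measurable_mx A -> measurable_mx B -> measurable_mx (fun t => A t *m B t).
Proof.
move=> mA mB i j; rewrite (_ : (fun t => _) = fun t => \sum_k A t i k * B t k j).
  by apply: measurable_sum => k; exact: measurable_funM.
by apply/funext => t; rewrite mxE.
Qed.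

Lemma measurable_mxT m n (A : T -> 'M[R]_(m, n)) :
  measurable_mx A -> measurable_mx (fun t => (A t)^T).
Proof.
move=> mA i j; rewrite (_ : (fun t => _) = fun t => A t j i); first exact: mA.
by apply/funext => t; rewrite mxE.
Qed.

Lemma measurable_mx_cst m n (A : 'M[R]_(m, n)) : measurable_mx (fun=> A).
Proof. by move=> i j; exact: measurable_cst. Qed.

Lemma measurable_mxD m n (A B : T -> 'M[R]_(m, n)) :
  measurable_mx A -> measurable_mx B -> measurable_mx (fun t => A t + B t).
Proof.
move=> mA mB i j; rewrite (_ : (fun t => _) = fun t => A t i j + B t i j).
  exact: measurable_funD.
by apply/funext => t; rewrite mxE.
Qed.

Lemma measurable_mxZ m n (a : T -> R) (A : T -> 'M[R]_(m, n)) :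
  measurable_fun [set: T] a -> measurable_mx A -> measurable_mx (fun t => a t *: A t).
Proof.
move=> ma mA i j; rewrite (_ : (fun t => _) = fun t => a t * A t i j).
  exact: measurable_funM.
by apply/funext => t; rewrite mxE.
Qed.

Lemma measurable_mxB m n (A B : T -> 'M[R]_(m, n)) :
  measurable_mx A -> measurable_mx B -> measurable_mx (fun t => A t - B t).
Proof.
move=> mA mB i j; rewrite (_ : (fun t => _) = fun t => A t i j - B t i j).
  exact: measurable_funB.
by apply/funext => t; rewrite !mxE.
Qed.

Lemma measurable_det n (A : T -> 'M[R]_n) :
  measurable_mx A -> measurable_fun [set: T] (fun t => \det (A t)).
Proof.
move=> mA; rewrite /determinant; apply: measurable_sum => s.
by apply: measurable_funM => //; apply: measurable_prod => i _; exact: mA.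
Qed.

(** Cramer's formula instead of [invmx], which branches on invertibility: the entries are visibly
    measurable in those of [A]. Both agree on invertible matrices ([resolventE]). *)
Definition resolvent n (A : 'M[R]_n) : 'M[R]_n := (\det A)^-1 *: \adj A.

Lemma measurable_resolvent n (A : T -> 'M[R]_n) :
  measurable_mx A -> measurable_mx (fun t => resolvent (A t)).
Proof.
move=> mA; apply: measurable_mxZ; first exact/measurable_funV/measurable_det.
move=> i j; rewrite (_ : (fun t => _) =
    fun t => (-1) ^+ (j + i) * \det (row' j (col' i (A t)))); last first.
  by apply/funext => t; rewrite mxE.
apply: measurable_funM => //; apply: measurable_det => k l.
rewrite (_ : (fun t => _) = fun t => A t (lift j k) (lift i l)); first exact: mA.
by apply/funext => t; rewrite !mxE.
Qed.

End Measurability.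

(** * Householder reflections *)

Section Householder.
Context {R : realType}.

Definition sqnorm n (v : 'cV[R]_n) : R := \sum_i v i 0 ^+ 2.

Lemma sqnorm_ge0 n (v : 'cV[R]_n) : 0 <= sqnorm v.
Proof. by apply: sumr_ge0 => i _; exact: sqr_ge0. Qed.

Lemma sqnorm_eq0 n (v : 'cV[R]_n) : (sqnorm v == 0) = (v == 0).
Proof.
rewrite psumr_eq0; last by move=> i _; exact: sqr_ge0.
apply/allP/eqP => [h|-> i _]; last by rewrite mxE expr0n eqxx.
apply/matrixP => i j; rewrite ord1 mxE.
by have := h i (mem_index_enum _); rewrite /= sqrf_eq0 => /eqP.
Qed.

Lemma sqnormE n (v : 'cV[R]_n) : v^T *m v = (sqnorm v)%:M.
Proof.
apply/matrixP => i j; rewrite !ord1 !mxE eqxx mulr1n.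
by apply: eq_bigr => k _; rewrite mxE expr2.
Qed.

Lemma sqnorm_mulmx m n (Q : 'M[R]_(m, n)) (v : 'cV[R]_n) :
  Q^T *m Q = 1%:M -> sqnorm (Q *m v) = sqnorm v.
Proof.
move=> QQ; have := sqnormE (Q *m v).
rewrite trmx_mul mulmxA -(mulmxA v^T) QQ mulmx1 sqnormE => /matrixP/(_ 0 0).
by rewrite !mxE eqxx !mulr1n.
Qed.

Lemma sqnormZ n a (v : 'cV[R]_n) : sqnorm (a *: v) = a ^+ 2 * sqnorm v.
Proof. by rewrite mulr_sumr; apply: eq_bigr => i _; rewrite mxE exprMn. Qed.

Definition dot n (u v : 'cV[R]_n) : R := \sum_i u i 0 * v i 0.

Lemma dotE n (u v : 'cV[R]_n) : u^T *m v = (dot u v)%:M.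
Proof.
apply/matrixP => i j; rewrite !ord1 !mxE eqxx mulr1n.
by apply: eq_bigr => k _; rewrite mxE.
Qed.

Lemma dotC n (u v : 'cV[R]_n) : dot u v = dot v u.
Proof. by apply: eq_bigr => i _; rewrite mulrC. Qed.

Lemma sqnormB n (u v : 'cV[R]_n) :
  sqnorm (u - v) = sqnorm u - 2 * dot u v + sqnorm v.
Proof.
rewrite /sqnorm /dot mulr_sumr -sumrN -!big_split/=.
by apply: eq_bigr => i _; rewrite !mxE; ring.
Qed.

Lemma sqnormD n (u v : 'cV[R]_n) :
  sqnorm (u + v) = sqnorm u + 2 * dot u v + sqnorm v.
Proof.
rewrite /sqnorm /dot mulr_sumr -!big_split/=.
by apply: eq_bigr => i _; rewrite !mxE; ring.
Qed.

Definition householder n (w : 'cV[R]_n) : 'M[R]_n :=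
  1%:M - (2 / sqnorm w) *: (w *m w^T).

Lemma householder0 n : householder (0 : 'cV[R]_n) = 1%:M.
Proof. by rewrite /householder mul0mx scaler0 subr0. Qed.

Lemma tr_householder n (w : 'cV[R]_n) : (householder w)^T = householder w.
Proof. by rewrite /householder linearB/= linearZ/= trmx1 trmx_mul trmxK. Qed.

Lemma mul_householder n p (w : 'cV[R]_n) (A : 'M[R]_(n, p)) :
  householder w *m A = A - (2 / sqnorm w) *: (w *m (w^T *m A)).
Proof. by rewrite mulmxBl mul1mx -scalemxAl mulmxA. Qed.

Lemma householderK n (w : 'cV[R]_n) : householder w *m householder w = 1%:M.
Proof.
have [->|w0] := eqVneq w 0; first by rewrite householder0 mulmx1.
have sw : sqnorm w != 0 by rewrite sqnorm_eq0.
have MM : w *m w^T *m (w *m w^T) = sqnorm w *: (w *m w^T).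
  by rewrite mulmxA -(mulmxA w) sqnormE mul_mx_scalar scalemxAl.
rewrite {1}/householder mulmxBl mul1mx -scalemxAl /householder mulmxBr mulmx1.
rewrite -scalemxAr MM scalerA divfK// scaler_nat mulr2n opprD addrA subrr sub0r.
by rewrite scalerN opprK subrK.
Qed.

(** For equal norms [2 * dot (v - v') v] is [sqnorm (v - v')], so that the reflection subtracts
    exactly [v - v'] from [v]. *)
Lemma householder_reflect n (v v' : 'cV[R]_n) :
  sqnorm v = sqnorm v' -> householder (v - v') *m v = v'.
Proof.
move=> vv'; have [/eqP|w0] := eqVneq (v - v') 0.
  by rewrite subr_eq0 => /eqP ->; rewrite subrr householder0 mul1mx.
have sw : sqnorm (v - v') != 0 by rewrite sqnorm_eq0.
have dE : 2 * dot (v - v') v = sqnorm (v - v').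
  rewrite sqnormB -vv' /dot; apply/eqP; rewrite -subr_eq0; apply/eqP.
  transitivity (2 * (dot (v - v') v - (sqnorm v - dot v v'))).
    by rewrite /dot; ring.
  rewrite /dot /sqnorm -sumrB -sumrB big1 ?mulr0// => i _.
  by rewrite !mxE; ring.
rewrite mul_householder dotE mul_mx_scalar scalerA mulrAC dE divff// scale1r.
by rewrite subKr.
Qed.

Definition e0 n : 'cV[R]_n.+1 := delta_mx ord0 ord0.

Lemma sqnorm_e0 n : sqnorm (e0 n) = 1.
Proof.
rewrite /sqnorm (bigD1 ord0)//= big1 ?addr0 => [|i i0].
  by rewrite mxE !eqxx expr1n.
by rewrite mxE (negbTE i0) expr0n.
Qed.

(** Among the orthogonal matrices taking [v] to the first axis, this one is an explicit expression
    in [v], hence measurable, and is its own transpose and inverse. *)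
Definition to_e0 n (v : 'cV[R]_n.+1) : 'M[R]_n.+1 :=
  householder (v - Num.sqrt (sqnorm v) *: e0 n).

Lemma to_e0P n (v : 'cV[R]_n.+1) : to_e0 v *m v = Num.sqrt (sqnorm v) *: e0 n.
Proof.
by apply: householder_reflect; rewrite sqnormZ sqnorm_e0 mulr1 sqr_sqrtr// sqnorm_ge0.
Qed.

Lemma measurable_to_e0 d (T : measurableType d) n (v : T -> 'cV[R]_n.+1) :
  measurable_mx v -> measurable_mx (fun t => to_e0 (v t)).
Proof.
move=> mv; have msq k (w : T -> 'cV[R]_k) : measurable_mx w ->
    measurable_fun [set: T] (fun t => sqnorm (w t)).
  by move=> mw; apply: measurable_sum => i; apply: measurable_funX; exact: mw.
have mw : measurable_mx (fun t => v t - Num.sqrt (sqnorm (v t)) *: e0 n).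
  apply: measurable_mxB => //; apply: measurable_mxZ; last exact: measurable_mx_cst.
  exact/measurable_fun_sqrt/msq.
apply: measurable_mxB; first exact: measurable_mx_cst.
apply: measurable_mxZ; last by apply: measurable_mxM => //; exact: measurable_mxT.
apply: measurable_funM => //; exact/measurable_funV/msq.
Qed.

(* Rotating the coordinates of [w] away one after the other. *)
Lemma exists_rotation_to_axis n (w : 'cV[R]_n.+1) : exists G : 'M[R]_n.+1,
  [/\ G *m G^T = 1%:M, preserves_gauss G, preserves_gauss G^T &
      forall k, k != ord0 -> (w^T *m G) 0 k = 0].
Proof.
suff H m : exists G : 'M[R]_n.+1,
    [/\ G *m G^T = 1%:M, preserves_gauss G, preserves_gauss G^T &
        forall k : 'I_n.+1, k != ord0 -> (k <= m)%N -> (w^T *m G) 0 k = 0].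
  have [G [h1 h2 h3 h4]] := H n; exists G; split => // k k0; apply: h4 => //.
  by rewrite -ltnS.
elim: m => [|m [G [GG pG pGT Gw]]].
  exists 1%:M; rewrite trmx1 mulmx1; split=> //; [exact: preserves_gauss1..|].
  by move=> k k0; rewrite leqn0 => /eqP k0'; move: k0; rewrite -val_eqE/= k0'.
have [mn|nm] := ltnP m.+1 n.+1; last first.
  exists G; split => // k k0 km; apply: Gw => //.
  by apply: (leq_trans _ (leq_trans (n:=n) _ _)); rewrite -ltnS//.
pose j := Ordinal mn.
(* If the entry already vanishes the rotation would have sine zero, a case that
   [preserves_gauss_givens] excludes. *)
have [wj0|wj0] := eqVneq ((w^T *m G) 0 j) 0.
  exists G; split => // k k0; rewrite leq_eqVlt => /orP[/eqP km|]; last exact: Gw.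
  by rewrite (_ : k = j)//; exact: val_inj.
set x := (w^T *m G) 0 0; set y := (w^T *m G) 0 j.
pose r := Num.sqrt (x ^+ 2 + y ^+ 2).
have r2 : r ^+ 2 = x ^+ 2 + y ^+ 2 by rewrite sqr_sqrtr// addr_ge0// sqr_ge0.
have r0 : r != 0.
  rewrite -sqrf_eq0 r2 gt_eqF// ltr_wpDl ?sqr_ge0// exprn_even_gt0//.
have cs : (x / r) ^+ 2 + (- y / r) ^+ 2 = 1.
  by rewrite !expr_div_n sqrrN -mulrDl -r2 divff// sqrf_eq0.
have s0 : - y / r != 0 by rewrite mulf_neq0 ?oppr_eq0 ?invr_eq0.
have oj : (ord0 : 'I_n.+1) != j by [].
pose Q := givens ord0 j (x / r) (- y / r).
have csN : (x / r) ^+ 2 + (- (- y / r)) ^+ 2 = 1 by rewrite sqrrN.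
exists (G *m Q); split.
- by rewrite trmx_mul mulmxA -(mulmxA G) givens_tr// givensK// mulmx1.
- by apply: preserves_gaussM => //; exact: preserves_gauss_givens.
- rewrite trmx_mul; apply: preserves_gaussM => //; rewrite givens_tr//.
  by apply: preserves_gauss_givens => //; rewrite oppr_eq0.
- move=> k k0 km; rewrite mulmxA mulmx_givens (negbTE k0).
  case: eqP => [_|/eqP kj].
    by rewrite -/x -/y; field.
  apply: Gw => //; move: km; rewrite leq_eqVlt => /orP[/eqP km|//].
  by exfalso; move/eqP: kj; apply; exact: val_inj.
Qed.

(** If [G] is a product of Givens rotations that brings [w] to the first axis, the reflection is
    [G *m sign0 n *m G^T]: in the new coordinates it only flips the first one. *)
Lemma preserves_gauss_householder n (w : 'cV[R]_n.+1) : preserves_gauss (householder w).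
Proof.
have [->|w0] := eqVneq w 0.
  by rewrite householder0; exact: preserves_gauss1.
have [G [GG pG pGT Gw]] := exists_rotation_to_axis w.
suff -> : householder w = G *m sign0 n *m G^T.
  apply: preserves_gaussM => //; apply: preserves_gaussM => //.
  exact: preserves_gauss_sign0.
have GTG : G^T *m G = 1%:M by exact: mulmx1C.
suff E : householder w *m G = G *m sign0 n.
  by rewrite -E -mulmxA GG mulmx1.
pose a := (w^T *m G) 0 0.
have wGE : w^T *m G = a *: (e0 n)^T.
  apply/matrixP => i k; rewrite [i]ord1 [RHS]mxE [(e0 n)^T _ _]mxE [e0 n _ _]mxE.
  rewrite eqxx andbT; have [->|k0] := eqVneq k ord0; first by rewrite mulr1.
  by rewrite mulr0 Gw.
have wE : w^T = a *: ((e0 n)^T *m G^T).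
  by rewrite scalemxAl -wGE -mulmxA GG mulmx1.
have wE' : w = a *: (G *m e0 n).
  by rewrite -[LHS]trmxK wE linearZ/= trmx_mul !trmxK.
have sw : sqnorm w = a ^+ 2.
  by rewrite {1}wE' sqnormZ sqnorm_mulmx// sqnorm_e0 mulr1.
have a0 : a != 0 by rewrite -sqrf_eq0 -sw sqnorm_eq0.
rewrite mul_householder wGE sw {1}wE'.
have -> : (2 / a ^+ 2) *: ((a *: (G *m e0 n)) *m (a *: (e0 n)^T)) =
    2 *: (G *m e0 n *m (e0 n)^T).
  by rewrite -scalemxAl -scalemxAr !scalerA; congr (_ *: _); field.
apply/matrixP => r k; rewrite mulmx_sign0 -colE !mxE big_ord1 !mxE eqxx andbT.
have [->|k0] := eqVneq k ord0; last by rewrite mulr0 mulr0 subr0.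
by rewrite mulr1; ring.
Qed.

End Householder.

(** * Concentration *)

Section Concentration.
Context {R : realType} {d} {T : measurableType d} (P : probability T R).
Local Notation gauss := (@gauss R).

Lemma join_family_inj (I I1 I2 : finType) (h1 : I1 -> I) (h2 : I2 -> I)
    (X : I -> T -> R) :
  injective h1 -> injective h2 -> (forall i j, h1 i != h2 j) ->
  gauss_family P X -> gauss_family P (join_family (X \o h1) (X \o h2)).
Proof.
move=> h1I h2I h12 gX.
pose h (i : I1 + I2) := match i with inl i => h1 i | inr i => h2 i end.
rewrite (_ : join_family _ _ = X \o h); last by apply/funext => -[].
apply: gauss_family_inj => // -[i|i] [j|j] /=.
- by move=> /h1I ->.
- by move=> /eqP; rewrite (negbTE (h12 i j)).
- by move=> /esym/eqP; rewrite (negbTE (h12 j i)).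
- by move=> /h2I ->.
Qed.

(** Once [X] is frozen, [Q] is a fixed matrix and [H *m Q] has the Gaussian law; as this law is the
    same for every frozen value, it is also the unconditional one. *)
Lemma random_rotation (I : finType) (X : I -> T -> R) m n
    (H : T -> 'M[R]_(m, n)) (Q : T -> 'M[R]_n) :
  gauss_family P (join_family X (entries H)) ->
  measurable_mx (T := sigmaT X) Q -> (forall t, preserves_gauss (Q t)) ->
  gauss_family P (entries (fun t => H t *m Q t)).
Proof.
move=> gXH mQ pQ.
have gH := gauss_family_inr gXH.
have mX i : measurable_fun [set: T] (X i) := gXH.1 (inl i).
have mHs : measurable_mx (T := sigmaT (entries H)) H.
  by move=> i j; exact: (@measurable_sigmaT _ _ _ _ (entries H) (i, j)).
have mprod : measurable_mx (T := (sigmaT X * sigmaT (entries H))%type)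
    (fun z => H z.2 *m Q z.1).
  apply: measurable_mxM => i j.
  - exact: (measurableT_comp (mHs i j) measurable_snd).
  - exact: (measurableT_comp (mQ i j) measurable_fst).
split=> [[i j]|B mB].
  have mdiag := measurable_fun_pair (sigmaT_sub mX) (sigmaT_sub gH.1).
  exact: (measurableT_comp (mprod i j) mdiag).
pose E : set (sigmaT X * sigmaT (entries H)) :=
  [set z | forall ij, B ij ((H z.2 *m Q z.1) ij.1 ij.2)].
have mE : measurable E.
  rewrite (_ : E = \bigcap_(ij in [set: 'I_m * 'I_n])
      ((fun z => (H z.2 *m Q z.1) ij.1 ij.2) @^-1` B ij)); last first.
    by apply/seteqP; split => z /= h ij; [move=> _|]; exact: h.
  apply: fin_bigcap_measurable => // ij _.
  by rewrite -[_ @^-1` _]setTI; exact: mprod.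
transitivity (P [set t | E (t, t)]) => //.
rewrite (freezing_prob gXH mE).
transitivity (\int[P]_t (cst (\prod_ij gauss (B ij)) t))%E; last first.
  by rewrite integral_cst//= probability_setT mule1.
apply: eq_integral => t _ /=.
(* Here [preserves_gauss] is applied with an empty companion family. *)
have gv : gauss_family P (join_family (fun x : void => match x with end : T -> R) (entries H)).
  have := @gauss_family_inj _ _ _ P _ _
    (fun x : void + 'I_m * 'I_n => match x with inl v => match v with end | inr y => y end)
     (entries H).
  rewrite (_ : entries H \o _ = join_family (fun x : void => match x with end : T -> R) (entries H)); last first.
    by apply/funext => -[[]|].
  by apply=> // -[[]|x] [[]|y] //= ->.
have := pQ t _ _ _ _ _ _ _ gv => /gauss_family_inr[_ gHQ].
exact: gHQ.
Qed.

Lemma ge0_integral_gauss_family (I : finType) (X : I -> T -> R) i (f : R -> \bar R) :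
  gauss_family P X -> measurable_fun [set: R] f -> (forall x, 0 <= f x)%E ->
  (\int[P]_t f (X i t) = \int[gauss]_x f x)%E.
Proof.
move=> gX mf f0; have mXi := gX.1 i.
pose Xi : {mfun T >-> R} := HB.pack (X i) (isMeasurableFun.Build _ _ _ _ _ mXi).
rewrite -[LHS](@ge0_integral_distribution _ _ _ _ _ P Xi f mf f0).
apply: eq_measure_integral => A mA _.
have gXi : gauss_family P (X \o (fun _ : unit => i)).
  by apply: gauss_family_inj => // -[] [].
have := gXi.2 (fun=> A) (fun=> mA).
rewrite (big_pred1 tt)//= => <-; congr (P _).
by apply/seteqP; split => t; [move=> h u; exact: h|move=> h; exact: (h tt)].
Qed.

(** One factor is split off at a time, and its coordinate frozen while the others are integrated. *)
Lemma expectation_prod (I : finType) (X : I -> T -> R) (f : I -> R -> R) (c : I -> R) :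
  gauss_family P X -> (forall i, measurable_fun [set: R] (f i)) ->
  (forall i x, 0 <= f i x) ->
  (forall i, \int[gauss]_x (f i x)%:E = (c i)%:E)%E ->
  (\int[P]_t (\prod_i f i (X i t))%:E = (\prod_i c i)%:E)%E.
Proof.
move=> gX mf f0 fc.
suff H (s : seq I) : uniq s ->
    (\int[P]_t (\prod_(i <- s) f i (X i t))%:E = (\prod_(i <- s) c i)%:E)%E.
  exact/H/index_enum_uniq.
elim: s => [_|i s IH /= /andP[iNs us]].
  under eq_integral do rewrite big_nil.
  by rewrite big_nil integral_cst//= probability_setT mule1.
rewrite big_cons EFinM -IH//.
pose X1 : unit -> T -> R := X \o (fun=> i).
pose X2 : {j | j \in s} -> T -> R := X \o val.
have gX12 : gauss_family P (join_family X1 X2).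
  apply: join_family_inj; [by move=> [] []|exact: val_inj| |exact: gX].
  by move=> _ [j js]/=; apply: contraNneq iNs => ->.
have mg1 : measurable_fun [set: sigmaT X1] (fun t => f i (X i t)).
  exact: (measurableT_comp (mf i) (@measurable_sigmaT _ _ _ _ X1 tt)).
have mg2 : measurable_fun [set: sigmaT X2] (fun t => \prod_(j <- s) f j (X j t)).
  apply: measurable_prod => j js.
  exact: (measurableT_comp (mf j) (@measurable_sigmaT _ _ _ _ X2 (exist _ j js))).
have p0 t : 0 <= \prod_(j <- s) f j (X j t) by exact: prodr_ge0.
pose F (z : sigmaT X1 * sigmaT X2) : \bar R :=
  ((f i (X i z.1))%:E * (\prod_(j <- s) f j (X j z.2))%:E)%E.
transitivity (\int[P]_t F (t, t))%E.
  by apply: eq_integral => t _; rewrite big_cons EFinM.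
rewrite (freezing gX12); last 2 first.
- apply: emeasurable_funM; apply/measurable_EFinP.
  + exact: (measurableT_comp mg1 measurable_fst).
  + exact: (measurableT_comp mg2 measurable_snd).
- by move=> z; rewrite mule_ge0// lee_fin.
have mXi := gX.1.
rewrite /F/=.
under eq_integral => t _.
  rewrite ge0_integralZl//; last 3 first.
  - apply/measurable_EFinP; apply: measurable_prod => j js.
    exact: (measurableT_comp (mf j) (mXi j)).
  - by move=> s' _; rewrite lee_fin.
  - by rewrite lee_fin.
  over.
rewrite ge0_integralZr//; last 3 first.
- by apply/measurable_EFinP; exact: (measurableT_comp (mf i) (mXi i)).
- by move=> t _; rewrite lee_fin.
- by apply: integral_ge0 => t _; rewrite lee_fin.
congr (_ * _)%E.
rewrite (@ge0_integral_gauss_family _ X i (EFin \o f i))//; last first.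
- by move=> x; rewrite lee_fin.
- exact/measurable_EFinP.
- by rewrite fc.
Qed.

Lemma exp_markov (Y : T -> R) (k : R) : measurable_fun [set: T] Y ->
  (P [set t | (k <= Y t)%R] <= (expR (- k))%:E * \int[P]_t (expR (Y t))%:E)%E.
Proof.
move=> mY; have mA : measurable [set t | k <= Y t].
  rewrite (_ : [set t | _] = Y @^-1` `[k, +oo[%classic); last first.
    by apply/seteqP; split => t /=; rewrite in_itv/= andbT.
  by rewrite -[_ @^-1` _]setTI; exact: mY.
have mexp : measurable_fun [set: T] (EFin \o (fun t => expR (Y t))).
  by apply/measurable_EFinP; apply: measurableT_comp.
rewrite -ge0_integralZl//.
rewrite -(setIT [set t | k <= Y t]) -integral_indic//.
apply: ge0_le_integral => //=.
- by apply/measurable_EFinP; exact: measurable_indic.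
- by apply: emeasurable_funM => //; exact: measurable_cst.
move=> t _; rewrite -EFinM lee_fin indicE; case: (boolP (t \in _)) => [|_].
  by rewrite inE/= => kY; rewrite -expRD -[leLHS]expR0 ler_expR addrC subr_ge0.
by rewrite mulr_ge0// expR_ge0.
Qed.

Lemma linear_form_mgf n (g : T -> 'cV[R]_n) (s : 'cV[R]_n) :
  gauss_family P (entries g) ->
  (\int[P]_t (expR (dot s (g t)))%:E = (expR (sqnorm s / 2))%:E)%E.
Proof.
move=> gg.
pose f (ij : 'I_n * 'I_1) x := expR (s ij.1 0 * x).
have := @expectation_prod _ (entries g) f (fun ij => expR (s ij.1 0 ^+ 2 / 2)) gg.
have big1col (F : 'I_n -> R) : \sum_(ij : 'I_n * 'I_1) F ij.1 = \sum_i F i.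
  rewrite -(pair_big xpredT xpredT (fun i (j : 'I_1) => F i))/=.
  by apply: eq_bigr => i _; rewrite big_ord1.
rewrite -expR_sum (big1col (fun i => s i 0 ^+ 2 / 2)) -mulr_suml -/(sqnorm s) => <-.
- apply: eq_integral => t _; rewrite /f -expR_sum; congr (expR _)%:E.
  rewrite /dot -(big1col (fun i => s i 0 * g t i 0)); apply: eq_bigr => -[i j] _ /=.
  by rewrite /entries/= ord1.
- move=> ij; apply: measurableT_comp; [exact: measurable_expR|exact: mulrl_measurable].
- by move=> ij x; exact: expR_ge0.
- by move=> ij; exact: gauss_mgf.
Qed.

(* The direction [s] is random but independent of the Gaussian vector [g]. *)
Lemma linear_form_tail (I : finType) (X : I -> T -> R) n (g s : T -> 'cV[R]_n)
    (v k : R) :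
  gauss_family P (join_family X (entries g)) ->
  measurable_mx (T := sigmaT X) s -> 0 < v -> 0 <= k ->
  measurable [set t | sqnorm (s t) <= v /\ k <= dot (s t) (g t)] /\
  (P [set t | (sqnorm (s t) <= v)%R /\ (k <= dot (s t) (g t))%R] <=
   (expR (- (k ^+ 2 / (2 * v))))%:E)%E.
Proof.
move=> gXg ms v0 k0; have gg := gauss_family_inr gXg.
pose E : set (sigmaT X * sigmaT (entries g)) :=
  [set z | sqnorm (s z.1) <= v /\ k <= dot (s z.1) (g z.2)].
have mE : measurable E.
  have msq : measurable_fun [set: sigmaT X * sigmaT (entries g)]
      (fun z => sqnorm (s z.1)).
    apply: measurable_sum => i; apply: measurable_funX.
    exact: (measurableT_comp (ms i 0) measurable_fst).
  have mdot : measurable_fun [set: sigmaT X * sigmaT (entries g)]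
      (fun z => dot (s z.1) (g z.2)).
    apply: measurable_sum => i; apply: measurable_funM.
      exact: (measurableT_comp (ms i 0) measurable_fst).
    exact: (measurableT_comp (@measurable_sigmaT _ _ _ _ (entries g) (i, 0)) measurable_snd).
  rewrite (_ : E = (fun z => sqnorm (s z.1)) @^-1` `]-oo, v]%classic `&`
      (fun z => dot (s z.1) (g z.2)) @^-1` `[k, +oo[%classic); last first.
    by apply/seteqP; split => z /=; rewrite !in_itv/= andbT.
  apply: measurableI; rewrite -[_ @^-1` _]setTI; [exact: msq|exact: mdot].
split; first exact: (measurable_diagonal gXg mE).
have -> : [set t | sqnorm (s t) <= v /\ k <= dot (s t) (g t)] = [set t | E (t, t)] by [].
rewrite (freezing_prob gXg mE).
apply: (@le_trans _ _ (\int[P]_t (cst (expR (- (k ^+ 2 / (2 * v))))%:E t))%E); last first.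
  by rewrite integral_cst//= probability_setT mule1.
apply: ge0_le_integral => //=.
- have mI : measurable_fun [set: sigmaT X * sigmaT (entries g)]
    (fun z => (\1_E z : R)%:E) by apply/measurable_EFinP; exact: measurable_indic.
  have mX i : measurable_fun [set: T] (X i) := gXg.1 (inl i).
  pose P2 := distribution P (to_sigmaT gg.1).
  have mF := @measurable_fun_fubini_tonelli_F _ _ (sigmaT X) (sigmaT (entries g)) R P2
    _ mI (fun z => ltac:(by rewrite lee_fin)).
  rewrite (_ : (fun t => _) = fubini_F P2 (fun z => (\1_E z : R)%:E)).
    exact: (measurable_fun_sigmaT mX mF).
  apply/funext => t; rewrite /fubini_F.
  rewrite (_ : (fun y => _) = fun y => (\1_([set s' | E (t, s')]) y : R)%:E)//.
  rewrite integral_indic ?setIT//.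
  have := @measurable_pair1 _ _ (sigmaT X) (sigmaT (entries g)) t measurableT E mE.
  by rewrite setTI.
move=> t _.
have [sv|vs] := leP (sqnorm (s t)) v; last first.
  rewrite (_ : [set s0 | _] = set0) ?measure0//.
  by apply/seteqP; split => // s' -[]; rewrite leNgt vs.
(* The minimiser of the Chernoff exponent [- th * k + th ^+ 2 * v / 2]. *)
pose th := k / v.
have mdot : measurable_fun [set: T] (fun s' => dot (th *: s t) (g s')).
  apply: measurable_sum => i; apply: measurable_funM => //.
  exact: (gg.1 (i, 0)).
apply: (@le_trans _ _ (P [set s' | th * k <= dot (th *: s t) (g s')])).
  apply: le_measure; rewrite ?inE.
  - exact: (measurable_frozen gXg).
  - rewrite (_ : [set s' | _] = (fun s' => dot (th *: s t) (g s')) @^-1` `[th * k, +oo[%classic).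
      by rewrite -[_ @^-1` _]setTI; exact: mdot.
    by apply/seteqP; split => s' /=; rewrite in_itv/= andbT.
  - move=> s' [/= _ ks]; rewrite /dot.
    rewrite (eq_bigr (fun i => th * (s t i 0 * g s' i 0))); last first.
      by move=> i _; rewrite mxE mulrA.
    by rewrite -mulr_sumr ler_wpM2l// divr_ge0// ltW.
apply: (le_trans (exp_markov (th * k) mdot)).
rewrite linear_form_mgf// -EFinM lee_fin -expRD ler_expR sqnormZ.
have -> : - (k ^+ 2 / (2 * v)) = - (th * k) + th ^+ 2 * v / 2.
  by rewrite /th; field; rewrite gt_eqF.
by rewrite lerD2l ler_wpM2r// ler_wpM2l// sqr_ge0.
Qed.

(** Each coordinate contributes [(1 - 2 * s)] to the power [- 1 / 2], and [(1 - 2 * s)^-1 = 1 + 2 *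
    x <= expR (2 * x)] for [x = s / (1 - 2 * s)]. *)
Lemma sqnorm_mgf n (g : T -> 'cV[R]_n) (s : R) : s < 1 / 2 ->
  gauss_family P (entries g) ->
  (\int[P]_t (expR (s * sqnorm (g t)))%:E <= (expR (s / (1 - 2 * s) * n%:R))%:E)%E.
Proof.
move=> s2 gg.
pose f (ij : 'I_n * 'I_1) x := expR (s * x ^+ 2).
have := @expectation_prod _ (entries g) f (fun ij => (Num.sqrt (1 - 2 * s))^-1) gg.
rewrite prodr_const card_prod !card_ord muln1 => intE.
rewrite (_ : \int[P]_t _ = ((Num.sqrt (1 - 2 * s))^-1 ^+ n)%:E)%E; last first.
  rewrite -intE.
  - apply: eq_integral => t _; rewrite /f -expR_sum; congr (expR _)%:E.
    rewrite /sqnorm mulr_sumr.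
    rewrite -(pair_big xpredT xpredT (fun i (j : 'I_1) => s * entries g (i, j) t ^+ 2))/=.
    by apply: eq_bigr => i _; rewrite big_ord1.
  - move=> ij; apply: measurableT_comp; first exact: measurable_expR.
    by apply: measurable_funM => //; exact: measurable_funX.
  - by move=> ij x; exact: expR_ge0.
  - by move=> ij; exact: gauss_sqr_mgf.
have a0 : 0 < 1 - 2 * s by lra.
rewrite lee_fin [_ / _ * n%:R]mulrC expRM_natl; apply: lerXn2r; rewrite ?nnegrE ?expR_ge0 ?invr_ge0 ?sqrtr_ge0//.
set x := s / (1 - 2 * s).
have -> : expR x = Num.sqrt (expR (2%:R * x)).
  by rewrite expRM_natl sqrtr_sqr ger0_norm ?expR_ge0.
have -> : (Num.sqrt (1 - 2 * s))^-1 = Num.sqrt (1 - 2 * s)^-1 by rewrite sqrtrV// ltW.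
apply: ler_wsqrtr; apply: (le_trans _ (expR_ge1Dx _)).
by rewrite le_eqVlt; apply/orP; left; apply/eqP; rewrite /x; field; lra.
Qed.

Lemma sqnorm_upper_tail m (N : nat) (g : T -> 'cV[R]_m) (tau : R) :
  0 < tau <= 1 -> (m <= N)%N -> gauss_family P (entries g) ->
  measurable [set t | (1 + tau) * N%:R <= sqnorm (g t)] /\
  (P [set t | ((1 + tau) * N%:R <= sqnorm (g t))%R] <= (expR (- (tau ^+ 2 / 16 * N%:R)))%:E)%E.
Proof.
(* With this parameter [s / (1 - 2 * s) <= s * (1 + tau / 2)], which leaves the exponent
   [- s * tau / 2], that is [- tau ^+ 2 / 16], per unit of [N]. *)
move=> /andP[t0 t1] mN gg; pose s := tau / 8.
have s0 : 0 < s by rewrite /s; lra.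
have s2 : s < 1 / 2 by rewrite /s; lra.
have mY : measurable_fun [set: T] (fun t => s * sqnorm (g t)).
  apply: measurable_funM => //; apply: measurable_sum => i; apply: measurable_funX.
  exact: (gg.1 (i, 0)).
have -> : [set t | (1 + tau) * N%:R <= sqnorm (g t)] =
    [set t | s * ((1 + tau) * N%:R) <= s * sqnorm (g t)].
  by apply/seteqP; split => t /=; rewrite ler_pM2l.
split.
  rewrite (_ : [set t | _] = (fun t => s * sqnorm (g t)) @^-1` `[s * ((1 + tau) * N%:R), +oo[%classic).
    by rewrite -[_ @^-1` _]setTI; exact: mY.
  by apply/seteqP; split => t /=; rewrite in_itv/= andbT.
apply: (le_trans (exp_markov _ mY)).
apply: (le_trans (lee_wpmul2l _ (sqnorm_mgf s2 gg))); first by rewrite lee_fin expR_ge0.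
rewrite -EFinM lee_fin -expRD ler_expR.
have a0 : 0 < 1 - 2 * s by lra.
have mN' : s / (1 - 2 * s) * m%:R <= s / (1 - 2 * s) * N%:R.
  by rewrite ler_wpM2l ?ler_nat// divr_ge0// ltW.
have h1 : s / (1 - 2 * s) <= s * (1 + tau / 2).
  rewrite ler_pdivrMr// -mulrA -{1}[s]mulr1 ler_pM2l// /s; nra.
have N0 : 0 <= N%:R :> R by [].
have h2 : s / (1 - 2 * s) * N%:R <= s * (1 + tau / 2) * N%:R by rewrite ler_wpM2r.
have sE : s = tau / 8 by [].
apply: (@le_trans _ _ (- (s * ((1 + tau) * N%:R)) + s * (1 + tau / 2) * N%:R)); first lra.
by rewrite le_eqVlt; apply/orP; left; apply/eqP; rewrite sE; field.
Qed.

Lemma sqnorm_lower_tail m (g : T -> 'cV[R]_m) (tau : R) :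
  0 < tau <= 1 -> gauss_family P (entries g) ->
  measurable [set t | sqnorm (g t) <= (1 - tau) * m%:R] /\
  (P [set t | (sqnorm (g t) <= (1 - tau) * m%:R)%R] <= (expR (- (tau ^+ 2 / 16 * m%:R)))%:E)%E.
Proof.
(* A negative parameter turns the lower tail into an upper one; now
   [s / (1 - 2 * s) <= s * (1 - tau / 2)], with the same final exponent. *)
move=> /andP[t0 t1] gg; pose s := - (tau / 8).
have s0 : s < 0 by rewrite /s; lra.
have s2 : s < 1 / 2 by rewrite /s; lra.
have mY : measurable_fun [set: T] (fun t => s * sqnorm (g t)).
  apply: measurable_funM => //; apply: measurable_sum => i; apply: measurable_funX.
  exact: (gg.1 (i, 0)).
have -> : [set t | sqnorm (g t) <= (1 - tau) * m%:R] =
    [set t | s * ((1 - tau) * m%:R) <= s * sqnorm (g t)].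
  by apply/seteqP; split => t /=; rewrite ler_nM2l.
split.
  rewrite (_ : [set t | _] = (fun t => s * sqnorm (g t)) @^-1` `[s * ((1 - tau) * m%:R), +oo[%classic).
    by rewrite -[_ @^-1` _]setTI; exact: mY.
  by apply/seteqP; split => t /=; rewrite in_itv/= andbT.
apply: (le_trans (exp_markov _ mY)).
apply: (le_trans (lee_wpmul2l _ (sqnorm_mgf s2 gg))); first by rewrite lee_fin expR_ge0.
rewrite -EFinM lee_fin -expRD ler_expR.
have a0 : 0 < 1 - 2 * s by lra.
have h1 : s / (1 - 2 * s) <= s * (1 - tau / 2).
  rewrite ler_pdivrMr// -mulrA -{1}[s]mulr1 ler_nM2l// /s; nra.
have N0 : 0 <= m%:R :> R by [].
have h2 : s / (1 - 2 * s) * m%:R <= s * (1 - tau / 2) * m%:R by rewrite ler_wpM2r.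
have sE : s = - (tau / 8) by [].
apply: (@le_trans _ _ (- (s * ((1 - tau) * m%:R)) + s * (1 - tau / 2) * m%:R)); first lra.
by rewrite le_eqVlt; apply/orP; left; apply/eqP; rewrite sE; field.
Qed.

End Concentration.

(** * Golub-Kahan bidiagonalisation and extreme singular values *)

Section Outside.
Context {R : realType} {d} {T : measurableType d} (P : probability T R).

(** Only the exceptional set has to be measurable: [E] may quantify over all vectors or all
    eigenvalues. *)
Definition holds_up_to (e : R) (E : T -> Prop) : Prop :=
  exists N : set T,
    [/\ measurable N, (P N <= e%:E)%E & forall t, ~ N t -> E t].

Lemma holds_up_to_le e e' (E F : T -> Prop) :
  e <= e' -> (forall t, E t -> F t) -> holds_up_to e E -> holds_up_to e' F.
Proof.
move=> ee' EF [N [mN PN EN]]; exists N; split => // [|t Nt]; last exact/EF/EN.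
by rewrite (le_trans PN)// lee_fin.
Qed.

Lemma holds_up_toT e (E : T -> Prop) : 0 <= e -> (forall t, E t) -> holds_up_to e E.
Proof. by move=> e0 Et; exists set0; split => //; rewrite measure0 lee_fin. Qed.

Lemma holds_up_to_set (N : set T) e :
  measurable N /\ (P N <= e%:E)%E -> holds_up_to e (fun t => ~ N t).
Proof. by move=> [mN PN]; exists N; split. Qed.

Lemma holds_up_to_and e f (E F : T -> Prop) :
  holds_up_to e E -> holds_up_to f F -> holds_up_to (e + f) (fun t => E t /\ F t).
Proof.
move=> [N [mN PN EN]] [M [mM PM FM]]; exists (N `|` M); split.
- exact: measurableU.
- by rewrite (le_trans (measureU2 _ mN mM))// EFinD leeD.
- by move=> t NMt; split; [apply: EN|apply: FM] => h; apply: NMt; [left|right].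
Qed.

Lemma holds_up_to_forall (I : Type) (s : seq I) e (E : I -> T -> Prop) :
  (forall i, holds_up_to e (E i)) ->
  holds_up_to ((size s)%:R * e) (fun t => forall i, List.In i s -> E i t).
Proof.
move=> hE; elim: s => [|i s IH].
  by apply: holds_up_toT => //; rewrite mul0r.
have := holds_up_to_and (hE i) IH; apply: holds_up_to_le.
  by rewrite /= -[in leRHS]natr1 mulrDl mul1r addrC.
by move=> t [Et Es] j /= [<-|]; [|exact: Es].
Qed.

Lemma holds_up_to_finType (I : finType) e (E : I -> T -> Prop) :
  (forall i, holds_up_to e (E i)) ->
  holds_up_to (#|I|%:R * e) (fun t => forall i, E i t).
Proof.
move=> hE; rewrite cardE; have := holds_up_to_forall (enum I) hE.
apply: holds_up_to_le => // t h i; apply: h.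
have : i \in enum I by rewrite mem_enum.
elim: (enum I) => // j s IH; rewrite in_cons => /orP[/eqP ->|/IH]; by [left|right].
Qed.

End Outside.

Section GolubKahan.
Context {R : realType} {d} {T : measurableType d} (P : probability T R).

Lemma sqnorm_col_mx m n (u : 'cV[R]_m) (v : 'cV[R]_n) :
  sqnorm (col_mx u v) = sqnorm u + sqnorm v.
Proof.
rewrite /sqnorm big_split_ord/=; congr (_ + _).
- by apply: eq_bigr => i _; rewrite col_mxEu.
- by apply: eq_bigr => i _; rewrite col_mxEd.
Qed.

Lemma sqnorm_scalar_mx (a : R) : sqnorm (a%:M : 'cV_1) = a ^+ 2.
Proof. by rewrite /sqnorm big_ord1 mxE eqxx mulr1n. Qed.

Lemma sqnorm_e0D_col_mx n a (u : 'cV[R]_1) (v : 'cV[R]_n) :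
  sqnorm (a *: e0 n + col_mx u v) = sqnorm (a%:M + u) + sqnorm v.
Proof.
transitivity (sqnorm (col_mx (a%:M + u) v)); last exact: sqnorm_col_mx.
congr sqnorm.
apply/matrixP => i j; rewrite ord1; case: (@split_ordP 1 n i) => k ->.
- rewrite [RHS](col_mxEu (a%:M + u) v) [LHS]mxE (col_mxEu u v) !mxE ord1.
  by rewrite !eqxx mulr1 mulr1n.
- by rewrite [RHS](col_mxEd (a%:M + u) v) [LHS]mxE (col_mxEd u v) !mxE mulr0 add0r.
Qed.

(* One step of the Golub-Kahan bidiagonalisation: reflect the columns so that
   the first row becomes [(|g|, 0, ..., 0)], then the remaining rows so that the
   remaining part of the first column becomes [(|c|, 0, ..., 0)].  The block [G']
   left over is again Gaussian. *)
Lemma golub_kahan_step n m (G : T -> 'M[R]_(1 + n.+1, 1 + m)) :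
  gauss_family P (entries G) ->
  exists (g : T -> 'cV[R]_m.+1) (c : T -> 'cV[R]_n.+1) (G' : T -> 'M[R]_(n.+1, m))
    (V : T -> 'M[R]_n.+1),
  [/\ gauss_family P (entries g), gauss_family P (entries c),
      gauss_family P (entries G'),
      forall t, (V t)^T *m V t = 1%:M &
      forall t a q, sqnorm ((G t)^T *m col_mx a%:M (V t *m q)) =
        (a * Num.sqrt (sqnorm (g t)) + Num.sqrt (sqnorm (c t)) * q 0 0) ^+ 2 +
        sqnorm ((G' t)^T *m q)].
Proof.
move=> gG.
pose g t : 'cV[R]_m.+1 := (usubmx (G t))^T.
pose H t : 'M[R]_(n.+1, m.+1) := dsubmx (G t).
have ggH : gauss_family P (join_family (entries g) (entries H)).
  have := @join_family_inj _ _ _ P _ _ _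
    (fun ij : 'I_m.+1 * 'I_1 => (lshift n.+1 ij.2, ij.1))
    (fun ij : 'I_n.+1 * 'I_m.+1 => (rshift 1 ij.1, ij.2)) (entries G).
  rewrite (_ : entries G \o _ = entries g); last first.
    by apply/funext => ij; apply/funext => t; rewrite /entries/= !mxE.
  rewrite (_ : entries G \o _ = entries H); last first.
    by apply/funext => ij; apply/funext => t; rewrite /entries/= !mxE.
  apply=> //.
  - by move=> [i i'] [j j'] /= /pair_equal_spec[/lshift_inj -> ->].
  - by move=> [i i'] [j j'] /= /pair_equal_spec[/rshift_inj -> ->].
  - by move=> [i i'] [j j']; rewrite xpair_eqE eq_lrshift.
have gg := gauss_family_inl ggH.
have mg : measurable_mx (T := sigmaT (entries g)) g.
  by move=> i j; exact: (@measurable_sigmaT _ _ _ _ (entries g) (i, j)).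
(* The reflection is determined by the first row and acts on the remaining ones, which are
   independent of it. *)
have gH1 := random_rotation ggH (measurable_to_e0 mg)
  (fun t => preserves_gauss_householder _).
set H1 := fun t => H t *m to_e0 (g t) in gH1.
pose c t : 'cV[R]_n.+1 := lsubmx (H1 t : 'M[R]_(n.+1, 1 + m)).
(* Transposed, so that the reflection of the rows becomes a multiplication on the right. *)
pose K t : 'M[R]_(m, n.+1) := (rsubmx (H1 t : 'M[R]_(n.+1, 1 + m)))^T.
have gcK : gauss_family P (join_family (entries c) (entries K)).
  have := @join_family_inj _ _ _ P _ _ _
    (fun ij : 'I_n.+1 * 'I_1 => (ij.1, lshift m ij.2 : 'I_m.+1))
    (fun ij : 'I_m * 'I_n.+1 => (ij.2, rshift 1 ij.1 : 'I_m.+1)) (entries H1).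
  rewrite (_ : entries H1 \o _ = entries c); last first.
    by apply/funext => -[i j]; apply/funext => t; rewrite /entries/= [RHS]mxE.
  rewrite (_ : entries H1 \o _ = entries K); last first.
    by apply/funext => -[i j]; apply/funext => t; rewrite /entries/= [RHS]mxE [RHS]mxE.
  apply=> //.
  - by move=> [i i'] [j j'] /= /pair_equal_spec[-> _]; rewrite [i']ord1 [j']ord1.
  - by move=> [i i'] [j j'] /= /pair_equal_spec[-> /(@rshift_inj 1 m) ->].
  - move=> [i i'] [j j'] /=; apply/eqP => /pair_equal_spec[_ /eqP].
    by rewrite (@eq_lrshift 1 m).
have gc := gauss_family_inl gcK.
have mc : measurable_mx (T := sigmaT (entries c)) c.
  by move=> i j; exact: (@measurable_sigmaT _ _ _ _ (entries c) (i, j)).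
have gK1 := random_rotation gcK (measurable_to_e0 mc)
  (fun t => preserves_gauss_householder _).
set K1 := fun t => K t *m to_e0 (c t) in gK1.
pose G' t : 'M[R]_(n.+1, m) := (K1 t)^T.
have gG' : gauss_family P (entries G').
  have := gauss_family_inj (h := fun ij : 'I_n.+1 * 'I_m => (ij.2, ij.1)) _ gK1.
  rewrite (_ : _ \o _ = entries G'); first by apply => -[i i'] [j j'] [] -> ->.
  by apply/funext => ij; apply/funext => t; rewrite /entries/= [RHS]mxE.
exists g, c, G', (fun t => to_e0 (c t)); split => // [t|t a q].
  by rewrite tr_householder householderK.
have QQ : (to_e0 (g t))^T *m to_e0 (g t) = 1%:M.
  by rewrite tr_householder householderK.
have -> : G t = col_mx (g t)^T (H t) by rewrite trmxK vsubmxK.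
rewrite tr_col_mx mul_row_col trmxK mul_mx_scalar -[LHS](sqnorm_mulmx _ QQ) mulmxDr.
rewrite -scalemxAr to_e0P.
have -> : to_e0 (g t) *m ((H t)^T *m (to_e0 (c t) *m q)) =
    col_mx ((c t)^T *m to_e0 (c t) *m q) (K1 t *m q).
  have H1E : (H1 t)^T = col_mx (c t)^T (K t).
    by rewrite /c /K -tr_row_mx hsubmxK.
  rewrite mulmxA -[to_e0 (g t)]tr_householder -trmx_mul -/(H1 t) H1E.
  by rewrite [LHS](mul_col_mx (c t)^T (K t) (to_e0 (c t) *m q)) !mulmxA.
rewrite scalerA sqnorm_e0D_col_mx.
congr (_ + _); last by rewrite /G' trmxK.
have -> : (c t)^T *m to_e0 (c t) = Num.sqrt (sqnorm (c t)) *: (e0 n)^T.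
  by rewrite -[to_e0 _]tr_householder -trmx_mul to_e0P linearZ.
have -> : (a * Num.sqrt (sqnorm (g t)))%:M +
    (Num.sqrt (sqnorm (c t)) *: (e0 n)^T) *m q =
    (a * Num.sqrt (sqnorm (g t)) + Num.sqrt (sqnorm (c t)) * q 0 0)%:M :> 'M[R]_1.
  rewrite -scalemxAl /e0 trmx_delta -rowE.
  by apply/matrixP => i j; rewrite !ord1 !mxE eqxx !mulr1n.
by rewrite sqnorm_scalar_mx.
Qed.

End GolubKahan.

(** * Bounds along the bidiagonalisation *)

Section ExtremeSingularValues.
Context {R : realType} {d} {T : measurableType d} (P : probability T R).

Lemma sqnorm_trivial (v : 'cV[R]_0) : sqnorm v = 0.
Proof. by rewrite /sqnorm big_ord0. Qed.

Lemma cV_split n (v : 'cV[R]_(1 + n)) : v = col_mx (v 0 0)%:M (dsubmx v).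
Proof.
rewrite -[LHS]vsubmxK; congr col_mx; apply/matrixP => i j.
by rewrite !ord1 !mxE eqxx mulr1n; congr (v _ _); exact: val_inj.
Qed.

Lemma expR_tail_le (tau : R) m N : (N <= m)%N ->
  expR (- (tau ^+ 2 / 16 * m%:R)) <= expR (- (tau ^+ 2 / 16 * N%:R)).
Proof.
move=> Nm; rewrite ler_expR lerN2 ler_wpM2l ?ler_nat//.
by rewrite divr_ge0// sqr_ge0.
Qed.

(* The term [q 0 0 ^+ 2] makes the bound self-improving along the reduction:
   by Cauchy-Schwarz
   [(a s + b t) ^+ 2 <= (S + U) * (S * a ^+ 2 + U * b ^+ 2)]. *)
Lemma sqnorm_upper_bound (tau : R) (M N : nat) : 0 < tau <= 1 ->
  let S := Num.sqrt ((1 + tau) * M%:R) in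
  let U := Num.sqrt ((1 + tau) * N%:R) in
  let e := expR (- (tau ^+ 2 / 16 * M%:R)) + expR (- (tau ^+ 2 / 16 * N%:R)) in
  forall n m (G : T -> 'M[R]_(n.+1, m)), (n <= N)%N -> (m <= M)%N ->
  gauss_family P (entries G) ->
  holds_up_to P (n.+1%:R * e) (fun t => forall q,
    sqnorm ((G t)^T *m q) <=
      (S + U) ^+ 2 * sqnorm q - U * (S + U) * q 0 0 ^+ 2).
Proof.
move=> tau01 S U e; have tau0 : 0 < tau by case/andP: tau01.
have S0 : 0 <= S by exact: sqrtr_ge0.
have U0 : 0 <= U by exact: sqrtr_ge0.
have S2 : S ^+ 2 = (1 + tau) * M%:R by rewrite sqr_sqrtr// mulr_ge0// addr_ge0// ltW.
have U2 : U ^+ 2 = (1 + tau) * N%:R by rewrite sqr_sqrtr// mulr_ge0// addr_ge0// ltW.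
have eps0 : 0 <= e by rewrite addr_ge0// expR_ge0.
have q0_le k (q : 'cV[R]_k.+1) : q 0 0 ^+ 2 <= sqnorm q.
  by rewrite /sqnorm (bigD1 ord0)//= lerDl sumr_ge0// => i _; exact: sqr_ge0.
have upper k (g : T -> 'cV[R]_k) K V : V ^+ 2 = (1 + tau) * K%:R -> 0 <= V ->
    (k <= K)%N -> gauss_family P (entries g) ->
    holds_up_to P (expR (- (tau ^+ 2 / 16 * K%:R)))
      (fun t => Num.sqrt (sqnorm (g t)) <= V).
  move=> V2 V0 kK gg.
  apply: (holds_up_to_le (lexx _) _ (holds_up_to_set (sqnorm_upper_tail tau01 kK gg))).
  move=> t /= /negP; rewrite -ltNge -V2 => h.
  by rewrite -(ger0_norm V0) -sqrtr_sqr ler_wsqrtr// ltW.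
(* For a single row the required factor is [(S + U) ^+ 2 - U * (S + U) = S ^+ 2 + S * U], and the
   norm of the row is at most [S]. *)
elim=> [|n IH] m G nN mM gG.
  have ggT : gauss_family P (entries (fun t => (G t)^T)).
    have := gauss_family_inj (h := fun ij : 'I_m * 'I_1 => (ij.2, ij.1)) _ gG.
    rewrite (_ : _ \o _ = entries (fun t => (G t)^T)).
      by apply => -[i i'] [j j'] [] -> ->.
    by apply/funext => ij; apply/funext => t; rewrite /entries/= mxE.
  apply: (holds_up_to_le _ _ (upper _ _ _ _ S2 S0 mM ggT)).
    by rewrite mul1r lerDl expR_ge0.
  move=> t gS q; rewrite {1}(_ : q = (q 0 0)%:M); last first.
    by apply/matrixP => i j; rewrite !ord1 mxE eqxx mulr1n.
  rewrite mul_mx_scalar sqnormZ.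
  have gS2 : sqnorm (G t)^T <= S ^+ 2.
    rewrite -[leLHS]sqr_sqrtr ?sqnorm_ge0// lerXn2r ?nnegrE ?sqrtr_ge0//.
  have -> : sqnorm q = q 0 0 ^+ 2 by rewrite /sqnorm big_ord1.
  have q2 : 0 <= q 0 0 ^+ 2 by exact: sqr_ge0.
  have := ler_wpM2l q2 gS2.
  have : 0 <= q 0 0 ^+ 2 * (S * U) by rewrite mulr_ge0// mulr_ge0.
  by nra.
case: m => [|m] in G mM gG *.
  apply: holds_up_toT => [|t q]; first by rewrite mulr_ge0.
  have SU0 : 0 <= S + U by exact: addr_ge0.
  rewrite sqnorm_trivial subr_ge0; apply: ler_pM => //.
  - exact: mulr_ge0.
  - exact: sqr_ge0.
  - by rewrite expr2 ler_wpM2r// lerDr.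
have [g [c [G' [V [gg gc gG' VV GE]]]]] := golub_kahan_step (gG : gauss_family P (entries (G : T -> 'M[R]_(1 + n.+1, 1 + m)))).
have h := holds_up_to_and (holds_up_to_and (upper _ _ _ _ S2 S0 mM gg)
  (upper _ _ _ _ U2 U0 nN gc)) (IH _ _ (ltnW nN) (ltnW mM) gG').
apply: (holds_up_to_le _ _ h) => [|t [[sS tU] Gq] Q].
  by rewrite -/e -[in leRHS]natr1 mulrDl mul1r addrC.
pose q : 'cV[R]_n.+1 := (V t)^T *m dsubmx (Q : 'cV[R]_(1 + n.+1)).
have VV' : V t *m (V t)^T = 1%:M by exact: mulmx1C.
have QE : Q = col_mx (Q 0 0)%:M (V t *m q).
  by rewrite mulmxA VV' mul1mx -cV_split.
have qE : sqnorm (V t *m q) = sqnorm q by rewrite sqnorm_mulmx.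
have -> : sqnorm Q = Q 0 0 ^+ 2 + sqnorm q.
  transitivity (sqnorm (col_mx (Q 0 0)%:M (V t *m q))); first by rewrite -QE.
  by rewrite sqnorm_col_mx sqnorm_scalar_mx qE.
have -> : sqnorm ((G t)^T *m Q) =
    (Q 0 0 * Num.sqrt (sqnorm (g t)) + Num.sqrt (sqnorm (c t)) * q 0 0) ^+ 2 +
    sqnorm ((G' t)^T *m q) by rewrite -GE -QE.
have := Gq q; set s := Num.sqrt _ in sS *; set u := Num.sqrt _ in tU *.
have s0 : 0 <= s by exact: sqrtr_ge0.
have u0 : 0 <= u by exact: sqrtr_ge0.
set a := Q 0 0; set b := q 0 0.
have cs : (a * s + u * b) ^+ 2 <= (S + U) * (S * a ^+ 2 + U * b ^+ 2).
  have h1 : (a * s + u * b) ^+ 2 <= (`|a| * S + U * `|b|) ^+ 2.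
    rewrite -real_normK ?num_real// lerXn2r ?nnegrE ?addr_ge0 ?mulr_ge0//.
    rewrite (le_trans (ler_normD _ _))// !normrM (ger0_norm s0) (ger0_norm u0).
    by rewrite lerD ?ler_wpM2l ?ler_wpM2r.
  apply: (le_trans h1); rewrite -subr_ge0.
  rewrite (_ : _ - _ = S * U * (`|a| - `|b|) ^+ 2); last first.
    by rewrite -(real_normK (num_real a)) -(real_normK (num_real b)); ring.
  by rewrite mulr_ge0 ?sqr_ge0// mulr_ge0.
(* The term [U * (S + U) * b ^+ 2] produced by Cauchy-Schwarz cancels the one subtracted in the
   bound for [q]. *)
move=> hq; apply: (le_trans (lerD cs hq)).
by rewrite le_eqVlt; apply/orP; left; apply/eqP; ring.
Qed.

(** The vector is built from its tail: prepending [1] to [r] times the previous vector adds a term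
    at least [(S + r * U) ^+ 2] and multiplies the earlier ones by [r ^+ 2]. Keeping the head equal
    to [1] makes this recursion work. After [K] steps the block left over contributes at least zero,
    and [N + K <= n], [M + K <= m] keep the rows and columns used long enough. *)
Lemma sqnorm_lower_bound (tau r : R) (M N : nat) : 0 < tau <= 1 -> 0 <= r ->
  let S := Num.sqrt ((1 - tau) * M%:R) in
  let U := Num.sqrt ((1 - tau) * N%:R) in
  let e := expR (- (tau ^+ 2 / 16 * M%:R)) + expR (- (tau ^+ 2 / 16 * N%:R)) in
  forall K n m (G : T -> 'M[R]_(n.+1, m)), (N + K <= n)%N -> (M + K <= m)%N ->
  gauss_family P (entries G) ->
  holds_up_to P (K%:R * e) (fun t => exists q : 'cV[R]_n.+1,
    [/\ q 0 0 = 1, sqnorm q = \sum_(i < K.+1) (r ^+ 2) ^+ i &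
      (S + r * U) ^+ 2 * (\sum_(i < K) (r ^+ 2) ^+ i) <= sqnorm ((G t)^T *m q)]).
Proof.
move=> tau01 r0 S U e; have [tau0 tau1] := andP tau01.
have S0 : 0 <= S by exact: sqrtr_ge0.
have U0 : 0 <= U by exact: sqrtr_ge0.
have S2 : S ^+ 2 = (1 - tau) * M%:R by rewrite sqr_sqrtr// mulr_ge0// subr_ge0.
have U2 : U ^+ 2 = (1 - tau) * N%:R by rewrite sqr_sqrtr// mulr_ge0// subr_ge0.
have eps0 : 0 <= e by rewrite addr_ge0// expR_ge0.
have lower k (g : T -> 'cV[R]_k) K V : V ^+ 2 = (1 - tau) * K%:R -> 0 <= V ->
    (K <= k)%N -> gauss_family P (entries g) ->
    holds_up_to P (expR (- (tau ^+ 2 / 16 * K%:R)))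
      (fun t => V <= Num.sqrt (sqnorm (g t))).
  move=> V2 V0 kK gg.
  apply: (holds_up_to_le _ _ (holds_up_to_set (sqnorm_lower_tail tau01 gg))).
    exact: expR_tail_le.
  move=> t /= /negP; rewrite -ltNge => h.
  rewrite -(ger0_norm V0) -sqrtr_sqr ler_wsqrtr// V2 ltW//.
  by apply: le_lt_trans h; rewrite ler_wpM2l ?ler_nat// subr_ge0.
elim=> [|K IH] n m G nN mM gG.
  rewrite mul0r; apply: holds_up_toT => // t; exists (e0 n).
  rewrite big_ord1 big_ord0 mulr0 expr0 sqnorm_e0 sqnorm_ge0; split=> //.
  by rewrite mxE !eqxx.
case: n => [|n] in G nN gG *; first by rewrite addnS in nN.
case: m => [|m] in G mM gG *; first by rewrite addnS in mM.
have [g [c [G' [V [gg gc gG' VV GE]]]]] := golub_kahan_step (gG : gauss_family P (entries (G : T -> 'M[R]_(1 + n.+1, 1 + m)))).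
rewrite !addnS !ltnS in nN mM.
have nN' : (N <= n.+1)%N by apply: leq_trans (leqW nN); exact: leq_addr.
have mM' : (M <= m.+1)%N by apply: leq_trans (leqW mM); exact: leq_addr.
have h := holds_up_to_and (holds_up_to_and (lower _ _ _ _ S2 S0 mM' gg)
  (lower _ _ _ _ U2 U0 nN' gc)) (IH _ _ _ nN mM gG').
apply: (holds_up_to_le _ _ h) => [|t [[sS tU] [q [q0 qn qG]]]].
  by rewrite -/e -[in leRHS]natr1 mulrDl mul1r addrC.
exists (col_mx 1%:M (V t *m (r *: q))); split.
- transitivity ((1%:M : 'cV[R]_1) 0 0); last by rewrite mxE.
  rewrite -[RHS](col_mxEu _ (V t *m (r *: q))); congr (col_mx _ _ _ _).
  exact: val_inj.
- transitivity (sqnorm (1%:M : 'cV[R]_1) + sqnorm (V t *m (r *: q))).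
    exact: (sqnorm_col_mx (1%:M : 'cV[R]_1) (V t *m (r *: q))).
  rewrite sqnorm_scalar_mx expr1n sqnorm_mulmx// sqnormZ qn.
  rewrite [RHS]big_ord_recl/= expr0; congr (_ + _); rewrite mulr_sumr.
  by apply: eq_bigr => i _; rewrite -exprS.
rewrite GE mul1r -scalemxAr sqnormZ mxE q0 mulr1 big_ord_recl/= expr0 mulrDr mulr1.
rewrite lerD//.
  rewrite lerXn2r ?nnegrE ?addr_ge0 ?mulr_ge0 ?sqrtr_ge0//.
  by rewrite lerD// mulrC ler_wpM2r.
apply: le_trans (ler_wpM2l (sqr_ge0 r) qG).
rewrite [leRHS]mulrCA [r ^+ 2 * \sum_(_ < _) _]mulr_sumr le_eqVlt; apply/orP; left; apply/eqP.
by congr (_ * _); apply: eq_bigr => i _; rewrite -exprS.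
Qed.

End ExtremeSingularValues.

(** * Symmetric matrices and resolvents *)

Section SymmetricMatrices.
Context {R : realType}.

Lemma discriminant_le (a b c : R) : 0 <= a ->
  (forall t, 0 <= a * t ^+ 2 + 2 * b * t + c) -> b ^+ 2 <= a * c.
Proof.
rewrite le0r => /orP[/eqP -> h|a0 h].
  have [->|b0] := eqVneq b 0; first by rewrite expr0n mul0r.
  have := h (- (c + 1) / (2 * b)); rewrite mul0r add0r.
  rewrite (_ : _ + c = - 1); last by field.
  by rewrite lerNr oppr0 ler10.
have := h (- b / a).
rewrite (_ : _ + c = (a * c - b ^+ 2) / a); last by field; rewrite gt_eqF.
by rewrite pmulr_lge0 ?invr_gt0// subr_ge0.
Qed.

Lemma sqnorm_dot n (v : 'cV[R]_n) : sqnorm v = dot v v.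
Proof. by apply: eq_bigr => i _; rewrite expr2. Qed.

Lemma dotDl n (u v w : 'cV[R]_n) : dot (u + v) w = dot u w + dot v w.
Proof. by rewrite /dot -big_split/=; apply: eq_bigr => i _; rewrite mxE mulrDl. Qed.

Lemma dotDr n (u v w : 'cV[R]_n) : dot u (v + w) = dot u v + dot u w.
Proof. by rewrite dotC dotDl !(dotC u). Qed.

Lemma dotZl n a (u v : 'cV[R]_n) : dot (a *: u) v = a * dot u v.
Proof. by rewrite /dot mulr_sumr; apply: eq_bigr => i _; rewrite mxE mulrA. Qed.

Lemma dotZr n a (u v : 'cV[R]_n) : dot u (a *: v) = a * dot u v.
Proof. by rewrite dotC dotZl dotC. Qed.

Lemma dotBr n (u v w : 'cV[R]_n) : dot u (v - w) = dot u v - dot u w.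
Proof. by rewrite dotDr -scaleN1r dotZr mulN1r. Qed.

Lemma dot_mulmx m n (A : 'M[R]_(m, n)) u v : dot u (A *m v) = dot (A^T *m u) v.
Proof.
have : (dot u (A *m v))%:M = (dot (A^T *m u) v)%:M :> 'M[R]_1.
  by rewrite -!dotE trmx_mul trmxK mulmxA.
by move=> /matrixP/(_ 0 0); rewrite !mxE eqxx !mulr1n.
Qed.

Lemma psd_cauchy n (B : 'M[R]_n) (u v : 'cV[R]_n) :
  B^T = B -> (forall w, 0 <= dot w (B *m w)) ->
  dot u (B *m v) ^+ 2 <= dot v (B *m v) * dot u (B *m u).
Proof.
move=> BT B0; apply: discriminant_le => // t.
rewrite [leRHS](_ : _ = dot (t *: v + u) (B *m (t *: v + u))); first exact: B0.
rewrite mulmxDr -scalemxAr !dotDl !dotDr !dotZl !dotZr.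
by rewrite (dot_mulmx B v u) BT (dotC (B *m v) u); ring.
Qed.

Lemma dot_cauchy n (u v : 'cV[R]_n) : dot u v ^+ 2 <= sqnorm u * sqnorm v.
Proof.
have := @psd_cauchy n 1%:M u v (trmx1 _ _).
rewrite !mul1mx -!sqnorm_dot mulrC; apply=> w.
by rewrite mul1mx -sqnorm_dot sqnorm_ge0.
Qed.

(** The squared Hilbert-Schmidt norm, a crude bound for the squared operator norm; below only its
    finiteness matters. *)
Definition frob m n (A : 'M[R]_(m, n)) : R := \sum_i \sum_j A i j ^+ 2.

Lemma frob_ge0 m n (A : 'M[R]_(m, n)) : 0 <= frob A.
Proof. by do 2 apply: sumr_ge0 => ? _; exact: sqr_ge0. Qed.

Lemma sqnorm_mulmx_le m n (A : 'M[R]_(m, n)) v : sqnorm (A *m v) <= frob A * sqnorm v.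
Proof.
rewrite /frob mulr_suml; apply: ler_sum => i _.
have := dot_cauchy (row i A)^T v.
have -> : dot (row i A)^T v = (A *m v) i 0.
  by rewrite mxE; apply: eq_bigr => j _; rewrite !mxE.
by congr (_ <= _ * _); apply: eq_bigr => j _; rewrite !mxE.
Qed.

(** Cauchy-Schwarz for the form of [B], applied to [B *m v] and [v], then division by
    [sqnorm (B *m v)]. The factor [frob B + 1] dominates the square root of [frob B]. *)
Lemma psd_sqnorm_le n (B : 'M[R]_n) v :
  B^T = B -> (forall w, 0 <= dot w (B *m w)) ->
  sqnorm (B *m v) <= (frob B + 1) * dot v (B *m v).
Proof.
move=> BT B0; have [Bv0|Bv0] := eqVneq (sqnorm (B *m v)) 0.
  by rewrite Bv0 mulr_ge0// addr_ge0// frob_ge0.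
have sB : 0 < sqnorm (B *m v) by rewrite lt_def Bv0 sqnorm_ge0.
have f1 : 0 < frob B + 1 by rewrite ltr_wpDl ?frob_ge0.
have := psd_cauchy (B *m v) v BT B0; rewrite -sqnorm_dot => h.
have h1 : dot (B *m v) (B *m (B *m v)) <= (frob B + 1) * sqnorm (B *m v).
  have := dot_cauchy (B *m v) (B *m (B *m v)).
  move=> /le_trans/(_ (ler_wpM2l (ltW sB) (sqnorm_mulmx_le B (B *m v)))) h2.
  rewrite -(ler_pXn2r (n := 2))// ?nnegrE ?B0 ?mulr_ge0 ?(ltW f1) ?(ltW sB)//.
  apply: (le_trans h2); rewrite mulrCA -expr2 exprMn ler_wpM2r ?sqr_ge0//.
  by have := frob_ge0 B; nra.
have h3 := le_trans h (ler_wpM2l (B0 v) h1).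
by rewrite -(ler_pM2r sB) -expr2; apply: (le_trans h3); rewrite mulrA [X in X * _]mulrC.
Qed.

Lemma eigenvalue_unitmx n (A : 'M[R]_n) a : ~~ eigenvalue A a -> a%:M - A \in unitmx.
Proof.
rewrite /eigenvalue negbK /eigenspace kermx_eq0 row_free_unit.
by move=> h; rewrite -opprB -scaleN1r unitmxZ// unitrN unitr1.
Qed.

(* Otherwise the supremum [mu] of the Rayleigh quotient exceeds [l], so that
   [mu%:M - S] is positive semi-definite and invertible, hence coercive. *)
Lemma rayleigh_le n (S : 'M[R]_n) (l : R) : S^T = S ->
  (forall mu, eigenvalue S mu -> mu <= l) ->
  forall v, dot v (S *m v) <= l * sqnorm v.
Proof.
move=> ST hl v0; rewrite leNgt; apply/negP => lv0.
have v0N : v0 != 0.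
  by apply/eqP => v0E; move: lv0; rewrite v0E mulmx0 -sqnorm_dot
    (eqP (_ : sqnorm 0 == 0)) ?sqnorm_eq0// mulr0 ltxx.
have sv0 : 0 < sqnorm v0 by rewrite lt_def sqnorm_eq0 v0N sqnorm_ge0.
pose E := [set x : R | exists2 v, sqnorm v = 1 & x = dot v (S *m v)].
have normalise v : v != 0 -> E (dot v (S *m v) / sqnorm v).
  move=> vN; have sv : 0 < sqnorm v by rewrite lt_def sqnorm_eq0 vN sqnorm_ge0.
  have s2 : Num.sqrt (sqnorm v) ^+ 2 = sqnorm v by rewrite sqr_sqrtr ?ltW.
  have s0 : Num.sqrt (sqnorm v) != 0 by rewrite gt_eqF// sqrtr_gt0.
  exists ((Num.sqrt (sqnorm v))^-1 *: v).
    by rewrite sqnormZ exprVn s2 mulVf// gt_eqF.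
  by rewrite -scalemxAr dotZl dotZr mulrA -expr2 exprVn s2 mulrC.
have Eub : has_ubound E.
  exists (frob S + 1) => _ [v v1 ->].
  have := dot_cauchy v (S *m v); rewrite v1 mul1r.
  move=> /le_trans/(_ (sqnorm_mulmx_le S v)); rewrite v1 mulr1 => h.
  have := frob_ge0 S; nra.
have Esup : has_sup E by split => //; exists (dot v0 (S *m v0) / sqnorm v0); exact: normalise.
pose mu := sup E.
have muE v : dot v (S *m v) <= mu * sqnorm v.
  have [->|vN] := eqVneq v 0.
    by rewrite mulmx0 -sqnorm_dot (eqP (_ : sqnorm 0 == 0)) ?sqnorm_eq0// mulr0.
  rewrite -ler_pdivrMr; first by apply: ub_le_sup => //; exact: normalise.
  by rewrite lt_def sqnorm_eq0 vN sqnorm_ge0.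
have lmu : l < mu.
  by rewrite -(ltr_pM2r sv0); apply: (lt_le_trans lv0); exact: muE.
have Bu : mu%:M - S \in unitmx.
  by apply: eigenvalue_unitmx; apply/negP => /hl; rewrite leNgt lmu.
set B := mu%:M - S in Bu.
have BT : B^T = B by rewrite /B linearB/= tr_scalar_mx ST.
have BE v : dot v (B *m v) = mu * sqnorm v - dot v (S *m v).
  by rewrite mulmxBl mul_scalar_mx dotBr dotZr sqnorm_dot.
have B0 v : 0 <= dot v (B *m v) by rewrite BE subr_ge0.
pose C := (frob (invmx B) + 1) * (frob B + 1).
have C0 : 0 < C by rewrite mulr_gt0// ltr_wpDl ?frob_ge0.
(* Writing [v] as [invmx B *m (B *m v)] gives coercivity, so the Rayleigh quotient stays below
   [mu - C^-1], against the choice of [mu] as its supremum. *)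
have coer v : sqnorm v <= C * dot v (B *m v).
  rewrite -{1}(mulKmx Bu v); apply: (le_trans (sqnorm_mulmx_le _ _)).
  rewrite -mulrA; apply: ler_pM; rewrite ?frob_ge0 ?sqnorm_ge0 ?lerDl//.
  exact: psd_sqnorm_le.
have : mu <= mu - C^-1.
  apply: ge_sup; first by case: Esup.
  move=> _ [v v1 ->]; have := coer v; rewrite BE v1 mulr1 => h.
  rewrite lerBrDr -lerBrDl -(ler_pM2l C0) mulfV ?gt_eqF//.
by rewrite lerBrDr gerDl leNgt invr_gt0 C0.
Qed.

Definition shifted n m (G : 'M[R]_(n, m)) (L : R) : 'M[R]_n := L%:M - G *m G^T.

Section Resolvent.
Variables (n m : nat) (G : 'M[R]_(n, m)) (x0 : R).
Hypothesis Gx0 : forall q, sqnorm (G^T *m q) <= x0 * sqnorm q.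

Lemma tr_shifted L : (shifted G L)^T = shifted G L.
Proof. by rewrite /shifted linearB/= tr_scalar_mx trmx_mul trmxK. Qed.

(** The quadratic form of [shifted G L] is at least [(L - x0) * sqnorm q]; Cauchy-Schwarz converts
    this into a bound that gives both invertibility and the norm of the resolvent. *)
Lemma sqnorm_shifted_ge L q : x0 <= L ->
  (L - x0) ^+ 2 * sqnorm q <= sqnorm (shifted G L *m q).
Proof.
move=> xL; have [->|qN] := eqVneq q 0.
  by rewrite mulmx0 (eqP (_ : sqnorm 0 == 0)) ?sqnorm_eq0// mulr0.
have sq : 0 < sqnorm q by rewrite lt_def sqnorm_eq0 qN sqnorm_ge0.
have h : (L - x0) * sqnorm q <= dot q (shifted G L *m q).
  rewrite mulmxBl mul_scalar_mx dotBr dotZr -sqnorm_dot -mulmxA dot_mulmx.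
  by rewrite -sqnorm_dot mulrBl lerD2l lerN2.
have h2 := dot_cauchy q (shifted G L *m q).
rewrite -(ler_pM2l sq); apply: le_trans h2.
rewrite (_ : sqnorm q * _ = ((L - x0) * sqnorm q) ^+ 2); last by ring.
by rewrite lerXn2r ?nnegrE ?mulr_ge0 ?subr_ge0 ?sqnorm_ge0// (le_trans _ h)// mulr_ge0
  ?subr_ge0 ?sqnorm_ge0.
Qed.

Lemma unitmx_inj (B : 'M[R]_n) : (forall q : 'cV_n, B *m q = 0 -> q = 0) -> B \in unitmx.
Proof.
move=> Binj; rewrite -unitmx_tr -row_free_unit -kermx_eq0.
apply/eqP/row_matrixP => i; rewrite row0; apply: trmx_inj; rewrite trmx0.
apply: Binj; apply: trmx_inj; rewrite trmx_mul trmxK -row_mul mulmx_ker row0.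
by rewrite trmx0.
Qed.

Lemma shifted_unit L : x0 < L -> shifted G L \in unitmx.
Proof.
move=> xL; apply: unitmx_inj => q Bq.
have := sqnorm_shifted_ge q (ltW xL); rewrite Bq (eqP (_ : sqnorm 0 == 0)) ?sqnorm_eq0//.
rewrite pmulr_rle0 ?exprn_gt0 ?subr_gt0// => q0.
by apply/eqP; rewrite -sqnorm_eq0 eq_le q0 sqnorm_ge0.
Qed.

Lemma resolventE (A : 'M[R]_n) : A \in unitmx -> resolvent A = invmx A.
Proof. by move=> uA; rewrite /resolvent /invmx uA. Qed.

Lemma tr_resolvent L : x0 < L -> (resolvent (shifted G L))^T = resolvent (shifted G L).
Proof.
by move=> xL; rewrite resolventE ?shifted_unit// trmx_inv tr_shifted.
Qed.

Lemma sqnorm_resolvent_le L q : x0 < L ->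
  sqnorm (resolvent (shifted G L) *m q) <= sqnorm q / (L - x0) ^+ 2.
Proof.
move=> xL; rewrite resolventE ?shifted_unit// ler_pdivlMr ?exprn_gt0 ?subr_gt0//.
rewrite mulrC; apply: (le_trans (sqnorm_shifted_ge _ (ltW xL))).
by rewrite mulKVmx// shifted_unit.
Qed.

Lemma resolvent_identity L L' : x0 < L -> x0 < L' ->
  resolvent (shifted G L) - resolvent (shifted G L') =
  (L' - L) *: (resolvent (shifted G L) *m resolvent (shifted G L')).
Proof.
move=> xL xL'; rewrite !resolventE ?shifted_unit//.
have uL := shifted_unit xL; have uL' := shifted_unit xL'.
rewrite scalemxAl -mul_mx_scalar (_ : (L' - L)%:M = shifted G L' - shifted G L).
  by rewrite mulmxBr mulVmx// mulmxBl mul1mx -mulmxA mulmxV// mulmx1.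
by rewrite /shifted opprB addrA subrK raddfB.
Qed.

End Resolvent.

End SymmetricMatrices.

(** * Eigenvectors of the spiked model *)

Section SpikeAlgebra.
Context {R : realType}.

Lemma sqnorm0 n : sqnorm (0 : 'cV[R]_n) = 0.
Proof. by apply/eqP; rewrite sqnorm_eq0. Qed.

Lemma dot0l n (v : 'cV[R]_n) : dot 0 v = 0.
Proof. by rewrite /dot big1// => i _; rewrite mxE mul0r. Qed.

Lemma dot_delta n (v : 'cV[R]_n) j : dot (delta_mx j 0) v = v j 0.
Proof.
rewrite /dot (bigD1 j)//= big1 ?addr0; first by rewrite mxE !eqxx mul1r.
by move=> k /negbTE kj; rewrite mxE kj mul0r.
Qed.

Lemma tr_sqnorm_bound m n (A : 'M[R]_(m, n)) (x : R) : 0 <= x ->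
  (forall q, sqnorm (A^T *m q) <= x * sqnorm q) ->
  forall v, sqnorm (A *m v) <= x * sqnorm v.
Proof.
move=> x0 Ax v; have [->|Av] := eqVneq (sqnorm (A *m v)) 0.
  by rewrite mulr_ge0 ?sqnorm_ge0.
have sA : 0 < sqnorm (A *m v) by rewrite lt_def Av sqnorm_ge0.
have := dot_cauchy v (A^T *m (A *m v)).
rewrite dot_mulmx trmxK -sqnorm_dot => h.
have := le_trans h (ler_wpM2l (sqnorm_ge0 v) (Ax (A *m v))).
by rewrite expr2 mulrA [sqnorm v * x]mulrC ler_pM2r.
Qed.

Lemma abs_dot_le n (u v : 'cV[R]_n) : `|dot u v| <= Num.sqrt (sqnorm u * sqnorm v).
Proof. by rewrite -sqrtr_sqr ler_wsqrtr// dot_cauchy. Qed.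

Section Model.
Variables (n m : nat) (Xi : 'M[R]_(n, m.+1)) (u : 'cV[R]_n) (z : 'cV[R]_m.+1) (sb : R).
Hypothesis z1 : sqnorm z = 1.

Definition spike_reflection : 'M[R]_m.+1 := householder (z - e0 m).
Definition signal_part : 'cV[R]_n := sb *: u + Xi *m z.
(** The noise along an orthonormal basis of the hyperplane orthogonal to [z]; the discarded first
    column is [Xi *m z]. *)
Definition noise_part : 'M[R]_(n, m) :=
  rsubmx (Xi *m spike_reflection : 'M[R]_(n, 1 + m)).
Definition data_matrix : 'M[R]_(n, m.+1) := sb *: (u *m z^T) + Xi.
Definition orthogonal_noise : 'M[R]_(n, m.+1) := Xi - Xi *m z *m z^T.

Local Notation H := spike_reflection.
Local Notation a := signal_part.
Local Notation G := noise_part.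
Local Notation X := data_matrix.
Local Notation Y := orthogonal_noise.

Lemma spike_reflection_z : H *m z = e0 m.
Proof. by apply: householder_reflect; rewrite sqnorm_e0. Qed.

Lemma spike_reflection_e0 : H *m e0 m = z.
Proof. by rewrite -spike_reflection_z mulmxA householderK mul1mx. Qed.

Lemma data_matrixE : X = a *m z^T + Y.
Proof. by rewrite /X /a /Y mulmxDl -scalemxAl addrCA addrK addrC. Qed.

Lemma orthogonal_noise_z : Y *m z = 0.
Proof. by rewrite mulmxBl -!mulmxA sqnormE z1 mulmx1 subrr. Qed.

Lemma orthogonal_noiseE : Y *m H = row_mx (0 : 'cV[R]_n) G.
Proof.
have zH : z^T *m H = (e0 m)^T.
  by rewrite -[H]tr_householder -trmx_mul spike_reflection_z.
rewrite /Y mulmxBl -(mulmxA (Xi *m z)) zH.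
have -> : Xi *m z = Xi *m H *m e0 m by rewrite -mulmxA spike_reflection_e0.
rewrite /noise_part; move: (Xi *m H) => Z.
apply/matrixP => i j.
have -> : (Z - Z *m e0 m *m (e0 m)^T) i j = Z i j - Z i ord0 * (j == ord0)%:R.
  by rewrite 2!mxE -colE; congr (_ - _); rewrite mxE big_ord1 !mxE eqxx andbT.
case: (@split_ordP 1 m j) => k ->.
- rewrite [RHS](row_mxEl (0 : 'cV[R]_n) (rsubmx (Z : 'M[R]_(n, 1 + m)))) [RHS]mxE.
  by rewrite (_ : lshift m k = ord0) ?eqxx ?mulr1 ?subrr// ord1; exact: val_inj.
- rewrite [RHS](row_mxEr (0 : 'cV[R]_n) (rsubmx (Z : 'M[R]_(n, 1 + m)))) [RHS]mxE.
  by rewrite (_ : (_ == ord0) = false)// mulr0 subr0.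
Qed.

Lemma orthogonal_noise_gram : Y *m Y^T = G *m G^T.
Proof.
have -> : Y *m Y^T = (Y *m H) *m (Y *m H)^T.
  by rewrite trmx_mul -mulmxA (mulmxA H) tr_householder householderK mul1mx.
rewrite orthogonal_noiseE.
transitivity (row_mx (0 : 'cV[R]_n) G *m col_mx (0 : 'cV[R]_n)^T G^T).
  by congr (_ *m _); exact: (tr_row_mx (0 : 'cV[R]_n) G).
by rewrite mul_row_col mul0mx add0r.
Qed.

Lemma sqnorm_orthogonal_noise q : sqnorm (Y^T *m q) = sqnorm (G^T *m q).
Proof.
rewrite !sqnorm_dot -[Y in dot (Y^T *m q)]trmxK -!dot_mulmx !mulmxA.
by rewrite -[G in dot q (G *m _ *m q)]trmxK !trmxK orthogonal_noise_gram.
Qed.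

Lemma orthogonal_noise_col j : Y *m delta_mx j 0 =
  G *m dsubmx (H *m delta_mx j 0 : 'cV[R]_(1 + m)).
Proof.
have -> : Y = Y *m H *m H by rewrite -mulmxA householderK mulmx1.
rewrite -mulmxA orthogonal_noiseE.
transitivity (row_mx (0 : 'cV[R]_n) G *m
  col_mx (usubmx (H *m delta_mx j 0 : 'cV[R]_(1 + m)))
         (dsubmx (H *m delta_mx j 0 : 'cV[R]_(1 + m)))).
  by rewrite vsubmxK.
by rewrite mul_row_col mul0mx add0r.
Qed.

(** The cross term vanishes as [Y *m z = 0]: on the sample side the matrix is [G *m G^T] plus the
    rank-one term [a *m a^T]. *)
Lemma sqnorm_data q : sqnorm (X^T *m q) = dot a q ^+ 2 + sqnorm (G^T *m q).
Proof.
rewrite data_matrixE linearD/= trmx_mul trmxK mulmxDl -mulmxA dotE mul_mx_scalar.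
rewrite sqnormD sqnormZ z1 mulr1 sqnorm_orthogonal_noise dotZl dot_mulmx trmxK.
by rewrite orthogonal_noise_z dot0l !mulr0 addr0.
Qed.

Section Eigenvector.
Variables (x0 x1 L : R) (w : 'cV[R]_m.+1).
Hypotheses (x00 : 0 <= x0) (x01 : x0 < x1).
Hypothesis Gx0 : forall q, sqnorm (G^T *m q) <= x0 * sqnorm q.
Hypotheses (w1 : sqnorm w = 1) (Xw : X^T *m (X *m w) = L *: w).
Hypothesis Xv : forall v, sqnorm (X *m v) <= L * sqnorm v.

(** [X] and its transpose have the same norm, so test vectors may be taken on the sample side, where
    the form splits. *)
Lemma eigenvalue_ge q : q != 0 ->
  x1 * sqnorm q <= dot a q ^+ 2 + sqnorm (G^T *m q) -> x1 <= L.
Proof.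
move=> qN; have sq : 0 < sqnorm q by rewrite lt_def sqnorm_eq0 qN sqnorm_ge0.
rewrite -sqnorm_data => h; rewrite -(ler_pM2r sq); apply: (le_trans h).
apply: tr_sqnorm_bound; last by move=> v; rewrite trmxK.
by have := le_trans (sqnorm_ge0 _) (Xv w); rewrite w1 mulr1.
Qed.

Lemma sqnorm_orthogonal_noise_le v : sqnorm (Y *m v) <= x0 * sqnorm v.
Proof.
by apply: tr_sqnorm_bound => // q; rewrite sqnorm_orthogonal_noise.
Qed.

Lemma data_mulmx v : X *m v = dot z v *: a + Y *m v.
Proof. by rewrite data_matrixE mulmxDl -mulmxA dotE mul_mx_scalar. Qed.

(** A crude bound, whose purpose is to limit the length of the grid for [L]. *)
Lemma eigenvalue_le : L <= 2 * sqnorm a + 2 * x0.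
Proof.
have -> : L = sqnorm (X *m w).
  by rewrite sqnorm_dot -{1}[X]trmxK -dot_mulmx Xw dotZr -sqnorm_dot w1 mulr1.
rewrite data_mulmx.
have za : sqnorm (dot z w *: a) <= sqnorm a.
  rewrite sqnormZ ler_piMl ?sqnorm_ge0//.
  by have := dot_cauchy z w; rewrite z1 w1 mulr1.
have Yw := sqnorm_orthogonal_noise_le w; rewrite w1 mulr1 in Yw.
have := sqnorm_ge0 (dot z w *: a - Y *m w).
rewrite sqnormB sqnormD; lra.
Qed.

(** With [q = X *m w] one has [dot a q = L * dot z w] and [shifted G L *m q = (L * dot z w) *: a];
    solving for [q] gives [w]. The resolvent is moved by symmetry onto [Y *m delta_mx j 0], so that
    for fixed [L] the perturbation is a linear form in [a] whose coefficients depend on the noise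
    [G] alone. *)
Lemma top_eigenvector_entries : x0 < L ->
  dot z w != 0 /\
  forall j, w j 0 = dot z w *
    (z j 0 + dot (resolvent (shifted G L) *m (Y *m delta_mx j 0)) a).
Proof.
move=> xL; have L0 : L != 0 by rewrite gt_eqF// (le_lt_trans x00).
set al := dot z w; pose q := X *m w.
have XTE v : X^T *m v = dot a v *: z + Y^T *m v.
  by rewrite data_matrixE linearD/= trmx_mul trmxK mulmxDl -mulmxA dotE mul_mx_scalar.
have zY v : dot z (Y^T *m v) = 0.
  by rewrite dot_mulmx trmxK orthogonal_noise_z dot0l.
have wE : L *: w = dot a q *: z + Y^T *m q by rewrite -Xw XTE.
have aq : dot a q = L * al.
  have := congr1 (dot z) wE; rewrite dotZr dotDr dotZr -sqnorm_dot z1 mulr1 zY addr0.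
  by move=> <-.
have qE : q = al *: a + Y *m w by rewrite /q data_mulmx.
have LY : L *: (Y *m w) = G *m G^T *m q.
  rewrite scalemxAr wE mulmxDr -scalemxAr orthogonal_noise_z scaler0 add0r.
  by rewrite mulmxA orthogonal_noise_gram.
have Bq : shifted G L *m q = (L * al) *: a.
  rewrite mulmxBl mul_scalar_mx -LY {1}qE scalerDr addrK scalerA.
  by [].
have uL := shifted_unit Gx0 xL.
have qR : q = (L * al) *: (resolvent (shifted G L) *m a).
  by rewrite resolventE// scalemxAr -Bq mulKmx.
have wE2 : w = al *: z + al *: (Y^T *m (resolvent (shifted G L) *m a)).
  apply: (scalerI L0); rewrite wE aq {1}qR -scalemxAr scalerDr !scalerA.
  by [].
split.
  apply/eqP => al0; have := w1; rewrite wE2 al0 !scale0r addr0 sqnorm0.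
  by move=> /esym/eqP; rewrite oner_eq0.
move=> j; have -> : dot (resolvent (shifted G L) *m (Y *m delta_mx j 0)) a =
    (Y^T *m (resolvent (shifted G L) *m a)) j 0.
  rewrite -dot_delta dot_mulmx trmxK [RHS]dot_mulmx.
  by rewrite (tr_resolvent Gx0 xL).
by rewrite {1}wE2 mxE [X in X + _]mxE [X in _ + X]mxE -mulrDr.
Qed.

End Eigenvector.

(* The perturbation is controlled at the points [x1 + i]; two points at distance
   at most one differ by the resolvent identity. *)
Lemma resolvent_grid (x0 x1 L A e : R) (N : nat) j :
  0 <= x0 -> x0 < x1 -> x1 <= L -> L < x1 + N%:R ->
  (forall q, sqnorm (G^T *m q) <= x0 * sqnorm q) -> sqnorm a <= A ->
  (forall i : 'I_N,
    `|dot (resolvent (shifted G (x1 + i%:R)) *m (Y *m delta_mx j 0)) a| <= e) ->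
  `|dot (resolvent (shifted G L) *m (Y *m delta_mx j 0)) a| <=
    e + Num.sqrt (x0 * A) / (x1 - x0) ^+ 2.
Proof.
move=> x00 x01 xL LN Gx0 aA he; set y := Y *m _.
have y1 : sqnorm y <= x0.
  apply: (le_trans (sqnorm_orthogonal_noise_le x00 Gx0 _)).
  rewrite (_ : sqnorm _ = 1) ?mulr1// /sqnorm (bigD1 j)//= big1 ?addr0.
    by rewrite mxE !eqxx expr1n.
  by move=> k /negbTE kj; rewrite mxE kj expr0n.
have Lx1 : 0 <= L - x1 by rewrite subr_ge0.
have /andP[tl tu] := truncn_itv Lx1; set i := Num.truncn (L - x1) in tl tu.
have iN : (i < N)%N by rewrite -(ltr_nat R); apply: (le_lt_trans tl); lra.
set Li := x1 + i%:R.
have x0L : x0 < L by exact: lt_le_trans xL.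
have x0Li : x0 < Li by apply: (lt_le_trans x01); rewrite lerDl.
have -> : resolvent (shifted G L) = resolvent (shifted G Li) +
    (Li - L) *: (resolvent (shifted G L) *m resolvent (shifted G Li)).
  by rewrite -(resolvent_identity Gx0)// addrC subrK.
rewrite mulmxDl dotDl (le_trans (ler_normD _ _))// lerD//.
  exact: (he (Ordinal iN)).
(* By symmetry one resolvent goes to each side of the scalar product, and each costs a factor
   [(x1 - x0)^-1]. *)
rewrite -scalemxAl dotZl normrM -mulmxA -{1}(tr_resolvent Gx0 x0L) -dot_mulmx.
have dist : `|Li - L| <= 1.
  rewrite /Li distrC ger0_norm; last by lra.
  by move: tu; rewrite -natr1; lra.
rewrite -[leRHS]mul1r; apply: ler_pM => //.
apply: (le_trans (abs_dot_le _ _)).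
have d0 : 0 < x1 - x0 by rewrite subr_gt0.
have dd l : x1 <= l -> x0 < l -> forall v,
    sqnorm (resolvent (shifted G l) *m v) <= sqnorm v / (x1 - x0) ^+ 2.
  move=> xl x0l v; apply: (le_trans (sqnorm_resolvent_le Gx0 _ x0l)).
  rewrite ler_wpM2l ?sqnorm_ge0// lef_pV2 ?posrE ?exprn_gt0 ?subr_gt0//.
  by rewrite lerXn2r ?nnegrE ?subr_ge0 ?(ltW x01) ?(ltW x0l)// lerD2r.
rewrite -[X in _ / X]ger0_norm ?sqr_ge0// -sqrtr_sqr -sqrtrV ?sqr_ge0// -sqrtrM; last first.
  by rewrite mulr_ge0// (le_trans (sqnorm_ge0 _) aA).
apply: ler_wsqrtr.
have x1Li : x1 <= Li by rewrite lerDl.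
apply: (le_trans (ler_pM (sqnorm_ge0 _) (sqnorm_ge0 _) (dd _ x1Li x0Li y) (dd _ xL x0L a))).
rewrite mulrACA -invfM -expr2 ler_wpM2r ?invr_ge0 ?sqr_ge0//.
by apply: ler_pM; rewrite ?sqnorm_ge0.
Qed.

End Model.
End SpikeAlgebra.

(** * Recovery at a fixed size *)

Section FixedSize.
Context {R : realType}.

(** The level [|al| / (2 * sqrt k)] strictly separates the entries on the support from the others.
    No tie can occur across it, so every admissible [S] contains the support and, by cardinality,
    equals it. *)
Lemma supp_eq_largest p k (z w : 'cV[R]_p) (S : {set 'I_p}) (al : R) :
  sparse_spike k z -> al != 0 ->
  (forall j, exists2 e, w j 0 = al * (z j 0 + e) & `|e| < (2 * Num.sqrt k%:R)^-1) ->
  largest_entries k w S -> S = supp z.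
Proof.
move=> [_ zk zE] al0 we [Sk wS].
have al1 : 0 < `|al| by rewrite normr_gt0.
have k_gt0 i : i \in supp z -> 0 < (Num.sqrt k%:R : R)^-1.
  move=> iz; rewrite invr_gt0 sqrtr_gt0 ltr0n -zk card_gt0.
  by apply/set0Pn; exists i.
have inz i : i \in supp z -> `|al| / (2 * Num.sqrt k%:R) < `|w i 0|.
  move=> iz; have [e -> he] := we i; have kp := k_gt0 _ iz.
  rewrite normrM ltr_pM2l//; have hh : (2 * Num.sqrt k%:R)^-1 = (Num.sqrt k%:R : R)^-1 / 2.
    by rewrite invfM mulrC.
  rewrite hh in he *; have zi : `|z i 0| = (Num.sqrt k%:R)^-1.
    by case: (zE i iz) => ->; rewrite ?normrN gtr0_norm.
  have := lerB_dist (z i 0) (- e); rewrite opprK normrN zi; lra.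
have outz i : i \notin supp z -> `|w i 0| < `|al| / (2 * Num.sqrt k%:R).
  rewrite inE negbK => /eqP zi; have [e -> he] := we i.
  by rewrite zi add0r normrM ltr_pM2l.
have sub : supp z \subset S.
  apply/fintype.subsetP => i iz; apply/negPn/negP => iS.
  have [j jS jz] : exists2 j, j \in S & j \notin supp z.
    apply/fintype.subsetPn; apply/negP => Ssub; move/negP: iS; apply.
    by have /setP/(_ i) : S = supp z; [apply/eqP; rewrite eqEcard Ssub Sk zk leqnn|rewrite iz].
  have := wS j i jS iS; rewrite leNgt => /negP; apply.
  exact: lt_trans (outz _ jz) (inz _ iz).
by apply/esym/eqP; rewrite eqEcard sub Sk zk leqnn.
Qed.

Context {d} {T : measurableType d} (P : probability T R).

Lemma gauss_family_inputs n p (u : 'I_n -> {RV P >-> R})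
    (xi : 'I_n -> 'I_p -> {RV P >-> R}) :
  iid_gaussian_inputs u xi ->
  gauss_family P (join_family (fun i => u i : T -> R)
    (entries (fun t => \matrix_(i, j) xi i j t))).
Proof.
move=> [ind std].
have -> : join_family (fun i => u i : T -> R)
    (entries (fun t => \matrix_(i, j) xi i j t)) =
    fun a => noise_family u xi a : T -> R.
  by apply/funext => -[i|[i j]]; apply/funext => t //=; rewrite /entries mxE.
split=> [a|B mB]; first by [].
have := ind [set: _]%SET B mB.
rewrite (_ : \bigcap_(i in _) _ = cylinder (fun a => noise_family u xi a : T -> R) B); last first.
  apply/seteqP; split => t h i; last by move=> _; exact: (h i).
  by apply: (h i); rewrite /= finset.in_setT.
move=> ->; rewrite (eq_bigl xpredT); last by move=> i; rewrite finset.in_setT.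
by apply: eq_bigr => a _; have := std a _ (mB a).
Qed.

Lemma two_sided_tail (I : finType) (X : I -> T -> R) n (g s : T -> 'cV[R]_n)
    (v k : R) :
  gauss_family P (join_family X (entries g)) ->
  measurable_mx (T := sigmaT X) s -> 0 < v -> 0 <= k ->
  holds_up_to P (2 * expR (- (k ^+ 2 / (2 * v))))
    (fun t => sqnorm (s t) <= v -> `|dot (s t) (g t)| < k).
Proof.
move=> gXg ms v0 k0.
have ms' : measurable_mx (T := sigmaT X) (fun t => - s t).
  move=> i j; rewrite (_ : (fun t => _) = fun t => - s t i j); last first.
    by apply/funext => t; rewrite mxE.
  by apply: measurable_funN; exact: ms.
have h := holds_up_to_and (holds_up_to_set (linear_form_tail gXg ms v0 k0))
  (holds_up_to_set (linear_form_tail gXg ms' v0 k0)).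
apply: (holds_up_to_le _ _ h) => {h}; first by rewrite [leRHS]mulr_natl [leRHS]mulr2n.
move=> t [/= h1 h2] sv; rewrite ltr_norml; apply/andP; split; rewrite ltNge; apply/negP => h.
  apply: h2; split.
    by rewrite -scaleN1r sqnormZ sqrrN expr1n mul1r.
  by rewrite -scaleN1r dotZl mulN1r lerNr.
by apply: h1; split.
Qed.

End FixedSize.

(** * Independence of signal and noise *)

Section RecoveryBound.
Context {R : realType} {d} {T : measurableType d} (P : probability T R).

Lemma gauss_family_tr m n (G : T -> 'M[R]_(m, n)) :
  gauss_family P (entries G) -> gauss_family P (entries (fun t => (G t)^T)).
Proof.
move=> gG; have := gauss_family_inj (h := fun ij : 'I_n * 'I_m => (ij.2, ij.1)) _ gG.
rewrite (_ : _ \o _ = entries (fun t => (G t)^T)).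
  by apply => -[i i'] [j j'] [] -> ->.
by apply/funext => ij; apply/funext => t; rewrite /entries/= mxE.
Qed.

Section Matrices.
Variables (n m : nat) (u : 'I_n -> T -> R) (Xi : T -> 'M[R]_(n, m.+1)).
Variables (z : 'cV[R]_m.+1).
Hypothesis z1 : sqnorm z = 1.
Hypothesis gW : gauss_family P (join_family u (entries Xi)).

Definition uvec t : 'cV[R]_n := \col_i u i t.
Definition bvec t : 'cV[R]_n := Xi t *m z.
Definition gmx t : 'M[R]_(n, m) := noise_part (Xi t) z.

(** The first column of [W] is [bvec] and the others form [gmx]: the independence statements below
    select disjoint blocks of one Gaussian family. *)
Let W t := Xi t *m spike_reflection z.

Let gWH : gauss_family P (join_family u (entries W)).
Proof. exact: preserves_gauss_householder. Qed.

Let bE t i j : bvec t i j = W t i ord0.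
Proof.
rewrite ord1 /bvec -(spike_reflection_e0 z1) mulmxA -colE mxE.
by [].
Qed.

Let gmxE t i j : gmx t i j = W t i (rshift 1 j).
Proof. by rewrite /gmx /noise_part mxE. Qed.

Let hu (ij : 'I_n * 'I_1) : 'I_n + 'I_n * 'I_m.+1 := inl ij.1.
Let hb (ij : 'I_n * 'I_1) : 'I_n + 'I_n * 'I_m.+1 := inr (ij.1, ord0).
Let hg (ij : 'I_n * 'I_m) : 'I_n + 'I_n * 'I_m.+1 := inr (ij.1, rshift 1 ij.2).

Let hu_inj : injective hu.
Proof. by move=> [i i'] [j j'] [->]; rewrite [i']ord1 [j']ord1. Qed.

Let hb_inj : injective hb.
Proof. by move=> [i i'] [j j'] [->]; rewrite [i']ord1 [j']ord1. Qed.

Let hg_inj : injective hg.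
Proof.
move=> [i i'] [j j'] e; have := inr_inj e.
by move=> /pair_equal_spec[/= -> h]; rewrite (@rshift_inj 1 m _ _ h).
Qed.

Let hub i j : hu i != hb j. Proof. by []. Qed.
Let hug i j : hu i != hg j. Proof. by []. Qed.
Let hbg i j : hb i != hg j.
Proof. by apply/eqP => e; have /pair_equal_spec[] := inr_inj e. Qed.

Let huE : join_family u (entries W) \o hu = entries uvec.
Proof. by apply/funext => ij; apply/funext => t; rewrite /entries/= mxE. Qed.

Let hbE : join_family u (entries W) \o hb = entries bvec.
Proof. by apply/funext => ij; apply/funext => t; rewrite /entries/= bE. Qed.

Let hgE : join_family u (entries W) \o hg = entries gmx.
Proof. by apply/funext => ij; apply/funext => t; rewrite /entries/= gmxE. Qed.

Lemma gauss_uvec_bvec : gauss_family P (join_family (entries uvec) (entries bvec)).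
Proof. by rewrite -huE -hbE; exact: join_family_inj. Qed.

Lemma gauss_gmx_uvec : gauss_family P (join_family (entries gmx) (entries uvec)).
Proof.
by rewrite -huE -hgE; apply: join_family_inj => // i j; rewrite eq_sym.
Qed.

Lemma gauss_gmx_bvec : gauss_family P (join_family (entries gmx) (entries bvec)).
Proof.
by rewrite -hbE -hgE; apply: join_family_inj => // i j; rewrite eq_sym hbg.
Qed.

(** Transposed, because the reflection attached to the signal acts on [gmx] from the left while
    [random_rotation] multiplies on the right. *)
Lemma gauss_signal_gmx :
  gauss_family P (join_family (join_family (entries uvec) (entries bvec))
    (entries (fun t => (gmx t)^T))).
Proof.
pose h1 (i : 'I_n * 'I_1 + 'I_n * 'I_1) := match i with inl i => hu i | inr i => hb i end.
pose h2 (ji : 'I_m * 'I_n) := hg (ji.2, ji.1).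
rewrite (_ : join_family (entries uvec) _ = join_family u (entries W) \o h1); last first.
  by rewrite -huE -hbE; apply/funext => -[].
rewrite (_ : entries (fun t => _) = join_family u (entries W) \o h2); last first.
  by apply/funext => -[j i]; apply/funext => t; rewrite /entries/= mxE gmxE.
apply: join_family_inj => //.
- move=> [i|i] [j|j] //=; first by move=> /hu_inj ->.
  by move=> /hb_inj ->.
- by move=> [i i'] [j j'] /hg_inj/pair_equal_spec[/= -> /= ->].
- by move=> [i|i] j; [exact: hug|exact: hbg].
Qed.

Variable sb : R.

Definition avec t : 'cV[R]_n := signal_part (Xi t) (uvec t) z sb.

Lemma avecE t : avec t = sb *: uvec t + bvec t.
Proof. by []. Qed.

Lemma measurable_avec :
  measurable_mx (T := sigmaT (join_family (entries uvec) (entries bvec))) avec.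
Proof.
set J := join_family _ _.
have mu : measurable_mx (T := sigmaT J) uvec.
  by move=> i j; exact: (@measurable_sigmaT _ _ _ _ J (inl (i, j))).
have mb : measurable_mx (T := sigmaT J) bvec.
  by move=> i j; exact: (@measurable_sigmaT _ _ _ _ J (inr (i, j))).
by apply: measurable_mxD => //; apply: measurable_mxZ => //; exact: measurable_cst.
Qed.

End Matrices.
End RecoveryBound.

Section RecoveryTheorem.
Context {R : realType} {d} {T : measurableType d} (P : probability T R).

(** Of the three numerical conditions, the first makes the test vector push [L] above [x1], the
    second makes [N] unit steps from [x1] reach beyond [L], and the third keeps linear form and
    interpolation error below [eps]. In the failure probability [2 * n] and [2 * K] come from the
    two bidiagonalisations and [6] from the norms of the signal; [h] is a common lower bound for all
    sizes. *)
Lemma spike_recovery_bound n' m (u : 'I_n'.+1 -> T -> R) (Xi : T -> 'M[R]_(n'.+1, m.+1))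
    (z : 'cV[R]_m.+1) (tau sb r eta kappa eps : R) (K M' N' h N : nat) :
  let n := n'.+1 in
  let x0 := (Num.sqrt ((1 + tau) * m%:R) + Num.sqrt ((1 + tau) * n%:R)) ^+ 2 in
  let x1 := x0 + eta * n%:R in
  let A := 4 * (1 + sb ^+ 2) * n%:R in
  let v := x0 / (eta * n%:R) ^+ 2 in
  sqnorm z = 1 -> gauss_family P (join_family u (entries Xi)) ->
  0 < tau <= 1 -> 0 <= sb -> 0 <= r -> 0 < eta -> 0 < kappa ->
  (N' + K <= n')%N -> (M' + K <= m)%N -> (h <= M')%N -> (h <= N')%N ->
  x1 * (\sum_(i < K.+1) (r ^+ 2) ^+ i) <=
    (1 + sb ^+ 2) * ((1 - tau) * n%:R) - 2 * sb * (tau * n%:R) +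
    (Num.sqrt ((1 - tau) * M'%:R) + r * Num.sqrt ((1 - tau) * N'%:R)) ^+ 2 *
      (\sum_(i < K) (r ^+ 2) ^+ i) ->
  2 * A + 2 * x0 < x1 + N%:R ->
  (sb + 1) * kappa + Num.sqrt (x0 * A) / (eta * n%:R) ^+ 2 < eps ->
  holds_up_to P
    ((2 * n + 2 * K + 6)%:R * expR (- (tau ^+ 2 / 16 * h%:R)) +
     (N * m.+1)%:R * (4 * expR (- (kappa ^+ 2 / (2 * v)))))
    (fun t => forall (w : 'cV[R]_m.+1) L,
      let X := data_matrix (Xi t) (uvec u t) z sb in
      X^T *m (X *m w) = L *: w -> sqnorm w = 1 ->
      (forall x, sqnorm (X *m x) <= L * sqnorm x) ->
      exists2 al : R, al != 0 &
        forall j, exists2 e, w j 0 = al * (z j 0 + e) & `|e| < eps).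
Proof.
move=> n x0 x1 A v z1 gW tau01 sb0 r0 eta0 kap0 nN mM hM hN Hlow Hgrid Heps.
have [tau0 tau1] := andP tau01.
have n0 : 0 < n%:R :> R by rewrite ltr0n.
have etan0 : 0 < eta * n%:R by rewrite mulr_gt0.
have x0_gt0 : 0 < x0.
  by rewrite exprn_gt0// ltr_wpDl ?sqrtr_ge0// sqrtr_gt0 mulr_gt0// addr_gt0.
have v0 : 0 < v by rewrite divr_gt0// exprn_gt0.
have x01 : x0 < x1 by rewrite ltrDl.
set eh := expR (- (tau ^+ 2 / 16 * h%:R)).
have eh_le q : (h <= q)%N -> expR (- (tau ^+ 2 / 16 * q%:R)) <= eh.
  exact: expR_tail_le.
have hn' : (h <= n')%N by apply: leq_trans hN (leq_trans (leq_addr _ _) nN).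
have hn : (h <= n)%N by exact: leqW.
have hm : (h <= m)%N by apply: leq_trans hM (leq_trans (leq_addr _ _) mM).
pose a := avec u Xi z sb; pose G := gmx Xi z.
pose U := uvec u : T -> 'cV[R]_n; pose b := bvec Xi z.
have gGU : gauss_family P (join_family (entries G) (entries U)) by exact: gauss_gmx_uvec.
have gGb : gauss_family P (join_family (entries G) (entries b)) by exact: (gauss_gmx_bvec z1 gW).
have gUb : gauss_family P (join_family (entries U) (entries b)) by exact: (gauss_uvec_bvec z1 gW).
have gG := gauss_family_inl gGU.
have gU := gauss_family_inl gUb; have gb := gauss_family_inr gUb.
have E1 := sqnorm_upper_bound tau01 (leqnSn n') (leqnn m) gG.
(* [a] is independent of [G], so reflecting [a] onto the first axis leaves [G] Gaussian. *)
have gGh : gauss_family P (entries (fun t => ((G t)^T *m to_e0 (a t))^T)).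
  apply: gauss_family_tr; apply: (random_rotation (gauss_signal_gmx z1 gW)) => [|t].
    by apply: measurable_to_e0; exact: measurable_avec.
  exact: preserves_gauss_householder.
have E2 := sqnorm_lower_bound tau01 r0 nN mM gGh.
have E3 := holds_up_to_set (sqnorm_upper_tail tau01 (leqnn n) gU).
have E3' := holds_up_to_set (sqnorm_upper_tail tau01 (leqnn n) gb).
have E4 := holds_up_to_set (sqnorm_lower_tail tau01 gU).
have E4' := holds_up_to_set (sqnorm_lower_tail tau01 gb).
have mU : measurable_mx (T := sigmaT (entries U)) U.
  by move=> i j; exact: (@measurable_sigmaT _ _ _ _ (entries U) (i, j)).
have n20 : 0 < 2 * n%:R :> R by rewrite mulr_gt0.
have tn0 : 0 <= tau * n%:R by rewrite mulr_ge0// ltW.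
(* The cross term of [sqnorm a]: given [U], its variance is [sqnorm U], below [2 * n] by [E3]. *)
have E5 := two_sided_tail gUb mU n20 tn0.
pose y (j : 'I_m.+1) : 'cV[R]_m :=
  dsubmx (spike_reflection z *m delta_mx j 0 : 'cV[R]_(1 + m)).
pose s (ij : 'I_N * 'I_m.+1) t : 'cV[R]_n :=
  resolvent (shifted (G t) (x1 + ij.1%:R)) *m (G t *m y ij.2).
have mG : measurable_mx (T := sigmaT (entries G)) G.
  by move=> i j; exact: (@measurable_sigmaT _ _ _ _ (entries G) (i, j)).
have ms ij : measurable_mx (T := sigmaT (entries G)) (s ij).
  apply: measurable_mxM; last by apply: measurable_mxM => //; exact: measurable_mx_cst.
  apply: measurable_resolvent; apply: measurable_mxB; first exact: measurable_mx_cst.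
  by apply: measurable_mxM => //; exact: measurable_mxT.
(* The summands [sb *: U] and [b] of [a] are treated separately, whence the factor [sb + 1] in front
   of [kappa]. *)
have E6 := holds_up_to_finType (fun ij => holds_up_to_and
  (two_sided_tail gGU (ms ij) v0 (ltW kap0)) (two_sided_tail gGb (ms ij) v0 (ltW kap0))).
have := holds_up_to_and (holds_up_to_and (holds_up_to_and E1 E2)
  (holds_up_to_and (holds_up_to_and E3 E3') (holds_up_to_and (holds_up_to_and E4 E4') E5))) E6.
apply: holds_up_to_le => [|t].
  rewrite card_prod !card_ord; apply: lerD; last by rewrite ler_wpM2l//; lra.
  have eh0 : 0 <= eh by exact: expR_ge0.
  have em := eh_le _ hm; have en := eh_le _ hn; have eM := eh_le _ hM; have eN := eh_le _ hN.
  have e5 : expR (- ((tau * n%:R) ^+ 2 / (2 * (2 * n%:R)))) <= eh.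
    apply: le_trans en; rewrite ler_expR lerN2.
    rewrite (_ : _ / (2 * _) = tau ^+ 2 / 4 * n%:R); last by field; rewrite gt_eqF.
    have : 0 <= tau ^+ 2 * n%:R by rewrite mulr_ge0 ?sqr_ge0// ltW.
    by lra.
  have two_eh (e1 e2 : R) : e1 <= eh -> e2 <= eh -> e1 + e2 <= 2 * eh.
    by move=> xe ye; rewrite [2 * eh]mulr_natl mulr2n lerD.
  rewrite (_ : _ * eh = (n%:R * (2 * eh) + K%:R * (2 * eh)) +
      (2 * eh + (2 * eh + 2 * eh))); last by rewrite !natrD !natrM; ring.
  apply: lerD; first by apply: lerD; rewrite ler_wpM2l// two_eh.
  apply: lerD; first exact: two_eh.
  by apply: lerD; [exact: two_eh|rewrite ler_wpM2l].
move=> [[[H1 H2] [[H3 H3'] [[H4 H4'] H5]]] H6] w L X Xw w1 Xv.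
have {}H3 : sqnorm (U t) < (1 + tau) * n%:R by rewrite ltNge; apply/negP.
have {}H3' : sqnorm (b t) < (1 + tau) * n%:R by rewrite ltNge; apply/negP.
have {}H4 : (1 - tau) * n%:R < sqnorm (U t) by rewrite ltNge; apply/negP.
have {}H4' : (1 - tau) * n%:R < sqnorm (b t) by rewrite ltNge; apply/negP.
have tn1 : tau * n%:R <= n%:R by rewrite ler_piMl// ltW.
have {}H5 : `|dot (U t) (b t)| < tau * n%:R by apply: H5; apply: ltW (lt_le_trans H3 _); lra.
have Gx0 q : sqnorm ((G t)^T *m q) <= x0 * sqnorm q.
  apply: (le_trans (H1 q)); rewrite gerBl; apply: mulr_ge0; last exact: sqr_ge0.
  by apply: mulr_ge0; [|apply: addr_ge0]; exact: sqrtr_ge0.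
have aE : sqnorm (a t) = sb ^+ 2 * sqnorm (U t) + 2 * sb * dot (U t) (b t) + sqnorm (b t).
  by rewrite /a avecE sqnormD sqnormZ dotZl mulrA.
have aA : sqnorm (a t) <= A.
  have hs := sqnorm_ge0 (sb *: U t - b t).
  have : sqnorm (a t) <= 2 * (sb ^+ 2 * sqnorm (U t)) + 2 * sqnorm (b t).
    by rewrite sqnormB sqnormZ dotZl in hs; rewrite aE; lra.
  move=> /le_trans; apply.
  have : sb ^+ 2 * sqnorm (U t) <= sb ^+ 2 * (2 * n%:R).
    by rewrite ler_wpM2l ?sqr_ge0// (le_trans (ltW H3))//; lra.
  rewrite /A; lra.
have alow : (1 + sb ^+ 2) * ((1 - tau) * n%:R) - 2 * sb * (tau * n%:R) <= sqnorm (a t).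
  have h1 : sb ^+ 2 * ((1 - tau) * n%:R) <= sb ^+ 2 * sqnorm (U t).
    by rewrite ler_wpM2l ?sqr_ge0// ltW.
  have h2 : 2 * sb * (- (tau * n%:R)) <= 2 * sb * dot (U t) (b t).
    rewrite ler_wpM2l ?mulr_ge0//; move: H5; rewrite ltr_norml => /andP[/ltW]//.
  by rewrite aE; lra.
have x1L : x1 <= L.
  have [q [q0 qn qG]] := H2.
  apply: (@eigenvalue_ge _ _ _ (Xi t) (U t) z sb z1 x1 L w w1 Xv (to_e0 (a t) *m q)).
    apply/eqP => Qq0; have : to_e0 (a t) *m (to_e0 (a t) *m q) = q.
      by rewrite mulmxA householderK mul1mx.
    rewrite Qq0 mulmx0 => q00; move: q0; rewrite -q00 mxE => /esym/eqP.
    by rewrite oner_eq0.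
  rewrite sqnorm_mulmx; last by rewrite tr_householder householderK.
  rewrite qn (le_trans Hlow)//; apply: lerD.
    rewrite (_ : dot _ _ = Num.sqrt (sqnorm (a t))); first by rewrite sqr_sqrtr ?sqnorm_ge0.
    rewrite -[signal_part _ _ _ _]/(a t) dot_mulmx tr_householder to_e0P dotZl.
    by rewrite /e0 dot_delta q0 mulr1.
  apply: (le_trans qG); rewrite trmxK mulmxA.
  by [].
have x0L : x0 < L by exact: lt_le_trans x1L.
have LN : L < x1 + N%:R.
  apply: le_lt_trans Hgrid.
  apply: (le_trans (@eigenvalue_le _ _ _ (Xi t) (U t) z sb z1 x0 L w (ltW x0_gt0) Gx0 w1 Xw)).
  by rewrite lerD2r ler_wpM2l//.
have [al0 wE] := @top_eigenvector_entries _ _ _ (Xi t) (U t) z sb z1 x0 L w (ltW x0_gt0)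
  Gx0 w1 Xw x0L.
exists (dot z w) => // j; eexists; first exact: wE.
apply: le_lt_trans Heps.
have Yy i : orthogonal_noise (Xi t) z *m delta_mx i 0 = G t *m y i.
  exact: orthogonal_noise_col.
have -> : eta * n%:R = x1 - x0 by rewrite /x1 addrAC subrr add0r.
apply: (@resolvent_grid _ _ _ (Xi t) (U t) z sb z1 x0 x1 L A _ N j (ltW x0_gt0) x01 x1L LN Gx0 aA).
move=> i; rewrite Yy.
have sv : sqnorm (s (i, j) t) <= v.
  have xi : x0 < x1 + i%:R by apply: (lt_le_trans x01); rewrite lerDl.
  apply: (le_trans (sqnorm_resolvent_le Gx0 _ xi)).
  rewrite -Yy; apply: ler_pM; rewrite ?sqnorm_ge0 ?invr_ge0 ?sqr_ge0//.
    apply: (le_trans (sqnorm_orthogonal_noise_le z1 (ltW x0_gt0) Gx0 _)).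
    rewrite (_ : sqnorm _ = 1) ?mulr1// sqnorm_dot dot_delta mxE !eqxx//.
  rewrite lef_pV2 ?posrE ?exprn_gt0 ?subr_gt0// lerXn2r ?nnegrE ?(ltW etan0) ?subr_ge0 ?(ltW xi)//.
  by rewrite (_ : x1 + i%:R - x0 = eta * n%:R + i%:R) ?lerDl// /x1; ring.
have [h1 h2] := H6 (i, j); have {}h1 := h1 sv; have {}h2 := h2 sv.
rewrite -[signal_part _ _ _ _]/(a t) /a avecE dotDr dotZr.
apply: (le_trans (ler_normD _ _)); rewrite mulrDl mul1r lerD//; last exact: ltW.
by rewrite normrM (ger0_norm sb0) ler_wpM2l// ltW.
Qed.

End RecoveryTheorem.

(** * Asymptotics *)

Section Constants.
Context {R : realType}.

Lemma geometric_sumE (q : R) K : q != 1 ->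
  \sum_(i < K) q ^+ i = (1 - q ^+ K) / (1 - q).
Proof.
move=> q1; have q1' : 1 - q != 0 by rewrite subr_eq0 eq_sym.
apply: (mulIf q1'); rewrite divfK// mulrC.
by rewrite -[1 - q ^+ K]opprB subrX1 -mulNr opprB.
Qed.

(* With [r = sqrt c / beta] and [K] tending to infinity, the right-hand side
   divided by the geometric sum tends to the almost sure limit
   [(1 + beta) * (1 + c / beta)] of the largest eigenvalue, which exceeds the edge
   [(1 + sqrt c) ^+ 2] by [(beta - sqrt c) ^+ 2 / beta]. *)
Lemma spike_constants (c beta : R) : 1 < c -> Num.sqrt c < beta ->
  let r := Num.sqrt c / beta in
  exists K : nat, exists tau eta : R, [/\ 0 < tau <= 1, 0 < eta &
    ((1 + tau) * (Num.sqrt c + 1) ^+ 2 + eta) * (\sum_(i < K.+1) (r ^+ 2) ^+ i) <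
    (1 + beta) * (1 - tau) - 2 * Num.sqrt beta * tau +
    (1 - tau) * (Num.sqrt c + r) ^+ 2 * (\sum_(i < K) (r ^+ 2) ^+ i)].
Proof.
move=> c1 cb r; set sc := Num.sqrt c in cb r *.
have c0 : 0 < c by exact: lt_trans c1.
have sc0 : 0 < sc by rewrite sqrtr_gt0.
have b0 : 0 < beta by exact: lt_trans cb.
have r0 : 0 < r by rewrite divr_gt0.
have r1 : r < 1 by rewrite ltr_pdivrMr// mul1r.
set q := r ^+ 2.
have q0 : 0 < q by rewrite exprn_gt0.
have q1 : q < 1 by rewrite expr_lt1// ltW.
pose a := (sc + r) ^+ 2 - (1 + sc) ^+ 2 * q.
pose s := fun K => \sum_(i < K) q ^+ i.
have sS K : s K.+1 = 1 + q * s K.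
  rewrite /s big_ord_recl expr0 mulr_sumr; congr (_ + _).
  by apply: eq_bigr => i _; rewrite -exprS.
have s0 K : 0 <= s K by apply: sumr_ge0 => i _; rewrite exprn_ge0// ltW.
(* The margin of the inequality at [tau = eta = 0]; its limit in [K] is positive because
   [beta > sc]. *)
pose f K := (1 + beta) + (sc + r) ^+ 2 * s K - (1 + sc) ^+ 2 * s K.+1.
have fE K : f K = ((beta - sc) ^+ 2 / beta - a * q ^+ K) / (1 - q).
  rewrite /f sS /s geometric_sumE ?lt_eqF// /a.
  have q1' : 1 - q != 0 by rewrite subr_eq0 gt_eqF.
  apply: (mulIf q1'); rewrite divfK//.
  rewrite (_ : _ * (1 - q) = (1 + beta) * (1 - q) +
      (sc + r) ^+ 2 * (1 - q ^+ K) - (1 + sc) ^+ 2 * (1 - q * q ^+ K)); last by field.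
  have hE : (1 + beta) * (1 - q) + (sc + r) ^+ 2 - (1 + sc) ^+ 2 = (beta - sc) ^+ 2 / beta.
    by rewrite /q /r; field; rewrite gt_eqF.
  by rewrite -hE; ring.
have [K fK] : exists K, 0 < f K.
  pose g := (beta - sc) ^+ 2 / beta.
  have g0 : 0 < g by rewrite divr_gt0// exprn_gt0// subr_gt0.
  have a1 : 0 < `|a| + 1 by rewrite ltr_wpDl.
  have cvq : q ^+ k @[k --> \oo] --> (0 : R).
    by apply: cvg_expr; rewrite ger0_norm// ltW.
  have [K _ hK] : \forall k \near \oo, q ^+ k < g / (`|a| + 1).
    by apply: (cvgr_lt 0 cvq); rewrite divr_gt0.
  exists K; rewrite fE divr_gt0 ?subr_gt0//.
  have := hK K (leqnn K); rewrite /= ltr_pdivlMr// -/g => h.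
  have qK : 0 < q ^+ K by rewrite exprn_gt0.
  have := ler_norm a; nra.
(* The coefficient of [tau] in the loss. The choices below spend half of the margin on [tau] and a
   quarter on [eta]; [f K <= D1] ensures [tau <= 1]. *)
pose D1 := (1 + beta) + 2 * Num.sqrt beta + (sc + r) ^+ 2 * s K + (1 + sc) ^+ 2 * s K.+1.
have sb0 : 0 <= Num.sqrt beta by exact: sqrtr_ge0.
have h1 : 0 <= (sc + r) ^+ 2 * s K by rewrite mulr_ge0 ?sqr_ge0.
have h2 : 0 <= (1 + sc) ^+ 2 * s K.+1 by rewrite mulr_ge0 ?sqr_ge0.
have D10 : 0 < D1 by rewrite /D1; lra.
have fD : f K <= D1 by rewrite /D1 /f; lra.
have s1 : 0 < s K.+1 by rewrite sS ltr_wpDr// mulr_ge0// ltW.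
exists K, (f K / (2 * D1)), (f K / (4 * s K.+1)).
set tau := f K / (2 * D1).
have tauD : tau * D1 = f K / 2 by rewrite /tau; field; rewrite gt_eqF.
have tau0 : 0 < tau by rewrite divr_gt0// mulr_gt0.
split.
- by rewrite tau0/= ler_pdivrMr ?mulr_gt0// mul1r; lra.
- by rewrite divr_gt0// mulr_gt0.
rewrite -/q -/(s K) -/(s K.+1) -subr_gt0.
set rhs := (X in X - _); set lhs := (X in _ - X).
have -> : rhs - lhs = f K - tau * D1 - f K / (4 * s K.+1) * s K.+1.
  by rewrite /rhs /lhs /D1 /f; ring.
rewrite tauD (_ : f K / (4 * s K.+1) * s K.+1 = f K / 4); last first.
  by field; rewrite gt_eqF.
by lra.
Qed.

End Constants.

(** * From fixed sizes to high probability *)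

Section HighProbability.
Context {R : realType}.

(** Complements of the exceptional sets serve as inner approximations, and the empty set for those
    [n] where no bound is available. *)
Lemma whp_holds_up_to (d : nat -> measure_display)
    (T : forall n, measurableType (d n)) (P : forall n, probability (T n) R)
    (E : forall n, set (T n)) (e : nat -> R) :
  e n @[n --> \oo] --> (0 : R) ->
  (\forall n \near \oo, holds_up_to (P n) (e n) (E n)) ->
  with_high_probability P E.
Proof.
move=> e0 hE.
have hA n : exists A : set (T n), [/\ measurable A, A `<=` E n &
    (holds_up_to (P n) (e n) (E n) -> ((1 - e n)%:E <= P n A)%E)].
  have [h|h] := pselect (holds_up_to (P n) (e n) (E n)); last by exists set0; split.
  have [N [mN PN NE]] := h; exists (~` N); split => [|t /NE//|_].
    exact: measurableC.
  by rewrite probability_setC// EFinB leeB.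
pose A n := sval (cid (hA n)).
have mA n : measurable (A n) by rewrite /A; case: cid => ? [].
have AE n : A n `<=` E n by rewrite /A; case: cid => ? [].
have PA n : holds_up_to (P n) (e n) (E n) -> ((1 - e n)%:E <= P n (A n))%E.
  by rewrite /A; case: cid => ? [].
exists A; split => //.
apply: (@squeeze_cvge _ _ _ _ (fun n => (1 - e n)%:E) _ (fun=> 1%E)).
- near=> n; rewrite probability_le1// andbT; apply: PA.
  by near: n.
- apply: cvg_EFin; first by near=> n.
  by rewrite -[X in _ --> X]subr0; apply: cvgB => //; exact: cvg_cst.
- exact: cvg_cst.
Unshelve. all: by end_near. Qed.

End HighProbability.

Section SpikedModel.
Context {R : realType}.

Lemma l2norm_eq1 p (v : 'cV[R]_p) : l2norm v = 1 -> sqnorm v = 1.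
Proof.
move=> h; have s0 : 0 <= sqnorm v by exact: sqnorm_ge0.
by rewrite -(sqr_sqrtr s0) -/(l2norm v) h expr1n.
Qed.

Context {d} {T : measurableType d} (P : probability T R).

Lemma sample_covarianceE n p (u : 'I_n -> {RV P >-> R}) (xi : 'I_n -> 'I_p.+1 -> {RV P >-> R})
    beta (z : 'cV[R]_p.+1) t :
  let X := data_matrix (\matrix_(i, j) xi i j t) (uvec (fun i => u i : T -> R) t) z
             (Num.sqrt beta) in
  sample_covariance (fun i => spike_sample u xi beta z i t) = n%:R^-1 *: (X^T *m X).
Proof.
move=> X; rewrite /sample_covariance; congr (_ *: _).
apply/matrixP => a b; rewrite summxE !mxE; apply: eq_bigr => i _.
rewrite !mxE big_ord1 !mxE !big_ord1 !mxE.
by congr (_ * _); ring.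
Qed.

Lemma leading_eigenvector_rayleigh n p (X : 'M[R]_(n, p)) (w : 'cV[R]_p) : (0 < n)%N ->
  leading_unit_eigenvector (n%:R^-1 *: (X^T *m X)) w ->
  exists L, [/\ X^T *m (X *m w) = L *: w, sqnorm w = 1 &
    forall x, sqnorm (X *m x) <= L * sqnorm x].
Proof.
move=> n0 [/l2norm_eq1 w1 [l wl lmax]].
have nn : n%:R != 0 :> R by rewrite pnatr_eq0 -lt0n.
have n_gt0 : 0 < n%:R :> R by rewrite ltr0n.
exists (n%:R * l); split => // [|x].
  by rewrite -scalerA -wl -scalemxAl scalerA divff// scale1r mulmxA.
have := rayleigh_le (S := n%:R^-1 *: (X^T *m X)) _ lmax x.
rewrite linearZ/= trmx_mul trmxK => /(_ erefl).
rewrite -scalemxAl dotZr -mulmxA => h.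
rewrite -mulrA mulrC -ler_pdivrMr// mulrC; apply: le_trans h.
by rewrite ler_pM2l ?invr_gt0// dot_mulmx trmxK sqnorm_dot.
Qed.

Lemma recovery_fixed_size n p k (u : 'I_n -> {RV P >-> R})
    (xi : 'I_n -> 'I_p -> {RV P >-> R}) (z : 'cV[R]_p) (beta : R)
    (w1 : T -> 'cV[R]_p) (supp_k : T -> {set 'I_p})
    (tau r eta kappa : R) (K M' N' h N : nat) :
  let m := p.-1 in
  let sb := Num.sqrt beta in
  let x0 := (Num.sqrt ((1 + tau) * m%:R) + Num.sqrt ((1 + tau) * n%:R)) ^+ 2 in
  let x1 := x0 + eta * n%:R in
  let A := 4 * (1 + beta) * n%:R in
  let v := x0 / (eta * n%:R) ^+ 2 in
  (0 < n)%N -> 0 <= beta -> sparse_spike k z -> iid_gaussian_inputs u xi ->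
  (forall t, leading_unit_eigenvector
     (sample_covariance (fun i => spike_sample u xi beta z i t)) (w1 t)) ->
  (forall t, largest_entries k (w1 t) (supp_k t)) ->
  0 < tau <= 1 -> 0 <= r -> 0 < eta -> 0 < kappa ->
  (N' + K <= n.-1)%N -> (M' + K <= m)%N -> (h <= M')%N -> (h <= N')%N ->
  x1 * (\sum_(i < K.+1) (r ^+ 2) ^+ i) <=
    (1 + beta) * ((1 - tau) * n%:R) - 2 * sb * (tau * n%:R) +
    (Num.sqrt ((1 - tau) * M'%:R) + r * Num.sqrt ((1 - tau) * N'%:R)) ^+ 2 *
      (\sum_(i < K) (r ^+ 2) ^+ i) ->
  2 * A + 2 * x0 < x1 + N%:R ->
  (sb + 1) * kappa + Num.sqrt (x0 * A) / (eta * n%:R) ^+ 2 < (2 * Num.sqrt k%:R)^-1 ->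
  holds_up_to P
    ((2 * n + 2 * K + 6)%:R * expR (- (tau ^+ 2 / 16 * h%:R)) +
     (N * p)%:R * (4 * expR (- (kappa ^+ 2 / (2 * v)))))
    [set t | supp_k t = supp z].
Proof.
case: n u xi => [//|n'] u xi.
case: p xi z w1 supp_k => [|m'] xi z w1 supp_k m sb x0 x1 A v _ beta0 zs inp w1P skP
  tau01 r0 eta0 kap0 nN mM hM hN Hlow Hgrid Heps.
  (* Dimension zero contains no unit vector. *)
  have [z1 _ _] := zs; have := l2norm_eq1 z1; rewrite /sqnorm big_ord0 => /esym/eqP.
  by rewrite oner_eq0.
have [z1 _ _] := zs; have {}z1 := l2norm_eq1 z1.
have sb0 : 0 <= sb by exact: sqrtr_ge0.
have sb2 : sb ^+ 2 = beta by rewrite sqr_sqrtr.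
have gW := gauss_family_inputs inp.
have := spike_recovery_bound z1 gW tau01 sb0 r0 eta0 kap0 nN mM hM hN.
rewrite sb2 => /(_ _ _ Hlow Hgrid Heps); apply: holds_up_to_le => // t ht /=.
have := w1P t; rewrite sample_covarianceE => /(leading_eigenvector_rayleigh (ltn0Sn n')).
move=> [L [wL w1' Lmax]].
have [al al0 we] := ht _ _ wL w1' Lmax.
exact: supp_eq_largest zs al0 we (skP t).
Qed.

End SpikedModel.

Section Ratios.
Context {R : realType}.

Lemma cvg_natinv : (n%:R : R)^-1 @[n --> \oo] --> (0 : R).
Proof.
apply/cvgrPdist_lt => e e0; near=> n.
rewrite sub0r normrN ger0_norm ?invr_ge0//.
have n0 : 0 < n%:R :> R by rewrite ltr0n; near: n; exact: nbhs_infty_gt.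
rewrite -(ltf_pV2 _ _) ?posrE ?invr_gt0// invrK.
by near: n; exact: nbhs_infty_gtr.
Unshelve. all: by end_near. Qed.

Lemma cvg_ratio_sub (f : nat -> nat) (a : R) K :
  ((f n)%:R / n%:R : R) @[n --> \oo] --> a ->
  ((f n - K)%:R / n%:R : R) @[n --> \oo] --> a.
Proof.
move=> fa; apply: (squeeze_cvgr (f := fun n => (f n)%:R / n%:R - K%:R * n%:R^-1) _ _ fa).
  near=> n; rewrite -mulrBl; apply/andP; split; apply: ler_wpM2r; rewrite ?invr_ge0//.
    by rewrite lerBlDr -natrD ler_nat addnC -leq_subLR.
  by rewrite ler_nat leq_subr.
rewrite -[X in _ --> X]subr0 -[X in _ - X](mulr0 K%:R).
by apply: cvgB => //; apply: cvgMr; exact: cvg_natinv.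
Unshelve. all: by end_near. Qed.

Lemma cvg_sqrt_scaled (f : nat -> R) (a s : R) :
  f n @[n --> \oo] --> a ->
  Num.sqrt (s * f n) @[n --> \oo] --> Num.sqrt (s * a).
Proof.
move=> fa; have sfa : s * f n @[n --> \oo] --> s * a by exact: cvgMr.
exact: (cvg_comp _ _ sfa (@sqrt_continuous R (s * a))).
Qed.

Lemma sqrtM_ratio (s : R) (m n : nat) : 0 <= s -> (0 < n)%N ->
  Num.sqrt (s * m%:R) = Num.sqrt (s * (m%:R / n%:R)) * Num.sqrt n%:R.
Proof.
move=> s0 n0; rewrite -sqrtrM ?mulr_ge0//; first by rewrite -mulrA divfK// pnatr_eq0 -lt0n.
Qed.

Lemma sqrt_combination (s r : R) (m l n : nat) : 0 <= s -> (0 < n)%N ->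
  (Num.sqrt (s * m%:R) + r * Num.sqrt (s * l%:R)) ^+ 2 =
  (Num.sqrt (s * (m%:R / n%:R)) + r * Num.sqrt (s * (l%:R / n%:R))) ^+ 2 * n%:R.
Proof.
move=> s0 n0; rewrite (sqrtM_ratio m s0 n0) (sqrtM_ratio l s0 n0) (mulrA r) -mulrDl exprMn.
by rewrite sqr_sqrtr.
Qed.

Lemma cvg_combination (s r a b : R) (f g : nat -> R) : 0 <= s -> 0 <= a ->
  f n @[n --> \oo] --> a -> g n @[n --> \oo] --> (1 : R) ->
  (Num.sqrt (s * f n) + r * Num.sqrt (s * g n)) ^+ 2 @[n --> \oo] -->
  s * (Num.sqrt a + r) ^+ 2.
Proof.
move=> s0 a0 fa g1.
have -> : s * (Num.sqrt a + r) ^+ 2 = (Num.sqrt (s * a) + r * Num.sqrt (s * 1)) ^+ 2.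
  by rewrite mulr1 sqrtrM// -[in LHS](sqr_sqrtr s0); ring.
have h : Num.sqrt (s * f n) + r * Num.sqrt (s * g n) @[n --> \oo] -->
    Num.sqrt (s * a) + r * Num.sqrt (s * 1).
  by apply: cvgD; [exact: cvg_sqrt_scaled|apply: cvgMr; exact: cvg_sqrt_scaled].
by rewrite expr2; apply: (cvg_trans _ (cvgM h h)).
Qed.

(** Strong enough to make [n] times an exponentially small term an explicit [O(1 / n)]. *)
Lemma expR_quadratic_decay (x : R) : 0 < x -> expR (- x) <= 4 / x ^+ 2.
Proof.
move=> x0; rewrite expRN -[4 / _]invrK lef_pV2 ?posrE ?expR_gt0 ?invr_gt0 ?divr_gt0 ?exprn_gt0//.
rewrite invf_div (_ : x = x / 2 + x / 2) in |- *; last by field.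
rewrite expRD; have h := expR_ge1Dx (x / 2).
have -> : (x / 2 + x / 2) ^+ 2 / 4 = (x / 2) * (x / 2) by field.
by apply: ler_pM; lra.
Qed.

End Ratios.

Section Eventually.
Context {R : realType}.
Variables (c tau : R) (m : nat -> nat).
Hypotheses (c0 : 0 <= c) (tau01 : 0 < tau <= 1).
Hypothesis m_over_n : ((m n)%:R / n%:R : R) @[n --> \oo] --> c.

Let x0 n := (Num.sqrt ((1 + tau) * (m n)%:R) + Num.sqrt ((1 + tau) * n%:R)) ^+ 2.

Let cvg_id : ((id n)%:R / n%:R : R) @[n --> \oo] --> (1 : R).
Proof.
apply: cvg_near_cst; near=> n; rewrite divff// pnatr_eq0 -lt0n.
by near: n; exact: nbhs_infty_gt.
Unshelve. all: by end_near. Qed.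

Let cvg_x0 : x0 n / n%:R @[n --> \oo] --> (1 + tau) * (Num.sqrt c + 1) ^+ 2.
Proof.
have [t0 t1] := andP tau01.
have s0 : 0 <= 1 + tau by lra.
apply: (cvg_trans _ (cvg_combination 1 s0 c0 m_over_n cvg_id)).
apply: near_eq_cvg; near=> n.
have n0 : (0 < n)%N by near: n; exact: nbhs_infty_gt.
have := sqrt_combination 1 (m n) n s0 n0; rewrite mul1r -/(x0 n) => ->.
by rewrite mulfK// pnatr_eq0 -lt0n.
Unshelve. all: by end_near. Qed.

Lemma edge_eventually_le :
  \forall n \near \oo, x0 n <= ((1 + tau) * (Num.sqrt c + 1) ^+ 2 + 1) * n%:R.
Proof.
near=> n; have n0 : 0 < n%:R :> R by rewrite ltr0n; near: n; exact: nbhs_infty_gt.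
rewrite -ler_pdivrMr//; near: n.
by apply: (cvgr_le _ cvg_x0); rewrite ltrDl.
Unshelve. all: by end_near. Qed.

(** Divided by [n], the two sides converge to the two sides of the strict hypothesis. *)
Lemma outlier_eventually (a b r eta S S' : R) (K : nat) :
  ((1 + tau) * (Num.sqrt c + 1) ^+ 2 + eta) * S' <
    a * (1 - tau) - b * tau + (1 - tau) * (Num.sqrt c + r) ^+ 2 * S ->
  \forall n \near \oo, (x0 n + eta * n%:R) * S' <=
    a * ((1 - tau) * n%:R) - b * (tau * n%:R) +
    (Num.sqrt ((1 - tau) * (m n - K)%:R) + r * Num.sqrt ((1 - tau) * (n.-1 - K)%:R)) ^+ 2 * S.
Proof.
move=> H; have [t0 t1] := andP tau01.
have s0 : 0 <= 1 - tau by lra.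
have cvm := cvg_ratio_sub K m_over_n.
(* [K.+1] because [n.-1 - K = n - K.+1]. *)
have cvn := cvg_ratio_sub K.+1 cvg_id.
have cvc := cvg_combination r s0 c0 cvm cvn.
pose F n := (a * (1 - tau) - b * tau +
    (Num.sqrt ((1 - tau) * ((m n - K)%:R / n%:R)) +
     r * Num.sqrt ((1 - tau) * ((n - K.+1)%:R / n%:R))) ^+ 2 * S) - (x0 n / n%:R + eta) * S'.
have cvF : F n @[n --> \oo] --> (a * (1 - tau) - b * tau +
    (1 - tau) * (Num.sqrt c + r) ^+ 2 * S) -
    ((1 + tau) * (Num.sqrt c + 1) ^+ 2 + eta) * S'.
  apply: cvgB; first by apply: cvgD; [exact: cvg_cst|apply: cvgMl].
  by apply: cvgMl; apply: cvgD; [exact: cvg_x0|exact: cvg_cst].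
near=> n; have n0 : (0 < n)%N by near: n; exact: nbhs_infty_gt.
have nR : 0 < n%:R :> R by rewrite ltr0n.
rewrite -subn1 -subnDA add1n (sqrt_combination _ _ _ s0 n0) -subr_ge0.
have -> : forall y : R, a * ((1 - tau) * n%:R) - b * (tau * n%:R) + y * n%:R * S -
    (x0 n + eta * n%:R) * S' =
    n%:R * (a * (1 - tau) - b * tau + y * S - (x0 n / n%:R + eta) * S').
  by move=> y; field; rewrite gt_eqF.
rewrite mulr_ge0 ?ltW// -/(F n); near: n.
by apply: (cvgr_gt _ cvF); rewrite subr_gt0.
Unshelve. all: by end_near. Qed.

End Eventually.

Section FailureProbability.
Context {R : realType}.

(** [64] is [16 * 4], from [n <= 4 * n./2] for [n > 1]. *)
Lemma rotation_failure_le (tau : R) (n K : nat) : 0 < tau -> (1 < n)%N ->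
  (2 * n + 2 * K + 6)%:R * expR (- (tau ^+ 2 / 16 * (n./2)%:R)) <=
  (2 * K + 8)%:R * 4 * 64 ^+ 2 / tau ^+ 4 / n%:R.
Proof.
move=> t0 n1; have n0 : 0 < n%:R :> R by rewrite ltr0n ltnW.
have hn : n%:R <= 4 * (n./2)%:R :> R.
  by rewrite -natrM ler_nat -{1}(odd_double_half n); case: n n1 {n0} => [|[|n]] //= _;
    case: (odd n); rewrite ?add0n -?muln2; lia.
have y0 : 0 < tau ^+ 2 / 64 * n%:R by rewrite mulr_gt0// divr_gt0// exprn_gt0.
have -> : (2 * K + 8)%:R * 4 * 64 ^+ 2 / tau ^+ 4 / n%:R =
    (2 * K + 8)%:R * n%:R * (4 / (tau ^+ 2 / 64 * n%:R) ^+ 2) :> R.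
  by field; rewrite ?gt_eqF.
apply: ler_pM; rewrite ?expR_ge0//.
  by rewrite -natrM ler_nat; nia.
apply: le_trans (expR_quadratic_decay y0); rewrite ler_expR lerN2.
have : 0 <= tau ^+ 2 by exact: sqr_ge0.
by nra.
Qed.

(** The smallness of [k * ln p] makes each exponent at least [4 * ln p], so that every event has
    probability [O(p ^ -4)]; there are [N * n * p] of them, and [n ^ 2 <= p ^ 3]. *)
Lemma resolvent_failure_le (n p k N : nat) (kappa eta x0 C : R) :
  (0 < n <= p)%N -> (0 < k)%N -> 0 < kappa -> 0 < eta -> 0 < x0 <= C * n%:R ->
  8 * C * (k%:R * ln p%:R) <= (kappa * eta) ^+ 2 * n%:R ->
  (N * n * p)%:R * (4 * expR (- ((kappa / Num.sqrt k%:R) ^+ 2 /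
     (2 * (x0 / (eta * n%:R) ^+ 2))))) <= 4 * N%:R / n%:R.
Proof.
move=> /andP[n0 np] k0 kap0 eta0 /andP[x00 x0C] hk.
have nR : 0 < n%:R :> R by rewrite ltr0n.
have kR : 0 < k%:R :> R by rewrite ltr0n.
have p0 : (0 < p)%N by exact: leq_trans np.
have pR : 0 < p%:R :> R by rewrite ltr0n.
have npR : n%:R <= p%:R :> R by rewrite ler_nat.
have le4 : 4 * ln p%:R <= (kappa / Num.sqrt k%:R) ^+ 2 / (2 * (x0 / (eta * n%:R) ^+ 2)) :> R.
  rewrite expr_div_n sqr_sqrtr// (_ : _ / _ = (kappa * eta) ^+ 2 * n%:R ^+ 2 / (2 * k%:R * x0)).
    rewrite ler_pdivlMr ?mulr_gt0//.
    have lnp : 0 <= ln p%:R :> R by rewrite ln_ge0// ler1n.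
    apply: (@le_trans _ _ (8 * C * (k%:R * ln p%:R) * n%:R)); last first.
      by rewrite [n%:R ^+ 2]expr2 (mulrA ((kappa * eta) ^+ 2)) ler_pM2r.
    have : 8 * (k%:R * ln p%:R) * x0 <= 8 * (k%:R * ln p%:R) * (C * n%:R).
      by rewrite ler_wpM2l// !mulr_ge0.
    lra.
  by field; rewrite ?gt_eqF.
have h : expR (- ((kappa / Num.sqrt k%:R) ^+ 2 / (2 * (x0 / (eta * n%:R) ^+ 2)))) <=
    (p%:R ^+ 4)^-1.
  rewrite expRN lef_pV2 ?posrE ?expR_gt0 ?exprn_gt0//; apply: le_trans (_ : _ <= expR (4 * ln p%:R)) _.
    by rewrite expRM_natl lnK ?posrE.
  by rewrite ler_expR.
apply: (@le_trans _ _ ((N * n * p)%:R * (4 * (p%:R ^+ 4)^-1))).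
  by rewrite ler_wpM2l// ler_wpM2l.
have -> : (N * n * p)%:R * (4 * (p%:R ^+ 4)^-1) = 4 * N%:R * (n%:R / p%:R ^+ 3) :> R.
  by rewrite !natrM; field; rewrite gt_eqF.
apply: ler_wpM2l => //.
rewrite ler_pdivrMr ?exprn_gt0// mulrC ler_pdivlMr//.
have : (n * n <= p ^ 3)%N.
  by apply: leq_trans (leq_mul np np) _; rewrite expnS mulnn leq_pmull.
by rewrite -(ler_nat R) natrX natrM.
Qed.

(** Each summand takes at most [1 / (8 * sqrt k)]: the first by the choice of [kappa], the second
    because it is at most [C4 / n] and [sqrt k <= k]. *)
Lemma threshold_lt (n k : nat) (sb eta x0 C A : R) :
  (0 < n)%N -> (0 < k)%N -> 0 <= sb -> 0 < eta -> 0 <= x0 <= C * n%:R -> 0 <= A ->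
  8 * (Num.sqrt (C * A) / eta ^+ 2 + 1) * k%:R < n%:R ->
  (sb + 1) * ((8 * (sb + 1))^-1 / Num.sqrt k%:R) +
    Num.sqrt (x0 * (A * n%:R)) / (eta * n%:R) ^+ 2 < (2 * Num.sqrt k%:R)^-1.
Proof.
move=> n0 k0 sb0 eta0 /andP[x00 x0C] A0 hk.
have nR : 0 < n%:R :> R by rewrite ltr0n.
have kR : 0 < k%:R :> R by rewrite ltr0n.
have k1 : 1 <= k%:R :> R by rewrite ler1n.
set s := Num.sqrt k%:R; have s0 : 0 < s by rewrite sqrtr_gt0.
have s2 : s ^+ 2 = k%:R by rewrite sqr_sqrtr.
have sk : s <= k%:R by nra.
set C4 := Num.sqrt (C * A) / eta ^+ 2 in hk *.
have C40 : 0 <= C4 by rewrite divr_ge0 ?sqrtr_ge0 ?sqr_ge0.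
have le1 : Num.sqrt (x0 * (A * n%:R)) / (eta * n%:R) ^+ 2 <= C4 / n%:R.
  have en0 : 0 < (eta * n%:R) ^+ 2 by rewrite exprn_gt0// mulr_gt0.
  rewrite ler_pdivrMr// (_ : _ / _ * _ = Num.sqrt (C * A) * n%:R).
    have C0 : 0 <= C by rewrite -(pmulr_lge0 _ nR); exact: le_trans x0C.
    rewrite -[in leRHS](ger0_norm (ltW nR)) -sqrtr_sqr -sqrtrM ?mulr_ge0//.
    by apply: ler_wsqrtr; rewrite expr2 mulrACA ler_wpM2r// mulr_ge0// ltW.
  by rewrite /C4; field; rewrite ?gt_eqF.
have -> : (sb + 1) * ((8 * (sb + 1))^-1 / s) = s^-1 / 8 by field; rewrite !gt_eqF//; lra.
have -> : (2 * s)^-1 = s^-1 / 2 by rewrite invfM mulrC.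
have sV0 : 0 < s^-1 by rewrite invr_gt0.
suff : C4 / n%:R < s^-1 / 8 by lra.
rewrite ltr_pdivrMr// -mulrA mulrC ltr_pdivlMr//.
by nra.
Qed.

End FailureProbability.

Lemma half_size_bounds (n p K : nat) : (2 * K + 4 < n)%N -> (n < p)%N ->
  [/\ (n./2 <= p.-1 - K)%N, (n./2 <= n.-1 - K)%N, (n.-1 - K + K <= n.-1)%N &
    (p.-1 - K + K <= p.-1)%N].
Proof. by have := odd_double_half n; rewrite -muln2; split; lia. Qed.

Theorem theorem1p1 (R : realType) (c beta : R)
  (c_gt1 : 1 < c) (beta_gt : Num.sqrt c < beta)
  (p k : nat -> nat)
  (p_oo : p n @[n --> \oo] --> \oo)
  (k_oo : k n @[n --> \oo] --> \oo)
  (p_over_n : ((p n)%:R / n%:R : R) @[n --> \oo] --> c)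
  (k_small :
    ((k n)%:R / (n%:R / ln (p n)%:R) : R) @[n --> \oo] --> (0 : R))
  (z : forall n, 'cV[R]_(p n))
  (z_spike : forall n, sparse_spike (k n) (z n))
  (d : nat -> measure_display) (T : forall n, measurableType (d n))
  (P : forall n, probability (T n) R)
  (u : forall n, 'I_n -> {RV (P n) >-> R})
  (xi : forall n, 'I_n -> 'I_(p n) -> {RV (P n) >-> R})
  (inputs : forall n, iid_gaussian_inputs (u n) (xi n))
  (w1 : forall n, T n -> 'cV[R]_(p n))
  (w1_leading : forall n (t : T n),
    leading_unit_eigenvector
      (sample_covariance
         (fun i => spike_sample (u n) (xi n) beta (z n) i t))
      (w1 n t))
  (supp_k : forall n, T n -> {set 'I_(p n)})
  (supp_kP : forall n (t : T n),
    largest_entries (k n) (w1 n t) (supp_k n t)) :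
  with_high_probability P
    (fun n => [set t : T n | supp_k n t = supp (z n)]).
Proof.
have sc0 : 0 <= Num.sqrt c by exact: sqrtr_ge0.
have beta0 : 0 < beta by exact: le_lt_trans beta_gt.
have c0 : 0 <= c by lra.
have [K [tau [eta [tau01 eta0 Hk]]]] := spike_constants c_gt1 beta_gt.
have [tau0 tau1] := andP tau01.
set r := Num.sqrt c / beta in Hk; set sb := Num.sqrt beta in Hk.
have sb0 : 0 <= sb by exact: sqrtr_ge0.
have r0 : 0 <= r by rewrite divr_ge0// ltW.
pose m n := (p n).-1.
have m_over_n : ((m n)%:R / n%:R : R) @[n --> \oo] --> c.
  have := cvg_ratio_sub 1 p_over_n.
  by rewrite (_ : (fun n => _) = fun n => (m n)%:R / n%:R)//; apply/funext => n; rewrite subn1.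
pose C0 : R := (1 + tau) * (Num.sqrt c + 1) ^+ 2 + 1.
have C0_ge0 : 0 <= C0 by rewrite addr_ge0// mulr_ge0 ?sqr_ge0//; lra.
pose A : R := 4 * (1 + beta).
have A0 : 0 <= A by rewrite /A; lra.
(* The grid has [C2 * n] points, since [L <= (2 * A + 2 * C0) * n]. *)
pose C2 := (Num.truncn (2 * A + 2 * C0)).+1.
have C2P : 2 * A + 2 * C0 < C2%:R by exact: truncnS_gt.
pose kap0 : R := (8 * (sb + 1))^-1.
have kap00 : 0 < kap0 by rewrite invr_gt0; lra.
pose Cr : R := (2 * K + 8)%:R * 4 * 64 ^+ 2 / tau ^+ 4.
apply: (@whp_holds_up_to _ _ _ _ _ (fun n => (Cr + 4 * C2%:R) * n%:R^-1)).
  by rewrite -(mulr0 (Cr + 4 * C2%:R)); apply: cvgMr; exact: cvg_natinv.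
have klnp (D : R) : 0 < D ->
    \forall n \near \oo, D * ((k n)%:R * ln (p n)%:R) < n%:R.
  move=> D0; near=> n.
  have n0 : 0 < n%:R :> R by rewrite ltr0n; near: n; exact: nbhs_infty_gt.
  have : (k n)%:R / (n%:R / ln (p n)%:R) < D^-1 :> R.
    by near: n; apply: (cvgr_lt _ k_small); rewrite invr_gt0.
  by rewrite invf_div (mulrA (k n)%:R) ltr_pdivrMr// (mulrC D^-1) ltr_pdivlMr// (mulrC _ D).
pose D1 : R := 8 * (Num.sqrt (C0 * A) / eta ^+ 2 + 1).
have D10 : 0 < D1.
  by rewrite mulr_gt0// ltr_wpDl// divr_ge0 ?sqrtr_ge0 ?sqr_ge0.
pose D2 : R := 8 * (C0 + 1) / (kap0 * eta) ^+ 2.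
have D20 : 0 < D2 by rewrite divr_gt0 ?exprn_gt0 ?mulr_gt0//; lra.
near=> n.
have nK : (2 * K + 4 < n)%N by near: n; exact: nbhs_infty_gt.
have n1 : (1 < n)%N by apply: leq_ltn_trans nK; rewrite addnS.
have n0 : (0 < n)%N by exact: ltnW.
have nR : 0 < n%:R :> R by rewrite ltr0n.
have np : (n < p n)%N.
  rewrite -(ltr_nat R) -[ltLHS]mul1r -ltr_pdivlMr//.
  by near: n; exact: (cvgr_gt _ p_over_n).
have k0 : (0 < k n)%N by near: n; exact: (k_oo _ (nbhs_infty_gt 0)).
(* Makes [ln p >= 1], so that a bound on [k * ln p] also bounds [k]. *)
have pe : expR 1 <= (p n)%:R :> R.
  by near: n; exact: (p_oo _ (nbhs_infty_ger (expR 1))).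
have lnp1 : 1 <= ln (p n)%:R :> R.
  by rewrite -[leLHS](expRK 1) ler_ln// ?posrE ?expR_gt0// ltr0n (leq_trans n0 (ltnW np)).
have kn : D1 * (k n)%:R < n%:R.
  apply: le_lt_trans (_ : _ <= D1 * ((k n)%:R * ln (p n)%:R)) _.
    by rewrite ler_pM2l// ler_peMr.
  by near: n; exact: klnp.
have kn2 : 8 * C0 * ((k n)%:R * ln (p n)%:R) <= (kap0 * eta) ^+ 2 * n%:R.
  have h : D2 * ((k n)%:R * ln (p n)%:R) < n%:R by near: n; exact: klnp.
  have kl0 : 0 <= (k n)%:R * ln (p n)%:R :> R by rewrite mulr_ge0// (le_trans _ lnp1).
  move: h; rewrite /D2 mulrAC ltr_pdivrMr ?exprn_gt0 ?mulr_gt0// => h.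
  by nra.
have x0C : (Num.sqrt ((1 + tau) * (m n)%:R) + Num.sqrt ((1 + tau) * n%:R)) ^+ 2 <= C0 * n%:R.
  by near: n; exact: edge_eventually_le.
have Hlow : (((Num.sqrt ((1 + tau) * (m n)%:R) + Num.sqrt ((1 + tau) * n%:R)) ^+ 2) +
      eta * n%:R) * \sum_(i < K.+1) (r ^+ 2) ^+ i <=
    (1 + beta) * ((1 - tau) * n%:R) - 2 * sb * (tau * n%:R) +
    (Num.sqrt ((1 - tau) * (m n - K)%:R) + r * Num.sqrt ((1 - tau) * (n.-1 - K)%:R)) ^+ 2 *
      \sum_(i < K) (r ^+ 2) ^+ i.
  by near: n; exact: (outlier_eventually c0 tau01 m_over_n K Hk).
set x0 := (X in X <= C0 * _) in x0C Hlow.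
have tau2 : 0 < 1 + tau by rewrite addr_gt0.
have x00 : 0 < x0 by rewrite exprn_gt0// ltr_wpDl ?sqrtr_ge0// sqrtr_gt0 mulr_gt0.
have kap : 0 < kap0 / Num.sqrt (k n)%:R by rewrite divr_gt0// sqrtr_gt0 ltr0n.
have [hM hN nKn mKm] := half_size_bounds nK np.
have Hgrid : 2 * (4 * (1 + beta) * n%:R) + 2 * x0 < x0 + eta * n%:R + (C2 * n)%:R.
  rewrite natrM; have : 0 < eta * n%:R by rewrite mulr_gt0.
  have : (2 * A + 2 * C0) * n%:R < C2%:R * n%:R by rewrite ltr_pM2r.
  by rewrite -/A; lra.
have x00' : 0 <= x0 <= C0 * n%:R by rewrite ltW.
have Heps := threshold_lt n0 k0 sb0 eta0 x00' A0 kn.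
apply: (holds_up_to_le _ _ (recovery_fixed_size n0 (ltW beta0) (z_spike n) (inputs n)
  (w1_leading n) (supp_kP n) tau01 r0 eta0 kap nKn mKm hM hN Hlow Hgrid Heps)).
  rewrite (mulrDl Cr); apply: lerD; first exact: rotation_failure_le.
  apply: (@resolvent_failure_le _ n (p n) (k n) C2 kap0 eta x0 C0) => //.
    by rewrite n0/= ltnW.
  by rewrite x00.
by [].
Unshelve. all: by end_near. Qed.
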